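(* There is an algorithm that, given an instance $\mathcal{K}$ of the budgeted matroid independent set (BMI) problem and a parameter $0<\varepsilon<\frac{1}{2}$, outputs a solution for $\mathcal{K}$ of profit at least $(1-\varepsilon)\cdot \mathrm{OPT}(\mathcal{K})$ in time $2^{O\left(\varepsilon^{-2}\log\frac{1}{\varepsilon}\right)}\cdot \mathrm{poly}(|\mathcal{K}|)$.
   Context: A BMI instance is a tuple $\mathcal{K}=(E,\mathcal{I},c,p,\beta)$: a finite ground set $E$, a collection $\mathcal{I}\subseteq 2^E$ given by a membership oracle such that $(E,\mathcal{I})$ is a matroid, a budget $\beta>0$, a cost function $c:E\to[0,\beta]$ and a profit function $p:E\to\mathbb{R}_{\ge 0}$. A solution is a set $X\in\mathcal{I}$ with $c(X)=\sum_{e\in X}c(e)\le\beta$; its profit is $p(X)=\sum_{e\in X}p(e)$. $\mathrm{OPT}(\mathcal{K})$ denotes the maximum profit of a solution, and $|\mathcal{K}|$ the bit-length encoding size of the instance. *)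

(* Defs.v *)
From HB Require Import structures.
From mathcomp Require Import all_boot all_order all_algebra.
From mathcomp Require Import reals.

Set Implicit Arguments.
Unset Strict Implicit.
Unset Printing Implicit Defensive.

Import Order.TTheory GRing.Theory Num.Theory.
Local Open Scope ring_scope.

Definition matroid (E : finType) (I : {set {set E}}) : Prop :=
  [/\ set0 \in I,
      forall X Y : {set E}, Y \in I -> X \subset Y -> X \in I
    & forall X Y : {set E}, X \in I -> Y \in I -> (#|X| < #|Y|)%N ->
        exists2 e, e \in Y :\: X & e |: X \in I].

(* Numbers are rational, since instances have a bit-length. *)
Record bmi := Bmi {
  ground : finType;
  indep : {set {set ground}};
  cost : ground -> rat;
  profit : ground -> rat;
  budget : rat;
  indep_matroid : matroid indep;
  budget_gt0 : 0 < budget;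
  cost_bounds : forall e, 0 <= cost e <= budget;
  profit_ge0 : forall e, 0 <= profit e
}.

Definition set_cost (K : bmi) (X : {set ground K}) : rat :=
  \sum_(e in X) cost e.

Definition set_profit (K : bmi) (X : {set ground K}) : rat :=
  \sum_(e in X) profit e.

Definition is_solution (K : bmi) (X : {set ground K}) : bool :=
  (X \in indep K) && (set_cost X <= budget K).

(* set0 is only the witness that a solution exists. *)
Definition OPT (K : bmi) : rat :=
  set_profit [arg max_(X > set0 | @is_solution K X) set_profit X]%O.

(* Model of computation: a first-order functional language with unbounded
   recursion, over binary trees whose leaves are integers in binary.  Trees are
   handled by pointer (pairing and projections take unit time), integer
   operations and oracle queries are charged the bit-length of their operands.
   Integers never grow by more bits than are paid for, so this is polynomially
   equivalent to oracle Turing machines, and a polynomial slowdown does not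
   affect bounds of the form 2^O(f(eps)) * poly(|K|). *)
Inductive value := VInt of int | VPair of value & value.

Inductive binop := Add | Sub | Mul | Div | Leq.

(* EVar i is a de Bruijn index; EMem queries the membership oracle of the
   matroid and EEps a comparison oracle for the real parameter. *)
Inductive expr :=
  | EVar of nat
  | EInt of int
  | ELet of expr & expr
  | EPair of expr & expr
  | EFst of expr
  | ESnd of expr
  | EIf of expr & expr & expr
  | EOp of binop & expr & expr
  | ECall of nat & expr
  | EMem of expr
  | EEps of expr & expr.

(* The f-th entry is the body of the f-th function, with its argument as EVar 0;
   function 0 is the entry point. *)
Definition program := seq expr.

(* Ill-typed operands are given default values: a pair used as an integer is 0,
   and the projections of an integer are 0. *)
Definition to_int (v : value) : int := if v is VInt z then z else 0.
Definition vfst (v : value) : value := if v is VPair a _ then a else VInt 0.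
Definition vsnd (v : value) : value := if v is VPair _ b then b else VInt 0.
Definition vbool (b : bool) : value := VInt (b : nat)%:Z.

(* Everything but the integer 0 is true, pairs included; with 0 also standing
   for the empty list, EIf tests for nonempty lists. *)
Definition truthy (v : value) : bool := if v is VInt z then z != 0 else true.

Definition binop_sem (o : binop) (a b : int) : value :=
  match o with
  | Add => VInt (a + b)
  | Sub => VInt (a - b)
  | Mul => VInt (a * b)
  | Div => VInt (a %/ b)%Z
  | Leq => vbool (a <= b)
  end.

(* A sign bit, then the binary digits of the absolute value. *)
Definition bits (z : int) : nat := (trunc_log 2 `|z|%N).+2.

Fixpoint vsize (v : value) : nat :=
  match v with
  | VInt z => bits z
  | VPair a b => (1 + vsize a + vsize b)%N
  end.

(* eval prog mem eps env e v t: in environment env, e evaluates to v in time t. *)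
Inductive eval (prog : program) (mem : value -> bool) (eps : int -> int -> bool) :
    seq value -> expr -> value -> nat -> Prop :=
  | eval_var env i :
      eval prog mem eps env (EVar i) (nth (VInt 0) env i) 1
  | eval_int env z :
      eval prog mem eps env (EInt z) (VInt z) 1
  | eval_let env e1 e2 v1 v2 t1 t2 :
      eval prog mem eps env e1 v1 t1 ->
      eval prog mem eps (v1 :: env) e2 v2 t2 ->
      eval prog mem eps env (ELet e1 e2) v2 (1 + t1 + t2)
  | eval_pair env e1 e2 v1 v2 t1 t2 :
      eval prog mem eps env e1 v1 t1 ->
      eval prog mem eps env e2 v2 t2 ->
      eval prog mem eps env (EPair e1 e2) (VPair v1 v2) (1 + t1 + t2)
  | eval_fst env e v t :
      eval prog mem eps env e v t ->
      eval prog mem eps env (EFst e) (vfst v) (1 + t)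
  | eval_snd env e v t :
      eval prog mem eps env e v t ->
      eval prog mem eps env (ESnd e) (vsnd v) (1 + t)
  | eval_if env e e1 e2 v w t1 t2 :
      eval prog mem eps env e v t1 ->
      eval prog mem eps env (if truthy v then e1 else e2) w t2 ->
      eval prog mem eps env (EIf e e1 e2) w (1 + t1 + t2)
  | eval_op env o e1 e2 v1 v2 t1 t2 :
      eval prog mem eps env e1 v1 t1 ->
      eval prog mem eps env e2 v2 t2 ->
      eval prog mem eps env (EOp o e1 e2)
        (binop_sem o (to_int v1) (to_int v2))
        (1 + t1 + t2 + bits (to_int v1) + bits (to_int v2))
  | eval_call env f e v w t1 t2 :
      eval prog mem eps env e v t1 ->
      eval prog mem eps [:: v] (nth (EInt 0) prog f) w t2 ->
      eval prog mem eps env (ECall f e) w (1 + t1 + t2)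
  | eval_mem env e v t :
      eval prog mem eps env e v t ->
      eval prog mem eps env (EMem e) (vbool (mem v)) (1 + t + vsize v)
  | eval_eps env e1 e2 v1 v2 t1 t2 :
      eval prog mem eps env e1 v1 t1 ->
      eval prog mem eps env e2 v2 t2 ->
      eval prog mem eps env (EEps e1 e2)
        (vbool (eps (to_int v1) (to_int v2)))
        (1 + t1 + t2 + bits (to_int v1) + bits (to_int v2)).

Lemma eval_det prog mem eps env e v t v' t' :
  eval prog mem eps env e v t -> eval prog mem eps env e v' t' ->
  v = v' /\ t = t'.
Proof.
move=> H; elim: H v' t' => {env e v t} /=; intros;
  match goal with H : eval _ _ _ _ _ ?w _ |- _ = ?w /\ _ => inversion H; subst end;
  repeat match goal with
  | IH : forall v t, eval _ _ _ ?env ?e v t -> _, H : eval _ _ _ ?env ?e _ _ |- _ =>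
      case: (IH _ _ H) => ? ?; subst; clear H
  end; by [].
Qed.

Definition vlist (s : seq value) : value := foldr VPair (VInt 0) s.

Fixpoint int_list (v : value) : seq int :=
  if v is VPair a b then to_int a :: int_list b else [::].

(* A ground element is named by its position in the enumeration. *)
Definition elem_code (E : finType) (e : E) : int := (enum_rank e : nat)%:Z.

Definition seq_code (E : finType) (s : seq E) : value :=
  vlist [seq VInt (elem_code e) | e <- s].

Definition set_of_code (E : finType) (v : value) : {set E} :=
  [set e | elem_code e \in int_list v].

Definition rat_code (q : rat) : value := VPair (VInt (numq q)) (VInt (denq q)).

Definition instance_code (K : bmi) : value :=
  VPair (rat_code (budget K))
        (vlist [seq VPair (rat_code (cost e)) (rat_code (profit e))
               | e <- enum (ground K)]).

Definition instance_size (K : bmi) : nat := vsize (instance_code K).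

Definition mem_oracle (K : bmi) (v : value) : bool :=
  set_of_code (ground K) v \in indep K.

(* The parameter is an arbitrary real and has no finite encoding, so a program
   only learns it by comparing it with rationals. *)
Definition eps_oracle (R : realType) (eps : R) (m n : int) : bool :=
  m%:~R <= n%:~R * eps.

Definition runs (prog : program) (K : bmi) (R : realType) (eps : R)
    (out : value) (t : nat) : Prop :=
  eval prog (mem_oracle K) (eps_oracle eps) [:: instance_code K]
    (ECall 0 (EVar 0)) out t.

(* Main.v *)
Require Import Defs.
From mathcomp Require Import all_boot all_order all_algebra.
From mathcomp Require Import reals exp.
From mathcomp Require Import zify ring lra.

(* The algorithm enumerates the expensive part of a near-optimal solution and
   completes it by Lagrangian relaxation.  Costs and profits are scaled to
   integers, k is the least integer with 5 <= k * eps, and d ranges over the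
   powers of 2, one of which satisfies d <= OPT < 2d.  An item is heavy when its
   profit is at least d / k, and heavy items are put into 2 * k^2 classes of
   almost equal profit.

   Heavy items.  Scanning a class by increasing cost, keep an item when it is
   independent of those kept, up to k^2 + 2k items.  If an optimal solution S
   contains a heavy x that was not kept, then either x is spanned by cheaper
   kept items of its class, one of which can replace x in S, or k^2 + 2k cheaper
   ones were kept.  In that case, since S has at most 2k heavy items, some kept y
   is independent of the other heavy items of S together with its k^2 most
   profitable light ones; adding y to S - x and restoring independence removes at
   most one light item, of profit at most OPT / k^2.  After at most 2k exchanges
   all the heavy items are kept ones and the loss is at most 4 OPT / k, so it
   remains to try all sets F of at most 2k kept items.

   Light items.  Let F be such a set, and for a ratio t let w_t = p - t c.  If t
   is the least breakpoint at which the greedy solution preferring cheap items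
   among ties fits the budget, then the greedy solution preferring expensive
   items exceeds it (or t = 0), as it is also optimal for the previous breakpoint.
   Moving items one at a time to the front of their ties leads from the first
   solution to the second, and each move of x turns a solution X into some X' with
   X' - x included in X.  When the budget is first exceeded, X' is at least as
   profitable as the optimum while X' - x is feasible, and the profit of the light
   item x is at most OPT / k. *)

Set Implicit Arguments.
Unset Strict Implicit.
Unset Printing Implicit Defensive.

Import Order.TTheory GRing.Theory Num.Theory.
Local Open Scope ring_scope.

(** * Matroids and the greedy algorithm *)

Section Matroid.

Variables (E : finType) (I : {set {set E}}).
Hypothesis matI : matroid I.
Implicit Types (A B X Y Z : {set E}) (x y e : E) (s l : seq E).

Let indep0 : set0 \in I. Proof. by case: matI. Qed.

Lemma indepS X Y : Y \in I -> X \subset Y -> X \in I.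
Proof. by case: matI => _ h _; apply: h. Qed.

Lemma indep_aug X Y : X \in I -> Y \in I -> (#|X| < #|Y|)%N ->
  exists2 e, e \in Y :\: X & e |: X \in I.
Proof. by case: matI => _ _ h; apply: h. Qed.

Definition rk A : nat := \max_(X in I | X \subset A) #|X|.

Definition cl A : {set E} := [set e | rk (e |: A) == rk A].

Definition basis B A := [/\ B \in I, B \subset A & #|B| = rk A].

Lemma card_le_rk X A : X \in I -> X \subset A -> (#|X| <= rk A)%N.
Proof. by move=> XI XA; apply: leq_bigmax_cond; rewrite XI. Qed.

Lemma basis_exists A : exists B, basis B A.
Proof.
pose Q X := (X \in I) && (X \subset A).
have h0 : Q set0 by rewrite /Q indep0 sub0set.
exists [arg max_(X > set0 | Q X) #|X|].
rewrite /basis /rk (@bigop.bigmax_eq_arg _ set0 Q _ h0).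
by case: arg_maxnP => // B /andP[].
Qed.

Lemma basis_extend X A : X \in I -> X \subset A ->
  exists2 B, basis B A & X \subset B.
Proof.
have [n] := ubnP (rk A - #|X|)%N; elim: n X => // n IH X; rewrite ltnS => hn XI XA.
have [B [BI BA hB]] := basis_exists A.
have /orP[/eqP eq_c|lt_c] : (#|X| == rk A) || (#|X| < rk A)%N.
- by rewrite -leq_eqVlt; exact: card_le_rk.
- by exists X.
rewrite -hB in lt_c; have [e] := indep_aug XI BI lt_c.
rewrite inE => /andP[eX eB] eXI.
have [] := IH (e |: X) => //.
- by rewrite cardsU1 eX add1n subnS; lia.
- by rewrite subUset sub1set (subsetP BA).
by move=> B' bB' sB'; exists B' => //; apply: subset_trans sB'; exact: subsetUr.
Qed.

Lemma basis_refl X : X \in I -> basis X X.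
Proof.
move=> XI; split=> //; apply/eqP; rewrite eqn_leq card_le_rk //.
by apply/bigmax_leqP => Y /andP[_]; exact: subset_leq_card.
Qed.

Lemma rk_insert e A : (rk (e |: A) <= (rk A).+1)%N.
Proof.
have [B [BI BA <-]] := basis_exists (e |: A).
have : (#|B :\ e| <= rk A)%N.
  apply: card_le_rk; first by apply: indepS BI _; exact: subsetDl.
  by rewrite subDset.
by rewrite (cardsD1 e B); case: (e \in B) => /=; lia.
Qed.

Lemma basis_insert B A e : basis B A -> e \notin B ->
  basis (if e |: B \in I then e |: B else B) (e |: A).
Proof.
move=> [BI BA hB] eB; case: ifP => eBI; split=> //.
- exact: setUS.
- apply/eqP; rewrite eqn_leq card_le_rk //; last exact: setUS.
  by rewrite cardsU1 eB hB add1n rk_insert.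
- by apply: subset_trans BA _; exact: subsetUr.
apply/eqP; rewrite eqn_leq card_le_rk ?andTb //; last first.
  by apply: subset_trans BA _; exact: subsetUr.
rewrite leqNgt; apply/negP => lt_c.
have [C [CI CA hC]] := basis_exists (e |: A); rewrite -hC in lt_c.
have [f] := indep_aug BI CI lt_c; rewrite inE => /andP[fB fC] fBI.
have : f \in e |: A := subsetP CA _ fC.
rewrite !inE => /orP[/eqP fe|fA]; first by rewrite -fe fBI in eBI.
have : (#|f |: B| <= rk A)%N.
  by apply: card_le_rk => //; rewrite subUset sub1set fA.
by rewrite cardsU1 fB hB add1n ltnn.
Qed.

Lemma basis_cl B A e : basis B A -> e \notin B -> (e \in cl A) = (e |: B \notin I).
Proof.
move=> bBA eB; have [_ _] := basis_insert bBA eB; case: bBA => _ _ hB.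
rewrite inE => <-; case: ifP => _; rewrite -hB ?eqxx //.
by rewrite cardsU1 eB add1n; apply/negbTE/eqP; lia.
Qed.

Lemma cl_mono A B : A \subset B -> cl A \subset cl B.
Proof.
move=> AB; apply/subsetP => e eA; apply: contraT => eB.
have [X bX] := basis_exists A; have [XI XA _] := bX.
have [Y bY XY] := basis_extend XI (subset_trans XA AB).
have [YI YB _] := bY.
have eNB : e \notin B.
  apply: contra eB => eB; rewrite inE; apply/eqP; congr rk.
  by apply/setUidPr; rewrite sub1set.
have eY : e \notin Y by apply: contra eNB; exact: (subsetP YB).
have eX : e \notin X by apply: contra eY; exact: (subsetP XY).
move: eA eB; rewrite (basis_cl bX eX) (basis_cl bY eY) negbK => /negP eXI eYI.
by case: eXI; apply: indepS eYI _; exact: setUS.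
Qed.

Lemma indep_swap S B x : S \in I -> B \in I -> x \in S -> x |: B \notin I ->
  exists y, [/\ y \in B, y \notin S & y |: (S :\ x) \in I].
Proof.
move=> SI BI xS xB.
have SxI : S :\ x \in I by apply: indepS SI _; exact: subsetDl.
have bS := basis_refl SxI.
have [y yB yS] : exists2 y, y \in B & y \notin cl (S :\ x).
  apply/subsetPn/negP => BS.
  have [C bC SC] := basis_extend SxI (subsetUl (S :\ x) B).
  have rkSB : rk (S :\ x :|: B) = rk (S :\ x).
    have {bC} [CI CA <-] := bC; apply/eqP; rewrite eqn_leq.
    case: (bS) => _ _ hS; rewrite -hS (subset_leq_card SC) andbT.
    apply: subset_leq_card; apply/subsetP => y yC.
    case: (boolP (y \in S :\ x)) => // yS.
    have yB : y \in B.
      by have := subsetP CA _ yC; rewrite inE (negbTE yS).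
    have := subsetP BS _ yB; rewrite (basis_cl bS yS).
    move=> /negP []; apply: indepS CI _.
    by rewrite subUset sub1set yC.
  have [D bD BD] := basis_extend BI (subsetUr (S :\ x) B).
  have [DI DA hD] := bD.
  have lt_c : (#|D| < #|S|)%N.
    by rewrite hD rkSB; case: (bS) => _ _ <-; rewrite [X in (_ < X)%N](cardsD1 x) xS.
  have [z] := indep_aug DI SI lt_c; rewrite inE => /andP[zD zS] zDI.
  have [zx|zx] := eqVneq z x.
    by case/negP: xB; apply: indepS zDI _; rewrite zx; exact: setUS.
  have := card_le_rk zDI; move=> /(_ (S :\ x :|: B)).
  rewrite subUset sub1set DA !inE zx zS /= => /(_ isT).
  by rewrite cardsU1 zD hD add1n ltnn.
have yNS : y \notin S :\ x.
  apply: contra yS => yS; rewrite inE; apply/eqP; congr rk.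
  by apply/setUidPr; rewrite sub1set.
move: yS; rewrite (basis_cl bS yNS) negbK => yI; exists y; split=> //.
have [yx|yx] := eqVneq y x; first by case/negP: xB; rewrite (setUidPr _) // sub1set -yx.
by move: yNS; rewrite !inE yx.
Qed.

Definition greedy_step s x := if [set e in x :: s] \in I then x :: s else s.

Definition greedy s l := foldl greedy_step s l.

Lemma set_cons x s : [set e in x :: s] = x |: [set e in s].
Proof. by apply/setP => e; rewrite !inE. Qed.

Lemma greedy_step_basis s A x : basis [set e in s] A -> x \notin s ->
  basis [set e in greedy_step s x] (x |: A).
Proof.
move=> bs xs; have := basis_insert (e := x) bs; rewrite inE => /(_ xs).
by rewrite /greedy_step set_cons; case: ifP => //; rewrite set_cons.
Qed.

Lemma mem_greedy_step s x e : e != x -> (e \in greedy_step s x) = (e \in s).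
Proof. by move=> ex; rewrite /greedy_step; case: ifP; rewrite // inE (negbTE ex). Qed.

Lemma mem_greedy s l e : e \notin l -> (e \in greedy s l) = (e \in s).
Proof.
elim: l s => //= x l IH s; rewrite inE negb_or => /andP[ex el].
by rewrite IH // mem_greedy_step.
Qed.

Lemma sub_greedy s l : {subset s <= greedy s l}.
Proof.
elim: l s => [|x l IH] s e //= es; apply: IH.
by rewrite /greedy_step; case: ifP => // _; rewrite inE es orbT.
Qed.

Lemma greedy_sub s l : {subset greedy s l <= s ++ l}.
Proof.
move=> e; rewrite mem_cat; case: (boolP (e \in l)) => [_ _|/mem_greedy ->].
  by rewrite orbT.
by move=> ->.
Qed.

Lemma greedy_step_uniq s x l : uniq (s ++ x :: l) -> uniq (greedy_step s x ++ l).
Proof.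
by rewrite -cat1s uniq_catCA /greedy_step; case: ifP => // _ /= /andP[].
Qed.

Lemma greedy_uniq_cat s l r : uniq (s ++ l ++ r) -> uniq (greedy s l ++ r).
Proof.
elim: l s => [|x l IH] s //= us; apply: IH.
exact: greedy_step_uniq.
Qed.

Lemma greedy_uniq s l : uniq (s ++ l) -> uniq (greedy s l).
Proof. by have := @greedy_uniq_cat s l [::]; rewrite !cats0. Qed.

Lemma greedy_basis s A l : basis [set e in s] A -> uniq (s ++ l) ->
  basis [set e in greedy s l] (A :|: [set e in l]).
Proof.
elim: l s A => [|x l IH] s A bs us /=.
  by have -> : A :|: [set e in [::]] = A by apply/setP => e; rewrite !inE orbF.
have xs : x \notin s.
  by move: us; rewrite cat_uniq /= negb_or => /and3P[_ /andP[]].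
have -> : A :|: [set e in x :: l] = (x |: A) :|: [set e in l].
  by apply/setP => e; rewrite !inE -orbA orbCA.
by apply: IH; [exact: greedy_step_basis|exact: greedy_step_uniq].
Qed.

(* Enlarging the set spanned so far can only shrink what greedy adds later. *)
Lemma greedy_anti s s' A A' l :
    basis [set e in s] A -> basis [set e in s'] A' -> A' \subset A ->
    uniq (s ++ l) -> uniq (s' ++ l) ->
  forall e, e \in l -> e \in greedy s l -> e \in greedy s' l.
Proof.
elim: l s s' A A' => //= x l IH s s' A A' bs bs' AA us us' e.
have xs : x \notin s.
  by move: us; rewrite cat_uniq /= negb_or => /and3P[_ /andP[]].
have xs' : x \notin s'.
  by move: us'; rewrite cat_uniq /= negb_or => /and3P[_ /andP[]].
have xl : x \notin l by move: us; rewrite cat_uniq /= => /and4P[].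
rewrite inE => /orP[/eqP ->|el].
  rewrite !mem_greedy // /greedy_step !set_cons.
  case: ifP => xsI; last by rewrite (negbTE xs).
  have xA : x \notin cl A by rewrite (basis_cl bs) ?xsI // inE.
  have : x \notin cl A' by apply: contra xA; apply/subsetP; exact: cl_mono.
  by rewrite (basis_cl bs') ?negbK ?inE // => ->; rewrite inE eqxx.
apply: (IH _ _ (x |: A) (x |: A')) el => //;
  try exact: greedy_step_basis; try exact: greedy_step_uniq.
exact: setUS.
Qed.

End Matroid.

Section GreedyOptimality.

Variables (E : finType) (I : {set {set E}}).
Hypothesis matI : matroid I.
Variable w : E -> rat.
Implicit Types (A Z : {set E}) (x : E) (s l F : seq E).

(* The slack [#|s| - #|Z :&: A|] is nonnegative because [s] is a basis of [A];
   paying for it with the current largest weight makes the induction go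
   through (Abel summation). *)
Lemma greedy_opt_slack Z s A l (w0 : rat) :
    Z \in I -> basis I [set e in s] A -> uniq (s ++ l) ->
    (forall x, x \in l -> x \notin A) ->
    pairwise (fun x y => w y <= w x) l -> (forall x, x \in l -> w x <= w0) ->
    (forall x, x \in l -> 0 <= w x) -> 0 <= w0 ->
  \sum_(x <- l | x \in Z) w x <=
    \sum_(x <- l | x \in greedy I s l) w x + w0 * (#|[set e in s]|%:R - #|Z :&: A|%:R).
Proof.
move=> ZI; elim: l s A w0 => [|x l IH] s A w0 bs us lA /= wl w0l wpos w0pos.
  rewrite !big_nil add0r mulr_ge0 // subr_ge0 ler_nat.
  case: bs => _ _ ->; apply: card_le_rk; last exact: subsetIr.
  by apply: (indepS matI) ZI _; exact: subsetIl.
have xs : x \notin s by move: us; rewrite cat_uniq /= negb_or => /and3P[_ /andP[]].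
have xl : x \notin l by move: us; rewrite cat_uniq /= => /and4P[].
move: wl => /andP[/allP wx wl].
have cZ : #|Z :&: A|%:R <= #|[set e in s]|%:R :> rat.
  rewrite ler_nat; case: (bs) => _ _ ->; apply: card_le_rk; last exact: subsetIr.
  by apply: (indepS matI) ZI _; exact: subsetIl.
have := IH (greedy_step I s x) (x |: A) (w x) (greedy_step_basis matI bs xs)
  (greedy_step_uniq I us) _ wl wx _ (wpos _ (mem_head _ _)).
have lA' y : y \in l -> y \notin x |: A.
  move=> yl; rewrite !inE negb_or lA ?inE ?yl ?orbT // andbT.
  by apply: contraNneq xl => <-.
have wl' y : y \in l -> 0 <= w y by move=> yl; apply: wpos; rewrite inE yl orbT.
move=> /(_ lA' wl') {IH lA' wl'}; rewrite !big_cons.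
have -> : x \in greedy I (greedy_step I s x) l = (x \in greedy_step I s x) by rewrite mem_greedy.
have -> : #|Z :&: (x |: A)| = ((x \in Z) + #|Z :&: A|)%N.
  have xA : x \notin A := lA _ (mem_head _ _).
  case: (boolP (x \in Z)) => xZ.
    have -> : Z :&: (x |: A) = x |: (Z :&: A) by rewrite setIUr (setIidPr _) // sub1set.
    by rewrite cardsU1 inE xZ (negbTE xA).
  congr #|pred_of_set _|; apply/setP => y; rewrite !inE.
  by case: (eqVneq y x) => [->|//]; rewrite (negbTE xZ).
have -> : #|[set e in greedy_step I s x]| =
    ((x \in greedy_step I s x) + #|[set e in s]|)%N.
  rewrite /greedy_step; case: ifP => _; last by rewrite (negbTE xs).
  by rewrite set_cons cardsU1 !inE eqxx xs.
have w0x : w x <= w0 := w0l _ (mem_head _ _).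
rewrite !natrD.
by case: (x \in Z); case: (x \in greedy_step I s x) => /=; nra.
Qed.

Lemma big_list_set (T : nmodType) (f : E -> T) l : uniq l ->
  \sum_(x <- l) f x = \sum_(x in [set e in l]) f x.
Proof. by move=> ul; rewrite big_uniq //=; apply: eq_bigl => x; rewrite inE. Qed.

Lemma greedy_opt F l Z :
    [set e in F] \in I -> Z \in I -> uniq (F ++ l) -> {subset F <= Z} ->
    pairwise (fun x y => w y <= w x) l -> (forall x, x \in l -> 0 <= w x) ->
    (forall x, x \in Z -> x \notin F -> x \notin l -> w x <= 0) ->
  \sum_(x in Z) w x <= \sum_(x <- greedy I F l) w x.
Proof.
move=> FI ZI uFl FZ wl wpos wneg.
have uG := greedy_uniq I uFl.
have bF := basis_refl FI.
have /and3P[uF Fl ul] : [&& uniq F, ~~ has (mem F) l & uniq l] by rewrite -cat_uniq.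
have lF x : x \in l -> x \notin F.
  by move=> xl; have /hasPn/(_ _ xl) := Fl.
pose w0 := \sum_(x <- l) w x.
have w0l x : x \in l -> w x <= w0.
  move=> xl; rewrite /w0 (big_rem x) //= lerDl big_seq sumr_ge0 // => y /mem_rem; exact: wpos.
have w0pos : 0 <= w0 by rewrite /w0 big_seq sumr_ge0.
have := greedy_opt_slack ZI bF uFl _ wl w0l wpos w0pos.
have -> : Z :&: [set e in F] = [set e in F].
  by apply/setIidPr/subsetP => x; rewrite inE; exact: FZ.
have lF' x : x \in l -> x \notin [set e in F] by move=> xl; rewrite inE lF.
rewrite subrr mulr0 addr0 => /(_ lF') h.
rewrite (bigID [in F]) /= [X in _ <= X](bigID [in F]) /=.
have -> : \sum_(x in Z | x \in F) w x = \sum_(i <- greedy I F l | i \in F) w i.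
  rewrite -[RHS]big_filter big_uniq ?filter_uniq //=; apply: eq_bigl => x.
  rewrite mem_filter; case: (boolP (x \in F)) => xF /=; rewrite ?andbF //.
  by rewrite FZ // sub_greedy.
rewrite lerD2l.
have -> : \sum_(i <- greedy I F l | i \notin F) w i = \sum_(x <- l | x \in greedy I F l) w x.
  rewrite -[LHS]big_filter -[RHS]big_filter; apply: perm_big; apply: uniq_perm.
  - exact: filter_uniq.
  - exact: filter_uniq.
  move=> x; rewrite !mem_filter andbC; case: (boolP (x \in greedy I F l)) => //= xG.
  have := greedy_sub xG; rewrite mem_cat => /orP[xF|xl]; last by rewrite lF.
  by rewrite xF; apply/esym/negbTE; apply: contraL xF => /lF.
apply: le_trans h.
rewrite (bigID [in l]) /= -[leRHS]addr0 lerD //; last first.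
  by apply: sumr_le0 => x /andP[/andP[xZ xF] xl]; exact: wneg.
rewrite -[leRHS]big_filter big_uniq ?filter_uniq //= le_eqVlt; apply/orP; left.
apply/eqP/eq_bigl => x; rewrite mem_filter -andbA; congr andb.
by rewrite andb_idl //; exact: lF.
Qed.

End GreedyOptimality.

(** * Orders by Lagrangian weight *)

Section Sorting.

Variables (E : eqType) (p c : E -> int) (u v : int).
Implicit Types (x y : E) (l t : seq E) (th : int).

(* [v] times the Lagrangian profit [p x - (u / v) * c x]. *)
Definition wt x : int := v * p x - u * c x.

Fixpoint winsert x l :=
  if l is y :: l' then if wt y <= wt x then x :: l else y :: winsert x l' else [:: x].

Definition wsort th t l :=
  foldr (fun x s => if th <= wt x then winsert x s else s) t l.

Lemma mem_winsert x l : winsert x l =i x :: l.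
Proof.
move=> y; elim: l => //= z l IH; case: ifP => // _.
by rewrite inE IH !inE orbCA.
Qed.

Lemma perm_winsert x l : perm_eq (winsert x l) (x :: l).
Proof.
elim: l => //= y l IH; case: ifP => // _.
by rewrite -(perm_cons y) in IH; apply: perm_trans IH _; apply/permP => a /=; lia.
Qed.

Lemma mem_wsort th t l y : (y \in wsort th t l) = (y \in t) || (y \in l) && (th <= wt y).
Proof.
elim: l => [|x l IH] /=; first by rewrite orbF.
rewrite inE; case: ifP => xth; rewrite ?mem_winsert ?inE IH.
  by case: (eqVneq y x) => [->|_] /=; rewrite ?xth ?orbT.
by case: (eqVneq y x) => [->|_] //=; rewrite xth !andbF.
Qed.

Lemma perm_wsort th t l : perm_eq (wsort th t l) ([seq x <- l | th <= wt x] ++ t).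
Proof.
elim: l => //= x l IH; case: ifP => // _.
by apply: perm_trans (perm_winsert _ _) _; rewrite perm_cons.
Qed.

Lemma wsort_uniq th t l : uniq (l ++ t) -> uniq (wsort th t l).
Proof.
rewrite (perm_uniq (perm_wsort _ _ _)) !cat_uniq => /and3P[ul lt ut].
rewrite filter_uniq // ut andbT /=; apply: contra lt => /hasP[x xt].
by rewrite /= mem_filter => /andP[_ xl]; apply/hasP; exists x.
Qed.

Definition lexw (r : rel E) x y := (wt y < wt x) || (wt y == wt x) && r x y.

Lemma lexw_ge r x y : lexw r x y -> wt y <= wt x.
Proof. by case/orP => [/ltW//|/andP[/eqP-> _]]. Qed.

Lemma winsert_pairwise r x t :
  pairwise (lexw r) t -> all (r x) t -> pairwise (lexw r) (winsert x t).
Proof.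
elim: t => //= y t IH /andP[yt tt] /andP[rxy rxt]; case: ifP => yx /=.
  rewrite yt tt !andbT; apply/andP; split.
    by move: yx; rewrite le_eqVlt /lexw rxy andbT orbC.
  apply/allP => z zt; have := lexw_ge (allP yt z zt) => zy.
  have := le_trans zy yx; rewrite le_eqVlt /lexw orbC => /orP[->//|->].
  by rewrite (allP rxt _ zt) orbT.
rewrite IH // andbT; apply/allP => z; rewrite mem_winsert inE => /orP[/eqP ->|zt].
  by rewrite /lexw ltNge yx.
exact: (allP yt).
Qed.

Lemma wsort_pairwise r th t l : pairwise (lexw r) t -> pairwise r l ->
  allrel r l t -> pairwise (lexw r) (wsort th t l).
Proof.
move=> tt; elim: l => //= x l IH /andP[xl ll]; rewrite allrel_consl => /andP[xt lt].
case: ifP => _; last exact: IH.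
apply: winsert_pairwise; first exact: IH.
apply/allP => y; rewrite mem_wsort => /orP[yt|/andP[yl _]].
  exact: (allP xt).
exact: (allP xl).
Qed.

Definition dec x y := wt y <= wt x.

Lemma pairwise_dec t : pairwise dec t = pairwise (lexw (fun _ _ => true)) t.
Proof. by apply: eq_pairwise => x y; rewrite /lexw /dec andbT le_eqVlt orbC. Qed.

Lemma winsert_dec x t : pairwise dec t -> pairwise dec (winsert x t).
Proof.
rewrite !pairwise_dec => tt; apply: winsert_pairwise => //; exact: all_predT.
Qed.

Lemma wsort_dec th t l : pairwise dec t -> pairwise dec (wsort th t l).
Proof.
rewrite !pairwise_dec => tt; apply: wsort_pairwise => //.
  by elim: l => //= x l ->; rewrite andbT all_predT.
by apply/allrelP.
Qed.

Lemma winsert_split x t : pairwise dec t -> exists t1 t2,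
  [/\ t = t1 ++ t2, winsert x t = t1 ++ x :: t2,
      forall y, y \in t1 -> wt x < wt y & forall y, y \in t2 -> wt y <= wt x].
Proof.
elim: t => [_|y t IH] /=; first by exists [::], [::].
move=> /andP[yt tt]; case: ifP => yx.
  exists [::], (y :: t); split=> // z; rewrite inE => /orP[/eqP->//|zt].
  exact: le_trans (allP yt z zt) yx.
have [t1 [t2 [-> -> h1 h2]]] := IH tt; exists (y :: t1), t2; split=> // z.
by rewrite inE => /orP[/eqP->|]; [rewrite ltNge yx|exact: h1].
Qed.

Lemma winsert_mid x y t1 t2 : pairwise dec (t1 ++ x :: t2) -> exists s1 s2,
  winsert y (t1 ++ x :: t2) = s1 ++ x :: s2 /\ winsert y (t1 ++ t2) = s1 ++ s2.
Proof.
elim: t1 => [|z t1 IH] /= /andP[xt tt].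
  case: ifP => xy; last by exists [::], (winsert y t2).
  exists [:: y], t2; split=> //; case: t2 xt {tt} => //= z t2 /andP[zx _].
  by rewrite (le_trans zx xy).
case: ifP => zy; first by exists (y :: z :: t1), t2.
by have [s1 [s2 [-> ->]]] := IH tt; exists (z :: s1), s2.
Qed.

Lemma wsort_mid th x t l : pairwise dec t -> exists s1 s2,
  wsort th (winsert x t) l = s1 ++ x :: s2 /\ wsort th t l = s1 ++ s2.
Proof.
move=> tt; elim: l => [|y l [s1 [s2 [e1 e2]]]] /=.
  by have [s1 [s2 [-> -> _ _]]] := winsert_split x tt; exists s1, s2.
case: ifP => _; last by exists s1, s2.
rewrite e1 e2; apply: winsert_mid; rewrite -e1; apply: wsort_dec; exact: winsert_dec.
Qed.

(* Elements of [acc] are kept when their weight is nonnegative and go before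
   the elements of [rest] of equal weight, which are kept when their weight
   is positive. *)
Definition lag_order acc rest := wsort 0 (wsort 1 [::] rest) acc.

Lemma mem_lag_order acc rest y :
  (y \in lag_order acc rest) = (y \in rest) && (1 <= wt y) || (y \in acc) && (0 <= wt y).
Proof. by rewrite /lag_order !mem_wsort. Qed.

Lemma lag_order_dec acc rest : pairwise dec (lag_order acc rest).
Proof. by do 2 apply: wsort_dec. Qed.

Lemma lag_order_uniq acc rest : uniq (acc ++ rest) -> uniq (lag_order acc rest).
Proof.
move=> ar; apply: wsort_uniq; move: ar; rewrite !cat_uniq => /and3P[-> h ur].
rewrite wsort_uniq ?cats0 // andbT /=; apply: contra h => /hasP[x].
by rewrite mem_wsort /= => /andP[xr _] xa; apply/hasP; exists x.
Qed.

Lemma lag_order_move acc x rest : uniq (acc ++ x :: rest) -> 0 <= wt x -> exists s1 s2 s3,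
  lag_order (x :: acc) rest = s1 ++ x :: s2 ++ s3 /\
  (lag_order acc (x :: rest) = s1 ++ s2 ++ x :: s3 \/
   lag_order acc (x :: rest) = s1 ++ s2 ++ s3).
Proof.
move=> _ x0; have [t1 [t2 [e1 e2 h1 h2]]] := winsert_split x (lag_order_dec acc rest).
have -> : lag_order (x :: acc) rest = winsert x (lag_order acc rest) by rewrite {1}/lag_order /= x0.
rewrite e2; case: (boolP (1 <= wt x)) => x1; last first.
  exists t1, t2, [::]; rewrite !cats0; split=> //; right; rewrite -e1.
  by rewrite /lag_order /= (negbTE x1).
have [s1 [s2 []]] := wsort_mid 0 x acc (wsort_dec 1 rest (isT : pairwise dec [::])).
rewrite -/(lag_order acc rest) e1.
have -> : wsort 0 (winsert x (wsort 1 [::] rest)) acc = lag_order acc (x :: rest).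
  by rewrite /lag_order /= x1.
move=> e3 e4.
have hs : forall y, y \in s2 -> wt y <= wt x.
  move=> y ys; have := lag_order_dec acc (x :: rest); rewrite e3 pairwise_cat /=.
  by case/and3P => _ _ /andP[/allP/(_ y ys)].
have [k ek] : exists k, s1 = t1 ++ k.
  exists (drop (size t1) s1); rewrite -{1}(cat_take_drop (size t1) s1); congr (_ ++ _).
  have [le|lt] := leqP (size t1) (size s1).
    by have := take_size_cat t2 (erefl (size t1)); rewrite e4 takel_cat.
  have e5 : s2 = drop (size s1) t1 ++ t2.
    have := drop_size_cat s2 (erefl (size s1)); rewrite -e4 drop_cat lt => <-.
    by [].
  case e6 : (drop (size s1) t1) => [|y d].
    by have := size_drop (size s1) t1; rewrite e6 /= => /esym/eqP; rewrite subn_eq0 leqNgt lt.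
  have ys2 : y \in s2 by rewrite e5 e6 mem_head.
  have yt1 : y \in t1 by apply: (mem_drop (n0 := size s1)); rewrite e6 mem_head.
  by have := le_lt_trans (hs _ ys2) (h1 _ yt1); rewrite ltxx.
exists t1, k, s2; split; last by left; rewrite e3 ek -catA.
congr (_ ++ _ :: _); move: e4; rewrite ek -catA => /eqP.
by rewrite eqseq_cat // eqxx => /andP[_ /eqP].
Qed.

End Sorting.

(** * Lagrangian relaxation *)

Lemma min_exists (T : eqType) (f : T -> rat) (s : seq T) (a : pred T) :
  has a s -> exists x, [/\ x \in s, a x & forall y, y \in s -> a y -> f x <= f y].
Proof.
elim: s => //= x s IH; case: (boolP (has a s)) => [/IH [y [ys ay hy]] _|/hasPn hs].
  case: (boolP (a x && (f x <= f y))) => [/andP[ax xy]|nx].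
    exists x; split=> //; first exact: mem_head.
    move=> z; rewrite inE => /orP[/eqP->//|zs az].
    by apply: le_trans xy _; exact: hy.
  exists y; split=> //; first by rewrite inE ys orbT.
  move=> z; rewrite inE => /orP[/eqP->|zs] az; last exact: hy.
  by rewrite az /= -ltNge in nx; exact: ltW.
rewrite orbF => ax; exists x; split=> //; first exact: mem_head.
move=> z; rewrite inE => /orP[/eqP->//|zs] az.
by have := hs z zs; rewrite az.
Qed.

Lemma pairwise_rev (T : Type) (r : rel T) (s : seq T) :
  pairwise r (rev s) = pairwise (fun x y => r y x) s.
Proof. by elim: s => //= x s IH; rewrite rev_cons pairwise_rcons all_rev IH. Qed.

Section Lagrange.

Variables (E : finType) (I : {set {set E}}).
Hypothesis matI : matroid I.
Variables (p c : E -> int).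
Hypotheses (p_ge0 : forall x, 0 <= p x) (c_ge0 : forall x, 0 <= c x).
Implicit Types (Z : {set E}) (x y : E) (l F acc rest : seq E) (u v : int).

Lemma greedy_move F s1 x s2 s3 : [set e in F] \in I -> uniq (F ++ s1 ++ x :: s2 ++ s3) ->
  forall y, y \in greedy I F (s1 ++ x :: s2 ++ s3) -> y != x ->
  (y \in greedy I F (s1 ++ s2 ++ x :: s3)) && (y \in greedy I F (s1 ++ s2 ++ s3)).
Proof.
move=> FI uF y yG yx.
have bF := basis_refl FI.
set G := greedy I F s1; set A := [set e in F] :|: [set e in s1].
have uF1 : uniq (F ++ s1).
  by move: uF; rewrite catA cat_uniq => /and3P[].
have bG : basis I [set e in G] A := greedy_basis matI bF uF1.
have uGx : uniq (G ++ x :: s2 ++ s3) by exact: greedy_uniq_cat.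
have uG : uniq (G ++ s2 ++ s3).
  by move: uGx; rewrite -cat1s uniq_catCA /= => /andP[].
have xG : x \notin G by move: uGx; rewrite cat_uniq /= negb_or => /and3P[_ /andP[]].
have xs : x \notin s2 ++ s3 by move: uGx; rewrite cat_uniq /= => /and4P[].
have bGx := greedy_step_basis matI bG xG.
have uGx' : uniq (greedy_step I G x ++ s2 ++ s3) := greedy_step_uniq I uGx.
have AA : A \subset x |: A := subsetUr _ _.
have cat_greedy s l1 l2 : greedy I s (l1 ++ l2) = greedy I (greedy I s l1) l2.
  by rewrite /greedy foldl_cat.
have [u2 u3] : uniq (G ++ s2) /\ uniq (greedy_step I G x ++ s2).
  by move: uG uGx'; rewrite !catA !(cat_uniq (_ ++ s2)) => /and3P[-> _ _] /and3P[-> _ _].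
have key1 : y \in greedy I G (s2 ++ s3).
  move: yG; rewrite cat_greedy /= -/G => yG.
  case: (boolP (y \in s2 ++ s3)) => ys.
    exact: (greedy_anti matI bGx bG AA uGx' uG ys).
  by move: yG; rewrite (mem_greedy _ (greedy_step I G x) ys) (mem_greedy _ G ys) mem_greedy_step.
rewrite (cat_greedy F s1 (s2 ++ s3)) -/G key1 andbT (cat_greedy F s1 (s2 ++ x :: s3)) -/G.
move: (yG); rewrite cat_greedy /= -/G.
case: (boolP (y \in s3)) => ys3; last first.
  move=> _; move: key1; rewrite !cat_greedy /=.
  rewrite (mem_greedy _ (greedy_step _ _ _) ys3) (mem_greedy _ (greedy _ G s2) ys3).
  by rewrite mem_greedy_step.
have b2 := greedy_basis matI bG u2.
have b2x := greedy_basis matI bGx u3.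
have xG2 : x \notin greedy I G s2.
  apply/negP => /greedy_sub; rewrite mem_cat (negbTE xG) /= => xs2.
  by rewrite mem_cat xs2 in xs.
have b2' := greedy_step_basis matI b2 xG2.
rewrite !cat_greedy /=; apply: (greedy_anti matI b2x b2') => //.
- by rewrite setUA.
- by apply: greedy_uniq_cat.
apply: greedy_step_uniq; apply: greedy_uniq_cat.
move: uGx; congr is_true; apply: perm_uniq.
by rewrite perm_cat2l -cat1s -[x :: s3]cat1s perm_catCA.
Qed.

Local Notation ordr := (lag_order p c).

Lemma lag_order_sub u v acc rest :
  {subset ordr u v acc rest <= acc ++ rest}.
Proof.
move=> z; rewrite mem_lag_order mem_cat; case: (z \in acc); case: (z \in rest) => //.
Qed.

Lemma lag_order_cat_uniq F u v acc rest : uniq (F ++ acc ++ rest) -> uniq (F ++ ordr u v acc rest).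
Proof.
rewrite !(cat_uniq F) => /and3P[-> h ua]; rewrite lag_order_uniq // andbT /=.
by apply: contra h => /hasP[z /lag_order_sub zo zF]; apply/hasP; exists z.
Qed.

Lemma chain_sub F u v acc x rest :
    [set e in F] \in I -> uniq (F ++ acc ++ x :: rest) ->
  {subset rem x (greedy I F (ordr u v (x :: acc) rest))
    <= greedy I F (ordr u v acc (x :: rest))}.
Proof.
move=> FI uF y.
have ua : uniq (acc ++ x :: rest) by move: uF; rewrite cat_uniq => /and3P[].
have uxa : uniq ((x :: acc) ++ rest) by move: ua; rewrite -cat1s uniq_catCA.
have uo : uniq (F ++ ordr u v (x :: acc) rest).
  apply: lag_order_cat_uniq; move: uF; congr is_true; apply: perm_uniq.
  by rewrite perm_cat2l -[x :: rest]cat1s perm_catCA.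
have uG := greedy_uniq I uo.
rewrite mem_rem_uniq // inE => /andP[yx].
case: (boolP (0 <= wt p c u v x)) => x0; last first.
  suff -> : ordr u v (x :: acc) rest = ordr u v acc (x :: rest) by [].
  have x1 : ~~ (1 <= wt p c u v x) by lia.
  by rewrite /lag_order /= (negbTE x0) (negbTE x1).
have [s1 [s2 [s3 [e1 e2]]]] := lag_order_move ua x0.
rewrite e1 in uo * => yG.
have /andP[h1 h2] := greedy_move FI uo yG yx.
by case: e2 => ->.
Qed.

Definition lw (t : rat) x : rat := (p x)%:~R - t * (c x)%:~R.

Definition lam (r : int * int) : rat := r.1%:~R / r.2%:~R.

Definition admissible (r : int * int) := (0 <= r.1) && (0 < r.2).

Lemma lam_ge0 r : admissible r -> 0 <= lam r.
Proof. by case/andP => r1 r2; rewrite divr_ge0 // ler0z // ltW. Qed.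

Lemma wt_lw r x : admissible r -> (wt p c r.1 r.2 x)%:~R = r.2%:~R * lw (lam r) x.
Proof.
case/andP => _ r2; rewrite /wt /lw /lam rmorphB !rmorphM /=; field.
by rewrite intr_eq0 gt_eqF.
Qed.

Lemma wt_le r x y : admissible r ->
  (wt p c r.1 r.2 x <= wt p c r.1 r.2 y) = (lw (lam r) x <= lw (lam r) y).
Proof.
move=> ar; rewrite -(ler_int rat) !wt_lw // ler_pM2l // ltr0z.
by case/andP: ar.
Qed.

Lemma wt_ge0 r x : admissible r -> (0 <= wt p c r.1 r.2 x) = (0 <= lw (lam r) x).
Proof.
move=> ar; rewrite -(ler_int rat) wt_lw // pmulr_rge0 // ltr0z.
by case/andP: ar.
Qed.

Lemma wt_ge1 r x : admissible r -> (1 <= wt p c r.1 r.2 x) = (0 < lw (lam r) x).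
Proof.
move=> ar; have -> : (1 <= wt p c r.1 r.2 x) = (0 < wt p c r.1 r.2 x) by lia.
rewrite -(ltr_int rat) wt_lw // pmulr_rgt0 // ltr0z.
by case/andP: ar.
Qed.

Lemma lw_ge_anti t t' x : t <= t' -> lw t' x <= lw t x.
Proof. by move=> tt; rewrite /lw lerD2l lerN2 ler_wpM2r // ler0z. Qed.

Lemma sum_lw t l :
  \sum_(x <- l) lw t x = (\sum_(x <- l) p x)%:~R - t * (\sum_(x <- l) c x)%:~R.
Proof. by rewrite !rmorph_sum /= sumrB mulr_sumr. Qed.

Variable F : seq E.
Hypothesis FI : [set e in F] \in I.

Local Notation sol r acc rest := (greedy I F (ordr r.1 r.2 acc rest)).

Lemma sol_indep r acc rest : uniq (F ++ acc ++ rest) ->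
  [set e in sol r acc rest] \in I.
Proof.
move=> uF; have uo := lag_order_cat_uniq r.1 r.2 uF.
by have [] := greedy_basis matI (basis_refl FI) uo.
Qed.

Lemma sol_uniq r acc rest : uniq (F ++ acc ++ rest) -> uniq (sol r acc rest).
Proof. by move=> uF; apply: greedy_uniq; exact: lag_order_cat_uniq. Qed.

Lemma sol_sub r acc rest : {subset sol r acc rest <= F ++ acc ++ rest}.
Proof.
move=> x /greedy_sub; rewrite !(mem_cat _ F) => /orP[->//|/lag_order_sub ->].
by rewrite orbT.
Qed.

Lemma sol_opt_gen t r acc rest Z :
    Z \in I -> {subset F <= Z} -> {subset Z <= F ++ acc ++ rest} ->
    uniq (F ++ acc ++ rest) ->
    pairwise (fun x y => lw t y <= lw t x) (ordr r.1 r.2 acc rest) ->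
    (forall x, x \in ordr r.1 r.2 acc rest -> 0 <= lw t x) ->
    (forall x, x \in acc ++ rest -> x \notin ordr r.1 r.2 acc rest -> lw t x <= 0) ->
  \sum_(x in Z) lw t x <= \sum_(x <- sol r acc rest) lw t x.
Proof.
move=> ZI FZ ZF uF wo wpos wneg; apply: greedy_opt => //.
  exact: lag_order_cat_uniq.
move=> x xZ xF xo; apply: wneg => //.
by have := ZF _ xZ; rewrite mem_cat (negbTE xF).
Qed.

Lemma sol_opt r acc rest Z : admissible r ->
    Z \in I -> {subset F <= Z} -> {subset Z <= F ++ acc ++ rest} ->
    uniq (F ++ acc ++ rest) ->
  \sum_(x in Z) lw (lam r) x <= \sum_(x <- sol r acc rest) lw (lam r) x.
Proof.
move=> ar ZI FZ ZF uF; apply: sol_opt_gen => //.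
- apply: sub_pairwise (lag_order_dec p c r.1 r.2 acc rest) => x y.
  by rewrite /dec wt_le.
- move=> x; rewrite mem_lag_order wt_ge0 // wt_ge1 //.
  by case/orP => /andP[_ //]; exact: ltW.
move=> x; rewrite mem_lag_order mem_cat wt_ge0 // wt_ge1 //.
case: (ltgtP 0 (lw (lam r) x)) => //; case: (x \in acc) => //=.
  by case: (x \in rest).
by case: (x \in rest).
Qed.

Section Crossing.

Variables (r r' : int * int) (ratios : seq (int * int)).
Hypotheses (ar : admissible r) (ar' : admissible r') (rr : lam r' < lam r).
Hypothesis between : forall q, q \in ratios -> admissible q ->
  lam q < lam r -> lam q <= lam r'.

Lemma no_crossing (d e : int) : (0 < e -> (d, e) \in ratios) ->
  0 < d%:~R - lam r' * e%:~R -> 0 <= d%:~R - lam r * e%:~R.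
Proof.
move=> de d0; rewrite leNgt; apply/negP => d1.
have e0 : 0 < (e%:~R : rat).
  have : 0 < (lam r - lam r') * e%:~R by lra.
  by rewrite pmulr_rgt0 // subr_gt0.
have lde : lam (d, e) = d%:~R / e%:~R by [].
have l1 : lam r' < lam (d, e) by rewrite lde ltr_pdivlMr //; lra.
have l2 : lam (d, e) < lam r by rewrite lde ltr_pdivrMr //; lra.
have ade : admissible (d, e).
  rewrite /admissible /=; move: (e0); rewrite ltr0z => ->; rewrite andbT.
  rewrite -(ler0z rat); have := lam_ge0 ar' => l0.
  have : 0 <= lam r' * e%:~R by apply: mulr_ge0 => //; exact: ltW.
  lra.
move: e0; rewrite ltr0z => /de de'.
by have := between de' ade l2; rewrite leNgt l1.
Qed.

Hypothesis ratios1 : forall x, (p x, c x) \in ratios.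
Hypothesis ratios2 : forall x y, (p x - p y, c x - c y) \in ratios.

Lemma lw_pos x : 0 < lw (lam r') x -> 0 <= lw (lam r) x.
Proof. by apply: no_crossing. Qed.

Lemma lw_lt x y : lw (lam r') x < lw (lam r') y -> lw (lam r) x <= lw (lam r) y.
Proof.
move=> h; have := @no_crossing (p y - p x) (c y - c x) (fun _ => ratios2 y x).
by move: h; rewrite /lw !rmorphB /=; lra.
Qed.

Lemma lw_lt' x y : lw (lam r) x < lw (lam r) y -> lw (lam r') x <= lw (lam r') y.
Proof. by move=> h; rewrite leNgt; apply/negP => /lw_lt; rewrite leNgt h. Qed.

Lemma sol_low L Z : Z \in I -> {subset F <= Z} -> {subset Z <= F ++ L} ->
    uniq (F ++ L) -> pairwise (fun x y => c x <= c y) L ->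
  \sum_(x in Z) lw (lam r) x <= \sum_(x <- sol r' [::] L) lw (lam r) x.
Proof.
move=> ZI FZ ZF uF cL; apply: sol_opt_gen => //.
- have : pairwise (lexw p c r'.1 r'.2 (fun x y => c x <= c y)) (wsort p c r'.1 r'.2 1 [::] L).
    apply: wsort_pairwise; [by []|exact: cL|by elim: (L)].
  apply: sub_pairwise => x y /orP[|/andP[/eqP e cxy]].
    by rewrite ltNge wt_le // -ltNge; exact: lw_lt.
  have := wt_le x y ar'; have := wt_le y x ar'; rewrite e lexx => /esym h1 /esym h2.
  have {h1 h2} : lw (lam r') x = lw (lam r') y by apply/le_anti; rewrite h1 h2.
  have : 0 <= (lam r - lam r') * ((c y)%:~R - (c x)%:~R).
    by apply: mulr_ge0; rewrite subr_ge0 ?ler_int // ltW.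
  rewrite /lw; lra.
- move=> x; rewrite mem_lag_order orbF wt_ge1 // => /andP[_]; exact: lw_pos.
move=> x xL; rewrite mem_lag_order orbF xL wt_ge1 //= -leNgt; apply: le_trans.
by apply: lw_ge_anti; exact: ltW.
Qed.

Lemma sol_high L Z : Z \in I -> {subset F <= Z} -> {subset Z <= F ++ L} ->
    uniq (F ++ L) -> pairwise (fun x y => c x <= c y) L ->
  \sum_(x in Z) lw (lam r') x <= \sum_(x <- sol r (rev L) [::]) lw (lam r') x.
Proof.
move=> ZI FZ ZF uF cL; apply: sol_opt_gen; rewrite ?cats0 //.
- by move=> x /ZF; rewrite !mem_cat mem_rev.
- by move: uF; rewrite !cat_uniq rev_uniq has_rev.
- have : pairwise (lexw p c r.1 r.2 (fun x y => c y <= c x)) (ordr r.1 r.2 (rev L) [::]).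
    apply: wsort_pairwise; [by []|by rewrite pairwise_rev|by elim: (rev L)].
  apply: sub_pairwise => x y /orP[|/andP[/eqP e cxy]].
    by rewrite ltNge wt_le // -ltNge; exact: lw_lt'.
  have := wt_le x y ar; have := wt_le y x ar; rewrite e lexx => /esym h1 /esym h2.
  have {h1 h2} : lw (lam r) x = lw (lam r) y by apply/le_anti; rewrite h1 h2.
  have : 0 <= (lam r - lam r') * ((c x)%:~R - (c y)%:~R).
    by apply: mulr_ge0; rewrite subr_ge0 ?ler_int // ltW.
  rewrite /lw; lra.
- move=> x; rewrite mem_lag_order /= wt_ge0 // => /andP[_] h; apply: le_trans h _.
  by apply: lw_ge_anti; exact: ltW.
move=> x xL; rewrite mem_lag_order /= xL wt_ge0 //= -ltNge => h.
by rewrite leNgt; apply/negP => /lw_pos; rewrite leNgt h.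
Qed.

End Crossing.

Lemma sum_sub (f : E -> int) s t : (forall x, 0 <= f x) ->
  uniq s -> uniq t -> {subset s <= t} -> \sum_(x <- s) f x <= \sum_(x <- t) f x.
Proof.
move=> f0 us ut st; rewrite !big_list_set //.
rewrite [leRHS](big_setID [set e in s]) /= (setIidPr _); last first.
  by apply/subsetP => x; rewrite !inE; exact: st.
by rewrite lerDl sumr_ge0.
Qed.

Lemma lagrangian L (ratios : seq (int * int)) Z (b : int) :
    Z \in I -> {subset F <= Z} -> {subset Z <= F ++ L} -> uniq (F ++ L) ->
    pairwise (fun x y => c x <= c y) L -> \sum_(x in Z) c x <= b -> L != [::] ->
    (0, 1) \in ratios -> (forall x, (p x, c x) \in ratios) ->
    (forall x y, (p x - p y, c x - c y) \in ratios) ->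
  exists r pre x rest, [/\ r \in ratios, L = pre ++ x :: rest,
    \sum_(y <- rem x (sol r (x :: rev pre) rest)) c y <= b &
    \sum_(y in Z) p y <= \sum_(y <- rem x (sol r (x :: rev pre) rest)) p y + p x].
Proof.
move=> ZI FZ ZF uF cL cZ L0 r0 r1 r2.
pose cost r acc rest := \sum_(y <- sol r acc rest) c y.
pose good r := admissible r && (cost r [::] L <= b).
have [q qr gq] : exists2 q, q \in ratios & good q.
  have ha : has admissible ratios by apply/hasP; exists (0, 1).
  have [q [qr aq hq]] := min_exists (fun q => - lam q) ha.
  exists q => //; rewrite /good aq /=; apply: le_trans cZ.
  rewrite /cost big_list_set ?sol_uniq //.
  rewrite (eq_bigr (fun x => if x \in F then c x else 0)); last first.
    move=> x; rewrite inE => xs; case: ifPn => xF //; apply/eqP.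
    rewrite eq_le c_ge0 andbT leNgt; apply/negP => cx.
    have ap : admissible (p x, c x) by rewrite /admissible /= p_ge0.
    have := hq _ (r1 x) ap; rewrite lerN2 {1}/lam ler_pdivrMr ?ltr0z //= => le1.
    have := greedy_sub xs; rewrite mem_cat (negbTE xF) mem_lag_order orbF wt_ge1 //=.
    by case/andP => _; rewrite /lw subr_gt0 ltNge le1.
  rewrite -big_mkcondr /= [leRHS](bigID [in F]) /=.
  rewrite (eq_bigl (fun x => (x \in Z) && (x \in F))) ?lerDl ?sumr_ge0 // => x.
  rewrite inE; case: (boolP (x \in F)) => xF; rewrite ?andbF // !andbT.
  by rewrite (FZ _ xF); apply: sub_greedy.
have hg : has good ratios by apply/hasP; exists q.
have {q qr gq} [r [rr /andP[ar cr] minr]] := min_exists lam hg.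
have hi : lam r = 0 \/ b < cost r (rev L) [::].
  have := lam_ge0 ar; rewrite le_eqVlt => /orP[/eqP <-|lr]; [by left|right].
  pose below q := admissible q && (lam q < lam r).
  have hb : has below ratios.
    by apply/hasP; exists (0, 1) => //; rewrite /below /lam /= mul0r lr.
  have [r' [r'r /andP[ar' r'lt] maxr']] := min_exists (fun q => - lam q) hb.
  have betw : forall q, q \in ratios -> admissible q -> lam q < lam r -> lam q <= lam r'.
    by move=> q qr aq ql; rewrite -lerN2; apply: maxr' => //; rewrite /below aq.
  have bad : b < cost r' [::] L.
    rewrite ltNge; apply/negP => h; have := minr r' r'r; rewrite /good ar' h => /(_ isT).
    by rewrite leNgt r'lt.
  have uL : uniq (F ++ rev L ++ [::]).
    by move: uF; rewrite cats0 !cat_uniq rev_uniq has_rev.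
  set X1 := sol r' [::] L; set X2 := sol r (rev L) [::].
  have [u1 u2] : uniq X1 /\ uniq X2 by split; apply: sol_uniq.
  have S1 : [set e in X1] \in I by apply: sol_indep.
  have S2 : [set e in X2] \in I by apply: sol_indep.
  have F1 : {subset F <= [set e in X1]} by move=> x xF; rewrite inE; apply: sub_greedy.
  have F2 : {subset F <= [set e in X2]} by move=> x xF; rewrite inE; apply: sub_greedy.
  have L1 : {subset [set e in X1] <= F ++ L} by move=> x; rewrite inE => /sol_sub.
  have L2 : {subset [set e in X2] <= F ++ L}.
    by move=> x; rewrite inE => /sol_sub; rewrite cats0 !mem_cat mem_rev.
  have L1' : {subset [set e in X1] <= F ++ rev L ++ [::]}.
    by move=> x /L1; rewrite cats0 !mem_cat mem_rev.
  have := sol_low ar' r'lt betw r1 r2 S2 F2 L2 uF cL.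
  have := sol_high ar ar' r'lt betw r1 r2 S1 F1 L1 uF cL.
  have := sol_opt ar S1 F1 L1' uL.
  have := sol_opt (acc := [::]) ar' S2 F2 L2 uF.
  rewrite -/X1 -/X2 -!big_list_set // !sum_lw -/(cost r' [::] L) -/(cost r (rev L) [::]).
  move=> h1 h2 h3 h4.
  have : (lam r - lam r') * ((cost r' [::] L)%:~R - (cost r (rev L) [::])%:~R) = 0 by lra.
  move/eqP; rewrite mulf_eq0 !subr_eq0 gt_eqF //= eqr_int => /eqP <-.
  exact: bad.
have walk : forall pre rest, L = pre ++ rest -> rest != [::] ->
    cost r (rev pre) rest <= b -> exists pre' x rest', [/\ L = pre' ++ x :: rest',
      cost r (rev pre') (x :: rest') <= b &
      lam r = 0 \/ b < cost r (x :: rev pre') rest'].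
  move=> pre rest; elim: rest pre => // x rest IH pre eL _ cb.
  have [lt_b|le_b] := ltP b (cost r (x :: rev pre) rest).
    by exists pre, x, rest; split=> //; right.
  case: rest => [|y rest] in IH eL cb le_b *.
    case: hi => hi; first by exists pre, x, [::]; split=> //; left.
    by move: hi; rewrite eL rev_cat /= ltNge le_b.
  by apply: (IH (rcons pre x)); rewrite ?cat_rcons ?rev_rcons.
have [pre [x [rest [eL c1 c2]]]] := walk [::] L erefl L0 cr.
exists r, pre, x, rest; split=> //.
  apply: le_trans c1; apply: sum_sub => //.
  - apply: rem_uniq; apply: sol_uniq; move: uF; rewrite eL; congr is_true.
    by apply: perm_uniq; rewrite perm_cat2l -[x :: rest]cat1s perm_catCA /= perm_cons
      perm_cat2r perm_sym perm_rev.
  - apply: sol_uniq; move: uF; rewrite eL; congr is_true.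
    by apply: perm_uniq; rewrite perm_cat2l perm_cat2r perm_sym perm_rev.
  apply: chain_sub => //; move: uF; rewrite eL; congr is_true.
  by apply: perm_uniq; rewrite perm_cat2l perm_cat2r perm_sym perm_rev.
have pm : perm_eq L ((x :: rev pre) ++ rest).
  rewrite eL -[x :: rest]cat1s perm_catCA /= perm_cons.
  by rewrite perm_cat2r perm_sym perm_rev.
have uF' : uniq (F ++ (x :: rev pre) ++ rest).
  by move: uF; congr is_true; apply: perm_uniq; rewrite perm_cat2l.
have ZF' : {subset Z <= F ++ (x :: rev pre) ++ rest}.
  by move=> y /ZF; rewrite !(mem_cat _ F) (perm_mem pm).
have := sol_opt ar ZI FZ ZF' uF'; set X := sol r _ _.
have -> : \sum_(y in Z) lw (lam r) y =
    (\sum_(y in Z) p y)%:~R - lam r * (\sum_(y in Z) c y)%:~R.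
  by rewrite !rmorph_sum /= sumrB mulr_sumr.
rewrite sum_lw => opt.
have le1 : \sum_(y in Z) p y <= \sum_(y <- X) p y.
  rewrite -(ler_int rat); case: c2 => [l0|lt_b].
    by move: opt; rewrite l0 !mul0r !subr0.
  have cc : (\sum_(y in Z) c y)%:~R <= (\sum_(y <- X) c y)%:~R :> rat.
    by rewrite ler_int; apply: le_trans cZ (ltW lt_b).
  have : 0 <= lam r * ((\sum_(y <- X) c y)%:~R - (\sum_(y in Z) c y)%:~R).
    by apply: mulr_ge0; rewrite ?lam_ge0 // subr_ge0.
  by lra.
apply: le_trans le1 _; case: (boolP (x \in X)) => xX.
  by rewrite (big_rem x xX) /= addrC.
by rewrite rem_id // lerDl p_ge0.
Qed.

End Lagrange.

(** * Candidates and representatives *)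

Section Candidates.

Variables (E : finType) (I : {set {set E}}) (p c : E -> int) (b : int).
Implicit Types (x y : E) (l F R acc rest : seq E).

Definition profit_class (a d : int) x : int := (p x * a %/ d)%Z.

Definition class_filter (a d lo hi : int) l :=
  [seq x <- l | (lo <= profit_class a d x) && (profit_class a d x <= hi)].

Definition pick_reps_step (a d q : int) R x :=
  let S := class_filter a d (profit_class a d x) (profit_class a d x) R in
  if ((size S)%:Z + 1 <= q) && ([set e in x :: S] \in I) then x :: R else R.

Definition pick_reps a d q R l := foldl (pick_reps_step a d q) R l.

Fixpoint enumF R F (h : nat) : seq (seq E) :=
  if R is x :: R' then
    enumF R' F h ++ (if h is h'.+1 then enumF R' (x :: F) h' else [::])
  else [:: F].

Fixpoint chainc F (r : int * int) acc rest : seq (seq E) :=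
  if rest is x :: rest' then
    rem x (greedy I F (lag_order p c r.1 r.2 (x :: acc) rest')) :: chainc F r (x :: acc) rest'
  else [::].

Definition leafc F (ratios : seq (int * int)) L : seq (seq E) :=
  flatten [seq chainc F r [::] L | r <- ratios] ++ [:: F].

Definition candidates ratios R (h : nat) L : seq (seq E) :=
  flatten [seq leafc F ratios L | F <- enumF R [::] h].

Definition psum l := \sum_(x <- l) p x.
Definition csum l := \sum_(x <- l) c x.

Definition feasible l := ([set e in l] \in I) && (csum l <= b).

Definition better best cand :=
  if feasible cand && (psum best <= psum cand) then cand else best.

Lemma better_foldl best cands : feasible best -> uniq best -> all uniq cands ->
  let res := foldl better best cands in
  [/\ feasible res, uniq res, psum best <= psum res &
      forall s, s \in cands -> feasible s -> psum s <= psum res].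
Proof.
elim: cands best => [|s cands IH] best fb ub /=; first by split.
case/andP => us uc; have [||fr ur le_r hr] := IH (better best s) _ _ uc.
- by rewrite /better; case: ifP => // /andP[].
- by rewrite /better; case: ifP.
have le1 : psum best <= psum (better best s) by rewrite /better; case: ifP => // /andP[].
split=> //; first exact: le_trans le1 _.
move=> s'; rewrite inE => /orP[/eqP -> fs|]; last exact: hr.
apply: le_trans le_r; rewrite /better fs /=.
by case: (leP (psum best) (psum s)) => [_|/ltW].
Qed.

Lemma enumF_mem R F h sub : subseq sub R -> (size sub <= h)%N ->
  rev sub ++ F \in enumF R F h.
Proof.
elim: R F h sub => [|x R IH] F h sub /=.
  by move=> /eqP -> _; rewrite mem_head.
case: sub => [|y sub] //= => [_ h0|].
  by rewrite mem_cat (IH F h [::]) // sub0seq.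
case: ifP => [/eqP -> ss|_ ss] sh; last first.
  by rewrite mem_cat (IH F h (y :: sub)).
by case: h sh => // h sh; rewrite mem_cat rev_cons cat_rcons IH ?orbT.
Qed.

Lemma enumF_inv R F h F' : F' \in enumF R F h ->
  exists2 sub, subseq sub R & F' = rev sub ++ F.
Proof.
elim: R F h => [|x R IH] F h /=; first by rewrite inE => /eqP ->; exists [::].
rewrite mem_cat => /orP[/IH [sub ss ->]|].
  by exists sub => //; exact: subseq_trans ss (subseq_cons _ _).
case: h => // h /IH [sub ss ->]; exists (x :: sub); rewrite /= ?eqxx //.
by rewrite rev_cons cat_rcons.
Qed.

Lemma class_filter_sub a d lo hi l : {subset class_filter a d lo hi l <= l}.
Proof. exact: mem_subseq (filter_subseq _ _). Qed.

Lemma chainc_mem F r pre x rest acc :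
  rem x (greedy I F (lag_order p c r.1 r.2 (x :: rev pre ++ acc) rest))
    \in chainc F r acc (pre ++ x :: rest).
Proof.
elim: pre acc => [|y pre IH] acc /=; first by rewrite mem_head.
by rewrite inE; have := IH (y :: acc); rewrite rev_cons cat_rcons => ->; rewrite orbT.
Qed.

Lemma chainc_uniq F r acc rest : uniq (F ++ acc ++ rest) ->
  all uniq (chainc F r acc rest).
Proof.
elim: rest acc => [|x rest IH] acc //= uF.
have uF' : uniq (F ++ (x :: acc) ++ rest).
  move: uF; congr is_true; apply: perm_uniq.
  by rewrite perm_cat2l -[x :: rest]cat1s perm_catCA.
by rewrite IH // andbT; apply: rem_uniq; apply: (sol_uniq I p c r uF').
Qed.

Lemma leafc_uniq F ratios L : uniq (F ++ L) -> all uniq (leafc F ratios L).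
Proof.
move=> uF; rewrite all_cat /=; apply/and3P; split=> //; last first.
  by move: uF; rewrite cat_uniq => /andP[].
by apply/allP => s /flatten_mapP[r _ sr]; apply: (allP (chainc_uniq r (acc := [::]) uF)).
Qed.

Lemma candidates_uniq ratios R h L : uniq (R ++ L) -> all uniq (candidates ratios R h L).
Proof.
move=> uRL; apply/allP => s /flatten_mapP[F /enumF_inv[sub ss ->]].
rewrite cats0; apply/allP; apply: leafc_uniq; move: uRL.
rewrite !cat_uniq => /and3P[uR hRL ->]; rewrite rev_uniq (subseq_uniq ss uR) andbT /=.
apply: contra hRL => /hasP[x xL]; rewrite /= mem_rev => xs.
by apply/hasP; exists x => //; exact: mem_subseq ss _ xs.
Qed.

End Candidates.

Section Representatives.

Variables (E : finType) (I : {set {set E}}).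
Hypothesis matI : matroid I.
Variables (p c : E -> int) (b : int).
Hypotheses (p_ge0 : forall x, 0 <= p x) (c_ge0 : forall x, 0 <= c x).
Implicit Types (S T W : {set E}) (x y z : E) (l F R acc rest : seq E).

Lemma pick_reps_mono a d q R l : {subset R <= pick_reps I p a d q R l}.
Proof.
elim: l R => [|x l IH] R y //= yR; apply: IH.
by rewrite /pick_reps_step /=; case: ifP => // _; rewrite inE yR orbT.
Qed.

Lemma pick_reps_sub a d q R l : {subset pick_reps I p a d q R l <= R ++ l}.
Proof.
elim: l R => [|x l IH] R y //=; first by rewrite cats0.
move/IH; rewrite !mem_cat /pick_reps_step /= inE; case: ifP => _; rewrite ?inE;
  by case: (y == x); case: (y \in R); case: (y \in l).
Qed.

Lemma pick_reps_step_uniq a d q R x l : uniq (R ++ x :: l) ->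
  uniq (pick_reps_step I p a d q R x ++ l).
Proof.
by rewrite -cat1s uniq_catCA /= => h; rewrite /pick_reps_step /=; case: ifP => _ //; case/andP: h.
Qed.

Lemma pick_reps_uniq a d q R l : uniq (R ++ l) -> uniq (pick_reps I p a d q R l).
Proof.
elim: l R => [|x l IH] R /=; first by rewrite cats0.
by move=> h; apply: IH; apply: pick_reps_step_uniq.
Qed.

Lemma pick_reps_spec a d q R l x :
    (forall y z, y \in R -> z \in l -> c y <= c z) -> pairwise (fun x y => c x <= c y) l ->
    (forall k, [set e in class_filter p a d k k R] \in I) -> uniq (R ++ l) ->
    x \in l -> x \notin pick_reps I p a d q R l ->
  exists B : {set E}, [/\ B \in I, {subset B <= pick_reps I p a d q R l},
    forall y, y \in B -> profit_class p a d y = profit_class p a d x /\ c y <= c x &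
    (q <= #|B|%:Z) \/ x |: B \notin I].
Proof.
elim: l R => // z l IH R cR /= /andP[cz cl] RI uR; rewrite inE.
have class_filter_profit_class k y : y \in class_filter p a d k k R -> profit_class p a d y = k.
  by rewrite mem_filter => /andP[/le_anti].
case: (eqVneq x z) => [-> _|xz /= xl] xR; last first.
  apply: IH => //.
  - move=> y w; rewrite /pick_reps_step /=; case: ifP => _ yR wl.
      move: yR; rewrite inE => /orP[/eqP->|yR]; first exact: (allP cz).
      by apply: cR; rewrite // inE wl orbT.
    by apply: cR; rewrite // inE wl orbT.
  - move=> k; rewrite /pick_reps_step /=; case: ifP => // /andP[_ h] /=.
    case: ifP => // /le_anti e; by rewrite -e in h *.
  exact: pick_reps_step_uniq.
set B := class_filter p a d (profit_class p a d z) (profit_class p a d z) R.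
exists [set e in B]; split.
- exact: RI.
- move=> y; rewrite inE => /class_filter_sub yR; apply: pick_reps_mono; rewrite /pick_reps_step /=.
  by case: ifP => // _; rewrite inE yR orbT.
- move=> y; rewrite inE => yB; split; first exact: class_filter_profit_class.
  by apply: cR; rewrite ?mem_head //; exact: class_filter_sub yB.
move: xR; rewrite /pick_reps_step /= -/B; case: ifP => [_|/negbT h _].
  by rewrite pick_reps_mono // mem_head.
move: h; rewrite negb_and -ltNge set_cons => /orP[h|]; [left|by right].
have -> : #|[set e in B]| = size B.
  by rewrite cardsE; apply/card_uniqP/filter_uniq; move: uR; rewrite cat_uniq => /andP[].
by lia.
Qed.

End Representatives.

(** * Exchanging heavy items *)

Section Approximation.

Variables (E : finType) (I : {set {set E}}).
Hypothesis matI : matroid I.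
Variables (p c : E -> int) (b : int).
Hypotheses (p_ge0 : forall x, 0 <= p x) (c_ge0 : forall x, 0 <= c x).
Implicit Types (S T W : {set E}) (x y z : E) (l F R acc rest : seq E).

Lemma top_set (m : nat) S : exists T, [/\ T \subset S, (#|T| <= m)%N &
  forall z, z \in S :\: T -> m%:Z * p z <= \sum_(x in T) p x].
Proof.
elim: m => [|m [T [TS Tm hT]]].
  exists set0; split; rewrite ?sub0set ?cards0 // => z _.
  by rewrite mul0r big_set0.
have [e0|[z0 z0S]] := set_0Vmem (S :\: T).
  by exists T; split=> // [|z]; [exact: leqW|rewrite e0 inE].
case: (@arg_maxP _ _ _ z0 [in S :\: T] p z0S) => z zS zmax.
have zT : z \notin T by move: zS; rewrite inE => /andP[].
exists (z |: T); split.
- by rewrite subUset sub1set TS andbT; move: zS; rewrite inE => /andP[].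
- by rewrite cardsU1 zT.
move=> y; rewrite in_setD in_setU1 negb_or => /andP[/andP[yz yT] yS].
have yST : y \in S :\: T by rewrite in_setD yT.
rewrite big_setU1 //= addrC -addn1 PoszD mulrDl mul1r lerD ?hT //.
exact: zmax.
Qed.

Variables (k : int) (d : int) (R : seq E).
Hypotheses (k_gt0 : 0 < k) (d_gt0 : 0 < d).

Local Notation cl := (profit_class p (k * k) d).
Definition heavy x := (k <= cl x) && (cl x <= 2 * k * k - 1).

Lemma profit_class_ge x : cl x * d <= p x * (k * k).
Proof. by rewrite /profit_class lez_floor // gt_eqF. Qed.

Lemma profit_class_lt x : p x * (k * k) < (cl x + 1) * d.
Proof. by rewrite /profit_class ltz_ceil. Qed.

Lemma light_le x : cl x <= k - 1 -> k * p x <= d.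
Proof.
move=> h; have := profit_class_lt x; have h1 : (cl x + 1) * d <= k * d by rewrite ler_wpM2r; lia.
nia.
Qed.

Hypothesis R_heavy : forall x, x \in R -> heavy x.
Hypothesis R_spec : forall x, heavy x -> x \notin R ->
  exists B : {set E}, [/\ B \in I, {subset B <= R},
    forall y, y \in B -> cl y = cl x /\ c y <= c x &
    (k * k + 2 * k <= #|B|%:Z) \/ x |: B \notin I].

Variable opt : int.
Hypothesis opt_max : forall S, S \in I -> \sum_(x in S) c x <= b -> \sum_(x in S) p x <= opt.

Lemma swap S x : S \in I -> x \in S -> heavy x -> x \notin R ->
    (#|[set y in S | heavy y]|%:Z <= 2 * k) -> \sum_(y in S) p y <= opt -> exists y W,
  [/\ [/\ y \in R, y \notin S, cl y = cl x & c y <= c x],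
      [/\ W \subset S & forall z, z \in W -> ~~ heavy z],
      k * k * \sum_(z in W) p z <= opt & y |: ((S :\ x) :\: W) \in I].
Proof.
move=> SI xS hx xR hS leS; have [B [BI BR Bx [Bq|xB]]] := R_spec hx xR; last first.
  have [y [yB yS yI]] := indep_swap matI SI BI xS xB.
  have [e1 e2] := Bx _ yB.
  exists y, set0; split; rewrite ?setD0 ?sub0set ?big_set0 ?mulr0 //.
  - by split=> //; exact: BR.
  - by split=> // z; rewrite inE.
  apply: le_trans leS; exact: sumr_ge0.
set H := [set y in S | heavy y] in hS.
have [T [TS Tk Th]] := top_set (absz (k * k)) (S :\: H).
have xH : x \in H by rewrite inE xS.
set C := (H :\ x) :|: T.
have HS : H \subset S by apply/subsetP => y; rewrite inE => /andP[].
have CS : C \subset S :\ x.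
  rewrite subUset setSD //=; apply/subsetP => y /(subsetP TS).
  rewrite !inE => /andP[h yS]; rewrite yS andbT; apply: contra h => /eqP ->.
  by rewrite xS.
have SxI : S :\ x \in I by apply: (indepS matI) SI _; exact: subsetDl.
have CI : C \in I by exact: (indepS matI) SxI CS.
have lt_c : (#|C| < #|B|)%N.
  have h1 : (#|C| <= #|H :\ x| + #|T|)%N by rewrite cardsU leq_subr.
  have h2 := cardsD1 x H; rewrite xH in h2.
  have h3 : (absz (k * k))%:Z = k * k by rewrite gez0_abs // mulr_ge0 // ltW.
  rewrite -ltz_nat; apply: lt_le_trans Bq; apply: lt_le_trans (_ : #|H|%:Z + k * k <= _).
    rewrite -h3 -PoszD ltz_nat h2 add1n addSn ltnS.
    by apply: leq_trans h1 _; rewrite leq_add2l.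
  by rewrite addrC lerD2l.
have [y] := indep_aug matI CI BI lt_c; rewrite inE => /andP[yC yB] yCI.
have [e1 e2] := Bx _ yB.
have hy : heavy y by rewrite /heavy e1.
have yx : y != x by apply: contraNneq xR => <-; exact: BR.
have yS : y \notin S.
  by apply: contra yC => yS; rewrite /C !inE yx yS hy.
have [D bD CD] := basis_extend matI yCI (subsetUl (y |: C) (S :\ x)).
have [DI DA hD] := bD.
pose W := (S :\ x) :\: D.
have eD : D = y |: ((S :\ x) :&: D).
  apply/setP => z; rewrite in_setU1 in_setI.
  case: (eqVneq z y) => [->|zy] /=; first by apply: (subsetP CD); rewrite !inE eqxx.
  case: (boolP (z \in D)) => zD; rewrite ?andbF // andbT; apply/esym.
  have := subsetP DA _ zD; rewrite in_setU in_setU1 (negbTE zy) /= => /orP[|//].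
  exact: (subsetP CS).
have leW : (#|W| <= 1)%N.
  have h1 : (#|S :\ x| <= #|D|)%N by rewrite hD; apply: card_le_rk => //; exact: subsetUr.
  have h2 : (#|D| <= 1 + #|(S :\ x) :&: D|)%N.
    by rewrite {1}eD cardsU1; case: (_ \notin _).
  have h3 := cardsID D (S :\ x).
  rewrite -(leq_add2l #|(S :\ x) :&: D|) h3 (leq_trans h1) // addnC.
  exact: h2.
have WT z : z \in W -> z \in (S :\: H) :\: T.
  move=> zW; have : z \in (S :\ x) :\: D := zW.
  rewrite in_setD in_setD1 => /and3P[zD zx zS].
  have zC : z \notin C by apply: contra zD => zC; apply: (subsetP CD); rewrite inE zC orbT.
  move: zC; rewrite /C in_setU in_setD1 zx negb_or /= => /andP[zH zT].
  by rewrite !in_setD zH zT.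
exists y, W; split.
- by split=> //; exact: BR.
- split; first by apply: subset_trans (subsetDl _ _) (subsetDl _ _).
  by move=> z /WT; rewrite !inE => /and3P[_ h zS]; move: h; rewrite zS.
- apply: le_trans leS.
  have [->|[z zW]] := set_0Vmem W; first by rewrite big_set0 mulr0 sumr_ge0.
  have -> : W = [set z].
    apply/esym/eqP; rewrite eqEcard sub1set zW cards1.
    exact: leW.
  rewrite big_set1.
  have := Th _ (WT _ zW); rewrite gez0_abs; last by rewrite mulr_ge0 // ltW.
  move/le_trans; apply.
  rewrite [leRHS](big_setID T) /= (setIidPr _); last first.
    by apply: subset_trans TS (subsetDl _ _).
  by rewrite lerDl sumr_ge0.
apply: (indepS matI) DI _; rewrite subUset sub1set; apply/andP; split.
  by apply: (subsetP CD); rewrite !inE eqxx.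
by apply/subsetP => z; rewrite /W !inE; case: (z \in D) => //; case: (z \in S); case: (z == x).
Qed.

Lemma represent (n : nat) S :
    S \in I -> \sum_(x in S) c x <= b -> #|[set y in S | heavy y]|%:Z <= 2 * k ->
    (forall x, x \in S -> heavy x || (cl x <= k - 1)) ->
    #|[set y in S | heavy y && (y \notin R)]| = n -> exists S',
  [/\ S' \in I, \sum_(x in S') c x <= b, #|[set y in S' | heavy y]|%:Z <= 2 * k,
    forall x, x \in S' -> (x \in R) || (cl x <= k - 1) &
    k * k * \sum_(x in S) p x <= k * k * \sum_(x in S') p x + n%:Z * (d + opt)].
Proof.
elim: n S => [|n IH] S SI cS hS hl hn.
  exists S; split=> //; last by rewrite mul0r addr0.
  move=> x xS; have /orP[hx|->] := hl x xS; last by rewrite orbT.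
  rewrite -[x \in R]negbK; apply/orP; left; apply/negP => xR.
  by have := cards0_eq hn; move/setP/(_ x); rewrite !inE xS hx xR.
have [x] : exists x, x \in [set y in S | heavy y && (y \notin R)].
  by apply/card_gt0P; rewrite hn.
rewrite !inE => /and3P[xS hx xR].
have pS := opt_max SI cS.
have [y [W [[yR yS eyx cyx] [WS Wl] leW yI]]] := swap SI xS hx xR hS pS.
set S1 := y |: _ in yI.
have hy : heavy y := R_heavy yR.
have xW : x \notin W by apply/negP => /Wl; rewrite hx.
have WSx : W \subset S :\ x.
  apply/subsetP => z zW; rewrite in_setD1 (subsetP WS _ zW) andbT.
  by apply: contraNneq xW => <-.
have ynS : y \notin (S :\ x) :\: W by rewrite !inE (negbTE yS) !andbF.
have sumE (f : E -> int) : \sum_(z in S) f z + f y =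
    \sum_(z in S1) f z + f x + \sum_(z in W) f z.
  rewrite (big_setD1 x xS) /= (big_setID W) /= (setIidPr WSx) big_setU1 //=.
  by ring.
have cS1 : \sum_(z in S1) c z <= b.
  apply: le_trans cS; rewrite -(lerD2r (c y)) sumE.
  apply: le_trans (_ : \sum_(z in S1) c z + c x <= _); first by rewrite lerD2l.
  by rewrite lerDl sumr_ge0.
have eh : [set z in S1 | heavy z] = y |: ([set z in S | heavy z] :\ x).
  apply/setP => z; rewrite !inE; case: (eqVneq z y) => [->|_] /=; first by rewrite hy.
  case: (boolP (z \in W)) => [/Wl/negbTE ->|_]; rewrite ?andbF //=.
  by rewrite andbA.
have hS1 : #|[set z in S1 | heavy z]|%:Z <= 2 * k.
  apply: le_trans hS; rewrite eh cardsU1 lez_nat.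
  by rewrite [X in (_ <= X)%N](cardsD1 x) inE xS hx leq_add2r leq_b1.
have hl1 z : z \in S1 -> heavy z || (cl z <= k - 1).
  rewrite in_setU1 => /orP[/eqP ->|]; first by rewrite hy.
  by rewrite !inE => /and3P[_ _]; exact: hl.
have hn1 : #|[set z in S1 | heavy z && (z \notin R)]| = n.
  have -> : [set z in S1 | heavy z && (z \notin R)] =
      [set y in S | heavy y && (y \notin R)] :\ x.
    apply/setP => z; rewrite !inE; case: (eqVneq z y) => [->|_] /=.
      by rewrite yR (negbTE yS) !andbF.
    case: (boolP (z \in W)) => [/Wl/negbTE ->|_]; first by rewrite /= !andbF.
    by rewrite /= -!andbA.
  by have := cardsD1 x [set y in S | heavy y && (y \notin R)]; rewrite hn !inE xS hx xR => -[].
have [S' [h1 h2 h3 h4 h5]] := IH S1 yI cS1 hS1 hl1 hn1.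
exists S'; split=> //.
apply: le_trans (_ : k * k * \sum_(z in S1) p z + (d + opt) <= _); last first.
  by rewrite -addn1 PoszD mulrDl mul1r [leRHS]addrA lerD2r.
have g1 : k * k * p x <= k * k * p y + d.
  rewrite [k * k * p x]mulrC [k * k * p y]mulrC; apply: ltW.
  apply: lt_le_trans (profit_class_lt x) _.
  by rewrite mulrDl mul1r lerD2r -eyx profit_class_ge.
rewrite -(lerD2r (k * k * p y)) -mulrDr sumE !mulrDr.
rewrite [leRHS](_ : _ = k * k * \sum_(z in S1) p z + (k * k * p y + d) + opt); last by ring.
by apply: lerD leW; rewrite lerD2l.
Qed.

End Approximation.

Section Guarantee.

Variables (E : finType) (I : {set {set E}}).
Hypothesis matI : matroid I.
Variables (p c : E -> int) (b : int).
Hypotheses (p_ge0 : forall x, 0 <= p x) (c_ge0 : forall x, 0 <= c x).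
Implicit Types (S T W : {set E}) (x y z : E) (l F R acc rest : seq E).

Definition reps (k d : int) items :=
  pick_reps I p (k * k) d (k * k + 2 * k) [::] (class_filter p (k * k) d k (2 * k * k - 1) items).

Definition lights (k d : int) items := class_filter p (k * k) d 0 (k - 1) items.

Lemma reps_lights_uniq k d items : uniq items -> uniq (reps k d items ++ lights k d items).
Proof.
move=> ui; rewrite cat_uniq pick_reps_uniq ?filter_uniq // andbT /=.
apply/hasPn => x; rewrite mem_filter => /andP[/andP[_ h] _]; apply/negP => /pick_reps_sub.
rewrite mem_filter => /andP[/andP[h' _] _]; lia.
Qed.

Lemma guarantee (k d : int) items (ratios : seq (int * int)) S :
    0 < k -> 0 < d -> uniq items -> (forall x, x \in items) ->
    pairwise (fun x y => c x <= c y) items ->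
    (0, 1) \in ratios -> (forall x, (p x, c x) \in ratios) ->
    (forall x y, (p x - p y, c x - c y) \in ratios) ->
    S \in I -> \sum_(x in S) c x <= b ->
    (forall S', S' \in I -> \sum_(x in S') c x <= b ->
      \sum_(x in S') p x <= \sum_(x in S) p x) ->
    d <= \sum_(x in S) p x < 2 * d -> exists2 s,
  s \in candidates I p c ratios (reps k d items) (absz (2 * k)) (lights k d items) &
  feasible I c b s && ((k - 5) * \sum_(x in S) p x <= k * psum p s).
Proof.
move=> k0 d0 ui ai ci r0 r1 r2 SI cS opt_max /andP[dS Sd].
set opt := \sum_(x in S) p x in opt_max dS Sd *.
set R := reps k d items; set L := lights k d items.
have uRL : uniq (R ++ L) := reps_lights_uniq k d ui.
have R_heavy x : x \in R -> heavy p k d x.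
  by move=> /pick_reps_sub; rewrite mem_filter => /andP[].
have R_spec x : heavy p k d x -> x \notin R -> exists B : {set E},
    [/\ B \in I, {subset B <= R},
    forall y, y \in B -> profit_class p (k * k) d y = profit_class p (k * k) d x /\ c y <= c x &
    (k * k + 2 * k <= #|B|%:Z) \/ x |: B \notin I].
  move=> hx xR; apply: pick_reps_spec => //.
  - by apply: subseq_pairwise ci; exact: filter_subseq.
  - move=> z; suff -> : [set e : E in class_filter p (k * k) d z z [::]] = set0 by case: matI.
    by apply/setP => e; rewrite !inE.
  - exact: filter_uniq.
  by rewrite mem_filter ai andbT.
have pS x : x \in S -> p x < 2 * d.
  by move=> xS; apply: le_lt_trans Sd; rewrite /opt (big_setD1 x xS) lerDl sumr_ge0.
have hl x : x \in S -> heavy p k d x || (profit_class p (k * k) d x <= k - 1).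
  move=> xS; rewrite /heavy; case: (leP k _) => h /=; last by rewrite lerBrDr lezD1.
  have h1 := profit_class_ge p k d0 x; have h2 := pS x xS; apply/orP; left.
  rewrite lerBrDr lezD1 -(ltr_pM2r d0); apply: le_lt_trans h1 _.
  have -> : 2 * k * k * d = (2 * d) * (k * k) by ring.
  by rewrite ltr_pM2r // mulr_gt0.
have hS : #|[set y in S | heavy p k d y]|%:Z <= 2 * k.
  have h1 : #|[set y in S | heavy p k d y]|%:Z * d <= k * opt.
    apply: (@le_trans _ _ (\sum_(y in [set y in S | heavy p k d y]) k * p y)).
      rewrite -natz mulr_natl -sumr_const; apply: ler_sum => y.
      rewrite inE => /andP[_ /andP[ky _]]; rewrite -(ler_pM2l k0).
      have -> : k * (k * p y) = p y * (k * k) by ring.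
      by apply: le_trans (profit_class_ge p k d0 y); rewrite ler_pM2r.
    rewrite -mulr_sumr ler_pM2l // /opt [leRHS](bigID (heavy p k d)) /=.
    rewrite (eq_bigl (fun y => (y \in S) && heavy p k d y)) ?lerDl ?sumr_ge0 // => y.
    by rewrite inE.
  apply: ltW; rewrite -(ltr_pM2r d0); apply: le_lt_trans h1 _.
  have -> : 2 * k * d = k * (2 * d) by ring.
  by rewrite ltr_pM2l.
have [S' [S'I cS' hS' S'R pS']] :=
  represent matI p_ge0 c_ge0 k0 d0 R_heavy R_spec opt_max SI cS hS hl erefl.
set n := #|_| in pS'.
have n_le : n%:Z <= 2 * k.
  apply: le_trans hS; rewrite lez_nat; apply: subset_leq_card; apply/subsetP => x.
  by rewrite !inE => /and3P[-> -> _].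
have opt0 : 0 <= opt by exact: sumr_ge0.
have kpS' : (k - 4) * opt <= k * \sum_(x in S') p x.
  have h1 : n%:Z * (d + opt) <= 2 * k * (2 * opt).
    apply: ler_pM => //; first by rewrite addr_ge0 // ltW.
    have -> : 2 * opt = opt + opt by ring.
    by rewrite lerD2r.
  rewrite -(ler_pM2l k0).
  have -> : k * ((k - 4) * opt) = k * k * opt - 2 * k * (2 * opt) by ring.
  rewrite lerBlDr (mulrA k k (\sum_(x in S') p x)); apply: le_trans pS' _.
  by rewrite lerD2l.
pose sub := [seq x <- R | x \in S'].
have subR : subseq sub R by exact: filter_subseq.
have size_sub : (size sub <= absz (2 * k)%R)%N.
  rewrite -lez_nat gez0_abs; last by rewrite mulr_ge0 // ltW.
  apply: le_trans hS'; rewrite lez_nat.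
  have /card_uniqP <- : uniq sub.
    by apply: filter_uniq; move: uRL; rewrite cat_uniq => /andP[].
  apply: subset_leq_card; apply/subsetP => x; rewrite mem_filter inE.
  by case/andP => -> /R_heavy.
pose F := rev sub.
have Fin : F \in enumF R [::] (absz (2 * k)).
  by have := enumF_mem [::] subR size_sub; rewrite cats0.
have memF x : (x \in F) = (x \in S') && (x \in R) by rewrite mem_rev mem_filter.
have FS' : {subset F <= S'} by move=> x; rewrite memF => /andP[].
have FI : [set e in F] \in I.
  by apply: (indepS matI) S'I _; apply/subsetP => x; rewrite inE; exact: FS'.
have uFL : uniq (F ++ L).
  move: uRL; rewrite !cat_uniq rev_uniq => /and3P[uR h ->].
  rewrite filter_uniq // andbT /=; apply: contra h => /hasP[x xL].
  by rewrite /= memF => /andP[_ xR]; apply/hasP; exists x.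
have memL x : (x \in L) = (profit_class p (k * k) d x <= k - 1).
  rewrite mem_filter ai andbT andb_idl // => _.
  by rewrite /profit_class divz_ge0 // mulr_ge0 // mulr_ge0 // ltW.
have S'F : {subset S' <= F ++ L}.
  by move=> x xS'; rewrite mem_cat memF xS' /= memL; exact: S'R.
have leaf s : s \in leafc I p c F ratios L ->
    s \in candidates I p c ratios R (absz (2 * k)) L.
  by move=> sl; apply/flatten_mapP; exists F.
have [L0|L0] := eqVneq L [::].
  exists F; first by apply: leaf; rewrite mem_cat mem_head orbT.
  have eF : [set e in F] = S'.
    apply/setP => x; rewrite inE; apply/idP/idP; first exact: FS'.
    by move/S'F; rewrite L0 cats0.
  have uF : uniq F by move: uFL; rewrite cat_uniq => /andP[].
  rewrite /feasible FI /csum /psum !big_list_set // eF cS' /=.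
  by apply: le_trans kpS'; rewrite ler_wpM2r // lerD2l lerN2.
have cL : pairwise (fun x y => c x <= c y) L.
  by apply: subseq_pairwise ci; exact: filter_subseq.
have [r [pre [x [rest [rr eL c1 p1]]]]] :=
  lagrangian matI p_ge0 c_ge0 FI S'I FS' S'F uFL cL cS' L0 r0 r1 r2.
set s := rem x _ in c1 p1.
exists s.
  apply: leaf; rewrite mem_cat; apply/orP; left; apply/flatten_mapP.
  by exists r => //; rewrite eL; have := chainc_mem I p c F r pre x rest [::]; rewrite cats0.
have sI : [set e in s] \in I.
  have uF' : uniq (F ++ (x :: rev pre) ++ rest).
    move: uFL; rewrite eL; congr is_true; apply: perm_uniq.
    rewrite perm_cat2l -[x :: rest]cat1s perm_catCA /= perm_cons perm_cat2r.
    by rewrite perm_sym perm_rev.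
  apply: (indepS matI) (sol_indep matI p c FI r uF') _; apply/subsetP => y.
  by rewrite !inE => /mem_rem.
rewrite /feasible sI c1 /=.
have px : k * p x <= d.
  by apply: (light_le k0 d0); rewrite -memL eL mem_cat mem_head orbT.
rewrite /psum; have : k * \sum_(y in S') p y <= k * (\sum_(y <- s) p y + p x).
  by rewrite ler_pM2l.
rewrite mulrDr => h.
have h2 : (k - 4) * opt <= k * (\sum_(y <- s) p y) + opt.
  by apply: le_trans kpS' (le_trans h _); rewrite lerD2l (le_trans px).
have -> : (k - 5) * opt = (k - 4) * opt - opt by ring.
by rewrite lerBlDr.
Qed.

End Guarantee.

(** * The program and its cost model *)

Definition elist (s : seq expr) : expr := foldr EPair (EInt 0) s.

(* Component [i] of the argument tuple, outside of and under one [ELet]. *)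
Definition arg0 i := EFst (iter i ESnd (EVar 0)).
Definition arg1 i := EFst (iter i ESnd (EVar 1)).

(* An item is coded as (identifier, (profit, cost)). *)
Definition pE e := EFst (ESnd e).
Definition cE e := ESnd (ESnd e).
Definition wtE u v x := EOp Defs.Sub (EOp Mul v (pE x)) (EOp Mul u (cE x)).

(* Functions are called by their position in [bmi_prog]. *)
Definition findk_body :=
  EIf (EEps (EInt 5) (EVar 0)) (EVar 0) (ECall 1 (EOp Add (EVar 0) (EInt 1))).

Definition dens_body :=
  EIf (EVar 0)
    (EOp Mul (EOp Mul (ESnd (EFst (EFst (EVar 0)))) (ESnd (ESnd (EFst (EVar 0)))))
             (ECall 2 (ESnd (EVar 0))))
    (EInt 1).

Definition conv_body :=
  let scaled q := EOp Mul (EFst q) (EOp Div (arg0 2) (ESnd q)) in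
  EIf (arg0 0)
    (EPair
      (EPair (arg0 1) (EPair (scaled (ESnd (EFst (arg0 0)))) (scaled (EFst (EFst (arg0 0))))))
      (ECall 3 (elist [:: ESnd (arg0 0); EOp Add (arg0 1) (EInt 1); arg0 2])))
    (EInt 0).

Definition winsert_body :=
  EIf (arg0 1)
    (EIf (EOp Leq (wtE (arg0 2) (arg0 3) (EFst (arg0 1))) (wtE (arg0 2) (arg0 3) (arg0 0)))
      (EPair (arg0 0) (arg0 1))
      (EPair (EFst (arg0 1)) (ECall 4 (elist [:: arg0 0; ESnd (arg0 1); arg0 2; arg0 3]))))
    (EPair (arg0 0) (EInt 0)).

Definition wsort_body :=
  EIf (arg0 0)
    (ELet (ECall 5 (elist [:: ESnd (arg0 0); arg0 1; arg0 2; arg0 3; arg0 4]))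
      (EIf (EOp Leq (arg1 4) (wtE (arg1 2) (arg1 3) (EFst (arg1 0))))
        (ECall 4 (elist [:: EFst (arg1 0); EVar 0; arg1 2; arg1 3]))
        (EVar 0)))
    (arg0 1).

Definition ids_body :=
  EIf (EVar 0) (EPair (EFst (EFst (EVar 0))) (ECall 6 (ESnd (EVar 0)))) (EInt 0).

Definition greedy_body :=
  EIf (arg0 1)
    (ECall 7 (elist
      [:: EIf (EMem (EPair (EFst (EFst (arg0 1))) (ECall 6 (arg0 0))))
            (EPair (EFst (arg0 1)) (arg0 0)) (arg0 0);
          ESnd (arg0 1)]))
    (arg0 0).

Definition wsum_body :=
  EIf (arg0 0)
    (EOp Add (wtE (arg0 1) (arg0 2) (EFst (arg0 0)))
             (ECall 8 (elist [:: ESnd (arg0 0); arg0 1; arg0 2])))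
    (EInt 0).

Definition rem_body :=
  EIf (arg0 1)
    (EIf (EOp Defs.Sub (EFst (EFst (arg0 1))) (EFst (arg0 0)))
      (EPair (EFst (arg0 1)) (ECall 9 (elist [:: arg0 0; ESnd (arg0 1)])))
      (ESnd (arg0 1)))
    (EInt 0).

Definition better_body :=
  EIf (EMem (ECall 6 (arg0 1)))
    (EIf (EOp Leq (ECall 8 (elist [:: arg0 1; EInt (-1); EInt 0])) (arg0 2))
      (EIf (EOp Leq (ECall 8 (elist [:: arg0 0; EInt 0; EInt 1]))
                    (ECall 8 (elist [:: arg0 1; EInt 0; EInt 1])))
        (arg0 1) (arg0 0))
      (arg0 0))
    (arg0 0).

Definition chain_body :=
  EIf (arg0 2)
    (ECall 11 (elist
      [:: ECall 10 (elist
            [:: arg0 0;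
                ECall 9 (elist
                  [:: EFst (arg0 2);
                      ECall 7 (elist
                        [:: arg0 3;
                            ECall 5 (elist
                              [:: EPair (EFst (arg0 2)) (arg0 1);
                                  ECall 5 (elist
                                    [:: ESnd (arg0 2); EInt 0; arg0 4; arg0 5; EInt 1]);
                                  arg0 4; arg0 5; EInt 0])])]);
                arg0 6]);
          EPair (EFst (arg0 2)) (arg0 1); ESnd (arg0 2);
          arg0 3; arg0 4; arg0 5; arg0 6]))
    (arg0 0).

Definition leaf_body :=
  EIf (arg0 2)
    (ECall 12 (elist
      [:: ECall 11 (elist [:: arg0 0; EInt 0; arg0 3; arg0 1;
                              EFst (EFst (arg0 2)); ESnd (EFst (arg0 2)); arg0 4]);
          arg0 1; ESnd (arg0 2); arg0 3; arg0 4]))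
    (ECall 10 (elist [:: arg0 0; arg0 1; arg0 4])).

Definition enum_body :=
  EIf (arg0 1)
    (ELet (ECall 13 (elist [:: arg0 0; ESnd (arg0 1); arg0 2; arg0 3; arg0 4; arg0 5; arg0 6]))
      (EIf (arg1 3)
        (ECall 13 (elist [:: EVar 0; ESnd (arg1 1); EPair (EFst (arg1 1)) (arg1 2);
                             EOp Defs.Sub (arg1 3) (EInt 1); arg1 4; arg1 5; arg1 6]))
        (EVar 0)))
    (ECall 12 (elist [:: arg0 0; arg0 2; arg0 4; arg0 5; arg0 6])).

Definition class_filter_body :=
  let rest := ECall 14 (elist [:: ESnd (arg1 0); arg1 1; arg1 2; arg1 3; arg1 4]) in
  EIf (arg0 0)
    (ELet (EOp Div (EOp Mul (pE (EFst (arg0 0))) (arg0 1)) (arg0 2))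
      (EIf (EOp Leq (arg1 3) (EVar 0))
        (EIf (EOp Leq (EVar 0) (arg1 4)) (EPair (EFst (arg1 0)) rest) rest)
        rest))
    (EInt 0).

Definition len_body :=
  EIf (EVar 0) (EOp Add (ECall 15 (ESnd (EVar 0))) (EInt 1)) (EInt 0).

Definition pick_reps_body :=
  EIf (arg0 1)
    (ECall 16 (elist
      [:: ELet (ELet (EOp Div (EOp Mul (pE (EFst (arg0 1))) (arg0 2)) (arg0 3))
                     (ECall 14 (elist [:: arg1 0; arg1 2; arg1 3; EVar 0; EVar 0])))
            (EIf (EOp Leq (EOp Add (ECall 15 (EVar 0)) (EInt 1)) (arg1 4))
              (EIf (EMem (EPair (EFst (EFst (arg1 1))) (ECall 6 (EVar 0))))
                (EPair (EFst (arg1 1)) (arg1 0))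
                (arg1 0))
              (arg1 0));
          ESnd (arg0 1); arg0 2; arg0 3; arg0 4]))
    (arg0 0).

Definition scale_body :=
  let k := arg0 5 in
  let kk := EOp Mul k k in
  let k2 := EOp Mul (EInt 2) k in
  EIf (EOp Leq (arg0 1) (arg0 2))
    (ECall 17 (elist
      [:: ECall 13 (elist
            [:: arg0 0;
                ECall 16 (elist
                  [:: EInt 0;
                      ECall 14 (elist [:: arg0 3; kk; arg0 1; k;
                        EOp Defs.Sub (EOp Mul k2 k) (EInt 1)]);
                      kk; arg0 1; EOp Add kk k2]);
                EInt 0; k2; arg0 4;
                ECall 14 (elist [:: arg0 3; kk; arg0 1; EInt 0; EOp Defs.Sub k (EInt 1)]);
                arg0 6]);
          EOp Add (arg0 1) (arg0 1); arg0 2; arg0 3; arg0 4; arg0 5; arg0 6]))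
    (arg0 0).

Definition mkr1_body :=
  EIf (arg0 2)
    (ECall 18 (elist
      [:: EPair (EPair (EOp Defs.Sub (pE (arg0 1)) (pE (EFst (arg0 2))))
                       (EOp Defs.Sub (cE (arg0 1)) (cE (EFst (arg0 2)))))
                (arg0 0);
          arg0 1; ESnd (arg0 2)]))
    (arg0 0).

Definition mkr2_body :=
  EIf (arg0 1)
    (ECall 19 (elist
      [:: ECall 18 (elist
            [:: EPair (ESnd (EFst (arg0 1))) (arg0 0); EFst (arg0 1); arg0 2]);
          ESnd (arg0 1); arg0 2]))
    (arg0 0).

(* The environment is, from the inside: ratios, items, budget, common
   denominator, k, instance. *)
Definition main_body :=
  ELet (ECall 1 (EInt 1))
  (ELet (EOp Mul (ESnd (EFst (EVar 1))) (ECall 2 (ESnd (EVar 1))))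
  (ELet (EOp Mul (EFst (EFst (EVar 2))) (EOp Div (EVar 0) (ESnd (EFst (EVar 2)))))
  (ELet (ECall 5 (elist
      [:: ECall 3 (elist [:: ESnd (EVar 3); EInt 0; EVar 1]); EInt 0; EInt 1; EInt 0;
          EOp Defs.Sub (EInt 0) (EVar 0)]))
  (ELet (ECall 19 (elist [:: EPair (EPair (EInt 0) (EInt 1)) (EInt 0); EVar 0; EVar 0]))
  (ECall 6 (ECall 17 (elist
      [:: EInt 0; EInt 1; ECall 8 (elist [:: EVar 1; EInt 0; EInt 1]);
          EVar 1; EVar 0; EVar 4; EVar 2]))))))).

Definition bmi_prog : program :=
  [:: main_body; findk_body; dens_body; conv_body; winsert_body; wsort_body; ids_body;
      greedy_body; wsum_body; rem_body; better_body; chain_body; leaf_body; enum_body;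
      class_filter_body; len_body; pick_reps_body; scale_body; mkr1_body; mkr2_body].

Lemma bits_le (n : nat) (z : int) : (absz z <= 2 ^ n)%N -> (bits z <= n.+2)%N.
Proof.
move=> h; rewrite /bits !ltnS; have [->//|z0] := posnP (absz z).
rewrite -(@leq_exp2l 2) //; apply: leq_trans h.
exact: trunc_logP.
Qed.

Lemma leq_abszD (a b : int) : (absz (a + b)%R <= absz a + absz b)%N.
Proof. lia. Qed.

Lemma leq_absz_div (a d : int) : 0 <= a -> 0 < d -> (absz (a %/ d)%Z <= absz a)%N.
Proof.
move=> a0 d0; rewrite -lez_nat !gez0_abs ?divz_ge0 //.
have h1 := lez_floor a (lt0r_neq0 d0).
by apply: le_trans h1; rewrite ler_peMr ?divz_ge0 // -gtz0_ge1.
Qed.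

Section Evaluation.

Variables (mem : value -> bool) (eps : int -> int -> bool).

Definition ev env e v T := exists2 t, (t <= T)%N & eval bmi_prog mem eps env e v t.

Definition call f v w T := ev [:: v] (nth (EInt 0) bmi_prog f) w T.

Lemma ev_le env e v T T' : ev env e v T -> (T <= T')%N -> ev env e v T'.
Proof. by case=> t le_t h le_T; exists t => //; exact: leq_trans le_T. Qed.

Lemma ev_var env i v : nth (VInt 0) env i = v -> ev env (EVar i) v 1.
Proof. by move=> <-; exists 1%N => //; constructor. Qed.

Lemma ev_int env z : ev env (EInt z) (VInt z) 1.
Proof. by exists 1%N => //; constructor. Qed.

Lemma ev_let env e1 e2 v1 v2 T1 T2 :
  ev env e1 v1 T1 -> ev (v1 :: env) e2 v2 T2 -> ev env (ELet e1 e2) v2 (1 + T1 + T2).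
Proof.
move=> [t1 h1 e1'] [t2 h2 e2']; exists (1 + t1 + t2)%N; last exact: eval_let e1' e2'.
by rewrite leq_add ?leq_add2l.
Qed.

Lemma ev_pair env e1 e2 v1 v2 T1 T2 :
  ev env e1 v1 T1 -> ev env e2 v2 T2 -> ev env (EPair e1 e2) (VPair v1 v2) (1 + T1 + T2).
Proof.
move=> [t1 h1 e1'] [t2 h2 e2']; exists (1 + t1 + t2)%N; last by constructor.
by rewrite leq_add ?leq_add2l.
Qed.

Lemma ev_fst env e a b T : ev env e (VPair a b) T -> ev env (EFst e) a (1 + T).
Proof. by move=> [t h e']; exists (1 + t)%N; [rewrite leq_add2l|exact: (eval_fst e')]. Qed.

Lemma ev_snd env e a b T : ev env e (VPair a b) T -> ev env (ESnd e) b (1 + T).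
Proof. by move=> [t h e']; exists (1 + t)%N; [rewrite leq_add2l|exact: (eval_snd e')]. Qed.

Lemma ev_ift env e e1 e2 v w T1 T2 : ev env e v T1 -> truthy v ->
  ev env e1 w T2 -> ev env (EIf e e1 e2) w (1 + T1 + T2).
Proof.
move=> [t1 h1 e1'] tv [t2 h2 e2']; exists (1 + t1 + t2)%N.
  by rewrite leq_add ?leq_add2l.
by apply: eval_if e1' _; rewrite tv.
Qed.

Lemma ev_iff env e e1 e2 v w T1 T2 : ev env e v T1 -> truthy v = false ->
  ev env e2 w T2 -> ev env (EIf e e1 e2) w (1 + T1 + T2).
Proof.
move=> [t1 h1 e1'] tv [t2 h2 e2']; exists (1 + t1 + t2)%N.
  by rewrite leq_add ?leq_add2l.
by apply: eval_if e1' _; rewrite tv.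
Qed.

Lemma ev_call env f e v w T1 T2 : call f v w T2 -> ev env e v T1 ->
  ev env (ECall f e) w (1 + T1 + T2).
Proof.
move=> [t2 h2 e2'] [t1 h1 e1']; exists (1 + t1 + t2)%N; last exact: eval_call e1' e2'.
by rewrite leq_add ?leq_add2l.
Qed.

Lemma ev_mem env e v T n : ev env e v T -> (vsize v <= n)%N ->
  ev env (EMem e) (vbool (mem v)) (1 + T + n).
Proof.
move=> [t h e'] hv; exists (1 + t + vsize v)%N; last by constructor.
by rewrite leq_add ?leq_add2l.
Qed.

Lemma ev_eps env e1 e2 a b T1 T2 n m :
  ev env e1 (VInt a) T1 -> ev env e2 (VInt b) T2 -> (bits a <= n)%N -> (bits b <= m)%N ->
  ev env (EEps e1 e2) (vbool (eps a b)) (1 + T1 + T2 + n + m).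
Proof.
move=> [t1 h1 e1'] [t2 h2 e2'] ha hb.
exists (1 + t1 + t2 + bits a + bits b)%N; first by rewrite !leq_add ?leq_add2l.
exact: (eval_eps e1' e2').
Qed.

(* All integers met by the program are bounded by a small power of [2 ^ M]. *)
Variable M : nat.
Hypothesis M_gt0 : (0 < M)%N.

Definition small j (z : int) := (absz z <= 2 ^ (j * M))%N.

Definition op_cost := (8 * M).+2.

Definition step_cost := (1000 * op_cost)%N.

Definition scan_cost := (M.+1 * step_cost)%N.

Lemma op_cost_gt1 : (2 <= op_cost)%N. Proof. by []. Qed.

Lemma ev_op env o e1 e2 a b v i j T1 T2 :
  ev env e1 (VInt a) T1 -> ev env e2 (VInt b) T2 ->
  small i a -> small j b -> (i <= 8)%N -> (j <= 8)%N ->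
  binop_sem o a b = v -> ev env (EOp o e1 e2) v (1 + T1 + T2 + op_cost + op_cost).
Proof.
move=> [t1 h1 e1'] [t2 h2 e2'] ha hb i8 j8 <-.
have le_W z l : small l z -> (l <= 8)%N -> (bits z <= op_cost)%N.
  by move=> hz l8; apply: leq_trans (bits_le hz) _; rewrite !ltnS leq_mul2r l8 orbT.
exists (1 + t1 + t2 + bits a + bits b)%N; last exact: (eval_op o e1' e2').
by rewrite !leq_add ?leq_add2l //; [exact: le_W ha i8|exact: le_W hb j8].
Qed.

Lemma small_le i j z : small i z -> (i <= j)%N -> small j z.
Proof.
by move=> hz ij; apply: leq_trans hz _; rewrite leq_exp2l // leq_mul2r ij orbT.
Qed.

Lemma small_mul i j a b : small i a -> small j b -> small (i + j) (a * b).
Proof. by move=> ha hb; rewrite /small abszM mulnDl expnD leq_mul. Qed.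

Lemma small_add i j a b : small i a -> small j b -> small (maxn i j).+1 (a + b).
Proof.
move=> ha hb; have {}ha := small_le ha (leq_maxl i j).
have {}hb := small_le hb (leq_maxr i j); move: ha hb; rewrite /small; move: (maxn i j) => n ha hb.
apply: leq_trans (leq_abszD a b) (leq_trans (leq_add ha hb) _).
rewrite addnn -mul2n -expnS leq_exp2l //.
by rewrite mulSn -add1n leq_add2r.
Qed.

Lemma smallN i a : small i (- a) = small i a.
Proof. by rewrite /small abszN. Qed.

Lemma small_sub i j a b : small i a -> small j b -> small (maxn i j).+1 (a - b).
Proof. by move=> ha hb; apply: small_add; rewrite ?smallN. Qed.

Lemma small0 : small 0 0. Proof. by []. Qed.
Lemma small1 : small 0 1. Proof. by []. Qed.
Lemma smallN1 : small 0 (-1). Proof. by []. Qed.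
Lemma small2 : small 1 2. Proof. by rewrite /small mul1n (leq_pexp2l _ M_gt0). Qed.

Lemma small_div i (a d : int) : 0 <= a -> 0 < d -> small i a -> small i (a %/ d)%Z.
Proof. by move=> a0 d0; apply: leq_trans; exact: leq_absz_div. Qed.

End Evaluation.

Ltac small_tac := lazymatch goal with
  | |- is_true (small _ _ (_ - _)) => eapply small_sub; small_tac
  | |- is_true (small _ _ (_ + _)) => eapply small_add; small_tac
  | |- is_true (small _ _ (_ * _)) => eapply small_mul; small_tac
  | |- is_true (small _ _ 0) => eapply small0
  | |- is_true (small _ _ 1) => eapply small1
  | |- is_true (small _ _ (-1)) => eapply smallN1
  | |- is_true (small _ _ 2) => eapply small2; eassumption
  | |- is_true (small _ _ (?f _)) => first
      [ eassumption
      | match goal with H : forall x, is_true (small _ _ (f x)) |- _ => eapply H end ]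
  | |- _ => eassumption
  end.

Ltac evt := lazymatch goal with
  | |- ev _ _ _ (EVar _) _ _ => eapply ev_var; reflexivity
  | |- ev _ _ _ (EInt _) _ _ => eapply ev_int
  | |- ev _ _ _ (EPair _ _) _ _ => eapply ev_pair; [evt|evt]
  | |- ev _ _ _ (EFst _) _ _ => eapply ev_fst; evt
  | |- ev _ _ _ (ESnd _) _ _ => eapply ev_snd; evt
  | |- ev _ _ _ (EOp _ _ _) _ _ =>
      eapply ev_op; [evt|evt|try small_tac|try small_tac|try by []|try by []|try reflexivity]
  | |- _ => idtac
  end.

Ltac evt_if b := eapply (@ev_ift _ _ _ _ _ _ (vbool b)).
Ltac evf_if b := eapply (@ev_iff _ _ _ _ _ _ (vbool b)).

Ltac body f := rewrite /call; change (nth (EInt 0) bmi_prog _) with f;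
  cbv [f elist foldr arg0 arg1 iter wtE pE cE].

Ltac cost_lia := lazymatch goal with
  |- context [step_cost ?M] => have := op_cost_gt1 M; rewrite /step_cost; clear; lia end.

Ltac cons_cost l := rewrite [size (_ :: l)]/= ?mulSn; move: (size l * _)%N => ?; cost_lia.

(** * Evaluation of the functions *)

Section Functions.

Variables (mem : value -> bool) (eps : int -> int -> bool) (M : nat).
Hypothesis M_gt0 : (0 < M)%N.
Variables (E : finType) (I : {set {set E}}) (p c id : E -> int).
Implicit Types (x y : E) (l s t : seq E).

Hypotheses (p_small : forall x, small M 1 (p x)) (c_small : forall x, small M 1 (c x)).
Hypotheses (id_small : forall x, small M 1 (id x)) (id_inj : injective id).
Hypotheses (p_ge0 : forall x, 0 <= p x) (c_ge0 : forall x, 0 <= c x).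

Definition item x := VPair (VInt (id x)) (VPair (VInt (p x)) (VInt (c x))).
Definition lcode l := vlist [seq item x | x <- l].
Definition icode l := vlist [seq VInt (id x) | x <- l].

Hypothesis mem_icode : forall l, mem (icode l) = ([set e in l] \in I).

Local Notation ev := (ev mem eps).
Local Notation call := (call mem eps).

Local Notation op_cost := (op_cost M).
Local Notation X := (step_cost M).
Local Notation U := (scan_cost M).

Lemma winsert_call u v x l : small M 1 u -> small M 1 v ->
  call 4 (vlist [:: item x; lcode l; VInt u; VInt v]) (lcode (winsert p c u v x l))
    ((size l).+1 * X).
Proof.
move=> hu hv; elim: l => [|y l IH]; body winsert_body.
  eapply ev_le; first by eapply ev_iff; [evt|by []|evt].
  by cost_lia.
rewrite /=; case: ifP => h.
  eapply ev_le.
    eapply ev_ift; [evt|by []|].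
    by eapply (@ev_ift _ _ _ _ _ _ (vbool (wt p c u v y <= wt p c u v x)));
      [evt | rewrite h | evt].
  by cost_lia.
eapply ev_le.
  eapply ev_ift; [evt|by []|].
  eapply (@ev_iff _ _ _ _ _ _ (vbool (wt p c u v y <= wt p c u v x)));
      [evt | by rewrite h | ].
  eapply ev_pair; [evt|].
  by eapply ev_call; [exact: IH | evt].
rewrite !mulSn; move: (size l * X)%N => T; have := (op_cost_gt1 M); rewrite /step_cost; lia.
Qed.

Lemma le_U n : (n <= M)%N -> (n.+1 * X <= U)%N.
Proof. by move=> h; rewrite leq_mul2r ltnS h orbT. Qed.

Lemma le_XU : (X <= U)%N. Proof. exact: leq_pmull. Qed.

Lemma size_wsort u v th t l : (size (wsort p c u v th t l) <= size l + size t)%N.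
Proof.
by rewrite (perm_size (perm_wsort _ _ _ _ _ _ _)) size_cat leq_add2r size_filter count_size.
Qed.

Lemma winsert_callU u v x l : small M 1 u -> small M 1 v -> (size l <= M)%N ->
  call 4 (vlist [:: item x; lcode l; VInt u; VInt v]) (lcode (winsert p c u v x l)) U.
Proof. by move=> hu hv hl; apply: ev_le (winsert_call x l hu hv) (le_U hl). Qed.

Lemma wsort_call u v th t l : small M 1 u -> small M 1 v -> small M 2 th ->
    (size l + size t <= M)%N ->
  call 5 (vlist [:: lcode l; lcode t; VInt u; VInt v; VInt th])
    (lcode (wsort p c u v th t l)) ((size l).+1 * (U + X)).
Proof.
move=> hu hv hth; elim: l => [|x l IH] hl; body wsort_body.
  eapply ev_le; first by eapply ev_iff; [evt|by []|evt].
  by rewrite mul1n; cost_lia.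
have {}IH := IH (ltnW hl).
have hs : (size (wsort p c u v th t l) <= M)%N.
  by apply: leq_trans (size_wsort _ _ _ _ _) (ltnW hl).
rewrite [wsort p c u v th t (x :: l)]/=; case: ifP => h.
  eapply ev_le.
    eapply ev_ift; [evt|by []|].
    eapply ev_let; first by eapply ev_call; [exact: IH|evt].
    evt_if (th <= wt p c u v x); [evt|by rewrite h|].
    by eapply ev_call; [exact: (winsert_callU x hu hv hs)|evt].
  rewrite [size (x :: l)]/= !mulSn; move: (size l * _)%N => T; by cost_lia.
eapply ev_le.
  eapply ev_ift; [evt|by []|].
  eapply ev_let; first by eapply ev_call; [exact: IH|evt].
  by evf_if (th <= wt p c u v x); [evt|by rewrite h|evt].
rewrite [size (x :: l)]/= !mulSn; move: (size l * _)%N => T; by cost_lia.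
Qed.

Lemma ids_call l : call 6 (lcode l) (icode l) ((size l).+1 * X).
Proof.
elim: l => [|x l IH]; body ids_body.
  eapply ev_le; first by eapply ev_iff; [evt|by []|evt].
  by cost_lia.
eapply ev_le.
  eapply ev_ift; [evt|by []|].
  by eapply ev_pair; [evt|eapply ev_call; [exact: IH|evt]].
rewrite [size (x :: l)]/= !mulSn; move: (size l * _)%N => T; by cost_lia.
Qed.

Lemma bits_small j z : small M j z -> (j <= 8)%N -> (bits z <= op_cost)%N.
Proof.
by move=> hz j8; apply: leq_trans (bits_le hz) _; rewrite !ltnS leq_mul2r j8 orbT.
Qed.

Lemma vsize_icode l : (vsize (icode l) <= (size l).+1 * X)%N.
Proof.
have := (op_cost_gt1 M); elim: l => [|x l IH] W1.
  by apply: leq_trans (bits_small (small0 M) isT) _; rewrite /step_cost; lia.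
have := IH W1; have := bits_small (id_small x) isT.
rewrite [size (x :: l)]/= [vsize (icode (x :: l))]/= !mulSn.
rewrite -/(icode l); move: (vsize _) (size l * X)%N => a T.
by rewrite /step_cost; lia.
Qed.

Lemma greedy_call s l : (size s + size l <= M)%N ->
  call 7 (vlist [:: lcode s; lcode l]) (lcode (greedy I s l)) ((size l).+1 * (U + U + X)).
Proof.
elim: l s => [|x l IH] s hl; body greedy_body.
  eapply ev_le; first by eapply ev_iff; [evt|by []|evt].
  by rewrite mul1n; cost_lia.
have hs : (size s <= M)%N by apply: leq_trans hl; exact: leq_addr.
have hs1 : (size (x :: s) <= M)%N by apply: leq_trans hl; rewrite /=; lia.
have IH' : call 7 (vlist [:: lcode (greedy_step I s x); lcode l]) (lcode (greedy I s (x :: l)))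
    ((size l).+1 * (U + U + X)).
  apply: IH; apply: leq_trans hl; rewrite /greedy_step; case: ifP => _ /=; lia.
have ids := ev_le (ids_call s) (le_U hs).
have memE := mem_icode (x :: s).
have vs := leq_trans (vsize_icode (x :: s)) (le_U hs1).
move: IH'; rewrite /greedy_step -memE; case: ifP => h IH'.
  eapply ev_le.
    eapply ev_ift; [evt|by []|].
    eapply ev_call; first exact: IH'.
    eapply ev_pair; last by evt.
    evt_if (mem (icode (x :: s))); [|by rewrite h|evt].
    eapply ev_mem; last exact: vs.
    by eapply ev_pair; [evt|eapply ev_call; [exact: ids|evt]].
  rewrite [size (x :: l)]/= !mulSn; move: (size l * _)%N => T; by cost_lia.
eapply ev_le.
  eapply ev_ift; [evt|by []|].
  eapply ev_call; first exact: IH'.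
  eapply ev_pair; last by evt.
  evf_if (mem (icode (x :: s))); [|by rewrite h|evt].
  eapply ev_mem; last exact: vs.
  by eapply ev_pair; [evt|eapply ev_call; [exact: ids|evt]].
rewrite [size (x :: l)]/= !mulSn; move: (size l * _)%N => T; by cost_lia.
Qed.

Lemma small_wt u v x : small M 1 u -> small M 1 v -> small M 3 (wt p c u v x).
Proof.
move=> hu hv; apply: small_le (_ : (maxn (1 + 1) (1 + 1)).+1 <= 3)%N => //.
by apply: small_sub => //; apply: small_mul.
Qed.

Lemma small_wsum u v l : small M 1 u -> small M 1 v -> (size l <= M)%N ->
  small M 4 (\sum_(x <- l) wt p c u v x).
Proof.
move=> hu hv hl; apply: (@leq_trans (size l * 2 ^ (3 * M))).
  elim: l {hl} => [|x l IH]; first by rewrite big_nil.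
  rewrite big_cons; apply: leq_trans (leq_abszD _ _) _.
  rewrite [size _]/= mulSn leq_add //; exact: small_wt.
rewrite (mulSn 3 M) expnD leq_mul2r; apply/orP; right.
by apply: leq_trans hl (ltnW (ltn_expl _ _)).
Qed.

Lemma wsum_call u v l : small M 1 u -> small M 1 v -> (size l <= M)%N ->
  call 8 (vlist [:: lcode l; VInt u; VInt v]) (VInt (\sum_(x <- l) wt p c u v x))
    ((size l).+1 * X).
Proof.
move=> hu hv; elim: l => [|x l IH] hl; body wsum_body.
  rewrite big_nil; eapply ev_le; first by eapply ev_iff; [evt|by []|evt].
  by rewrite mul1n; cost_lia.
have {}IH := IH (ltnW hl); have hs := small_wsum hu hv (ltnW hl).
rewrite big_cons; eapply ev_le.
  eapply ev_ift; [evt|by []|].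
  by eapply (@ev_op _ _ M); [evt|eapply ev_call; [exact: IH|evt]|small_tac|small_tac| | |reflexivity].
by cons_cost l.
Qed.

Lemma rem_call x l : call 9 (vlist [:: item x; lcode l]) (lcode (rem x l)) ((size l).+1 * X).
Proof.
elim: l => [|y l IH]; body rem_body.
  eapply ev_le; first by eapply ev_iff; [evt|by []|evt].
  by rewrite mul1n; cost_lia.
rewrite [rem x (y :: l)]/=; case: eqVneq => yx.
  eapply ev_le.
    eapply ev_ift; [evt|by []|].
    eapply (@ev_iff _ _ _ _ _ _ (VInt (id y - id x))); [evt| |evt].
    by rewrite yx /= subrr.
  by cons_cost l.
eapply ev_le.
  eapply ev_ift; [evt|by []|].
  eapply (@ev_ift _ _ _ _ _ _ (VInt (id y - id x))); [evt| |].
    by rewrite /= subr_eq0; apply: contra yx => /eqP /id_inj ->.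
  by eapply ev_pair; [evt|eapply ev_call; [exact: IH|evt]].
by cons_cost l.
Qed.

Variable b : int.
Hypothesis b_small : small M 2 b.

Lemma small01 z : small M 0 z -> small M 1 z.
Proof. by move/small_le; apply. Qed.

Lemma psumE l : \sum_(x <- l) wt p c 0 1 x = psum p l.
Proof. by apply: eq_bigr => x _; rewrite /wt mul1r mul0r subr0. Qed.

Lemma csumE l : \sum_(x <- l) wt p c (-1) 0 x = csum c l.
Proof. by apply: eq_bigr => x _; rewrite /wt mul0r mulN1r opprK add0r. Qed.

Lemma better_call best cand : (size best <= M)%N -> (size cand <= M)%N ->
  call 10 (vlist [:: lcode best; lcode cand; VInt b]) (lcode (better I p c b best cand))
    (5 * U + X).
Proof.
move=> hb hc; body better_body; rewrite /better /feasible.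
have l0 := small01 (small0 M); have l1 := small01 (small1 M); have lm1 := small01 (smallN1 M).
have ids := ev_le (ids_call cand) (le_U hc).
have vs := leq_trans (vsize_icode cand) (le_U hc).
have cs := ev_le (wsum_call lm1 l0 hc) (le_U hc).
have ps := ev_le (wsum_call l0 l1 hc) (le_U hc).
have pb := ev_le (wsum_call l0 l1 hb) (le_U hb).
have lcs := small_wsum lm1 l0 hc; have lps := small_wsum l0 l1 hc; have lpb := small_wsum l0 l1 hb.
rewrite -mem_icode; case h1 : (mem (icode cand)); last first.
  eapply ev_le.
    evf_if (mem (icode cand)); [|by rewrite h1|evt].
    by eapply ev_mem; [eapply ev_call; [exact: ids|evt]|exact: vs].
  by cost_lia.
rewrite -csumE; case: leP => h2; last first.
  eapply ev_le.
    evt_if (mem (icode cand)); [|by rewrite h1|].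
      by eapply ev_mem; [eapply ev_call; [exact: ids|evt]|exact: vs].
    evf_if (\sum_(x <- cand) wt p c (-1) 0 x <= b); [|by rewrite leNgt h2|evt].
    by eapply (@ev_op _ _ M); [eapply ev_call; [exact: cs|evt]|evt|exact: lcs|exact: b_small
      | | |reflexivity].
  by cost_lia.
rewrite -!psumE; case: leP => h3.
  eapply ev_le.
    evt_if (mem (icode cand)); [|by rewrite h1|].
      by eapply ev_mem; [eapply ev_call; [exact: ids|evt]|exact: vs].
    evt_if (\sum_(x <- cand) wt p c (-1) 0 x <= b); [|by rewrite h2|].
      by eapply (@ev_op _ _ M); [eapply ev_call; [exact: cs|evt]|evt|exact: lcs|exact: b_small
        | | |reflexivity].
    evt_if (\sum_(x <- best) wt p c 0 1 x <= \sum_(x <- cand) wt p c 0 1 x);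
      [|by rewrite h3|evt].
    by eapply (@ev_op _ _ M); [eapply ev_call; [exact: pb|evt]|eapply ev_call; [exact: ps|evt]
      |exact: lpb|exact: lps| | |reflexivity].
  by cost_lia.
eapply ev_le.
  evt_if (mem (icode cand)); [|by rewrite h1|].
    by eapply ev_mem; [eapply ev_call; [exact: ids|evt]|exact: vs].
  evt_if (\sum_(x <- cand) wt p c (-1) 0 x <= b); [|by rewrite h2|].
    by eapply (@ev_op _ _ M); [eapply ev_call; [exact: cs|evt]|evt|exact: lcs|exact: b_small
      | | |reflexivity].
  evf_if (\sum_(x <- best) wt p c 0 1 x <= \sum_(x <- cand) wt p c 0 1 x);
    [|by rewrite leNgt h3|evt].
  by eapply (@ev_op _ _ M); [eapply ev_call; [exact: pb|evt]|eapply ev_call; [exact: ps|evt]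
    |exact: lpb|exact: lps| | |reflexivity].
by cost_lia.
Qed.

Lemma size_greedy s l : (size (greedy I s l) <= size s + size l)%N.
Proof.
elim: l s => [|x l IH] s /=; first by rewrite addn0.
apply: leq_trans (IH _) _; rewrite /greedy_step; case: ifP => _ /=.
  by rewrite addSnnS.
by rewrite leq_add2l.
Qed.

Lemma size_lag_order u v acc rest :
  (size (lag_order p c u v acc rest) <= size acc + size rest)%N.
Proof.
apply: leq_trans (size_wsort _ _ _ _ _) _; rewrite leq_add2l.
by apply: leq_trans (size_wsort _ _ _ _ _) _; rewrite addn0.
Qed.

Lemma size_chainc F r acc rest s : s \in chainc I p c F r acc rest ->
  (size s <= size F + size acc + size rest)%N.
Proof.
elim: rest acc => [|x rest IH] acc //=; rewrite inE => /orP[/eqP ->|/IH]; last first.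
  by rewrite /= addnS addSnnS.
apply: leq_trans (size_subseq (rem_subseq _ _)) _.
apply: leq_trans (size_greedy _ _) _; rewrite -addnA leq_add2l.
by apply: leq_trans (size_lag_order r.1 r.2 (x :: acc) rest) _; rewrite addSnnS.
Qed.

Lemma size_better_foldl best cands n : (size best <= n)%N ->
  (forall s, s \in cands -> (size s <= n)%N) ->
  (size (foldl (better I p c b) best cands) <= n)%N.
Proof.
elim: cands best => [|s cands IH] best //= hb hc; apply: IH.
  by rewrite /better; case: ifP => // _; apply: hc; exact: mem_head.
by move=> s' hs'; apply: hc; rewrite inE hs' orbT.
Qed.

Definition sort_cost := (M.+1 * (U + X))%N.
Definition greedy_cost := (M.+1 * (U + U + X))%N.
Definition link_cost := (sort_cost + sort_cost + greedy_cost + 6 * U + 2 * X)%N.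

Lemma le_mulM n T : (n <= M)%N -> (n.+1 * T <= M.+1 * T)%N.
Proof. by move=> h; rewrite leq_mul2r ltnS h orbT. Qed.

Lemma chain_call F r acc rest best : small M 1 r.1 -> small M 1 r.2 -> (size best <= M)%N ->
    (size F + size acc + size rest <= M)%N ->
  call 11 (vlist [:: lcode best; lcode acc; lcode rest; lcode F; VInt r.1; VInt r.2; VInt b])
    (lcode (foldl (better I p c b) best (chainc I p c F r acc rest)))
    ((size rest).+1 * link_cost).
Proof.
move=> h1 h2; elim: rest acc best => [|x rest IH] acc best hb hs; body chain_body.
  eapply ev_le; first by eapply ev_iff; [evt|by []|evt].
  by rewrite mul1n /link_cost; cost_lia.
rewrite [chainc _ _ _ _ _ _ _]/= [foldl _ _ _]/=.
set cand := rem x _.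
have hcand : (size cand <= M)%N.
  by apply: leq_trans hs; apply: (@size_chainc F r); rewrite /= mem_head.
have hs' : (size F + size (x :: acc) + size rest <= M)%N.
  by rewrite /= addnS addSnnS.
have hu : (size (better I p c b best cand) <= M)%N by rewrite /better; case: ifP.
have {}IH := IH (x :: acc) _ hu hs'.
set best' := better _ _ _ _ _ _ in hu IH *.
have hr : (size rest + @size E [::] <= M)%N.
  by rewrite addn0; apply: leq_trans hs'; exact: leq_addl.
have l0 := small_le (small0 M) (isT : 0 <= 2)%N; have l1 := small_le (small1 M) (isT : 0 <= 2)%N.
have hr' : (size rest <= M)%N by rewrite addn0 in hr.
have s1 := ev_le (wsort_call h1 h2 l1 hr) (le_mulM _ hr').
have hra : (size (x :: acc) + size (wsort p c r.1 r.2 1 [::] rest) <= M)%N.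
  apply: leq_trans hs'; rewrite -addnA; apply: leq_trans (leq_addl _ _).
  by rewrite leq_add2l; apply: leq_trans (size_wsort _ _ _ _ _) _; rewrite addn0.
have hxa : (size (x :: acc) <= M)%N := leq_trans (leq_addr _ _) hra.
have s2 := ev_le (wsort_call h1 h2 l0 hra) (le_mulM _ hxa).
rewrite -/(lag_order p c r.1 r.2 (x :: acc) rest) in s2.
have ho : (size F + size (lag_order p c r.1 r.2 (x :: acc) rest) <= M)%N.
  by apply: leq_trans hs'; rewrite -addnA leq_add2l size_lag_order.
have ho' := leq_trans (leq_addl _ _) ho.
have s3 := ev_le (greedy_call ho) (le_mulM _ ho').
have hg : (size (greedy I F (lag_order p c r.1 r.2 (x :: acc) rest)) <= M)%N.
  exact: leq_trans (size_greedy _ _) ho.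
have s4 := ev_le (rem_call x _) (le_U hg).
have s5 := better_call hb hcand.
eapply ev_le.
  eapply ev_ift; [evt|by []|].
  eapply ev_call; first exact: IH.
  eapply ev_pair; last by evt.
  eapply ev_call; first exact: s5.
  eapply ev_pair; [evt|eapply ev_pair; [|evt]].
  eapply ev_call; first exact: s4.
  eapply ev_pair; [evt|eapply ev_pair; [|evt]].
  eapply ev_call; first exact: s3.
  eapply ev_pair; [evt|eapply ev_pair; [|evt]].
  eapply ev_call; first exact: s2.
  eapply ev_pair; [evt|eapply ev_pair; [|evt]].
  by eapply ev_call; [exact: s1|evt].
rewrite [size (x :: rest)]/= !(mulSn _ link_cost); move: (size rest * _)%N => T.
rewrite {3}/link_cost -/sort_cost -/greedy_cost; move: sort_cost greedy_cost U => t1 t2 t3.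
cost_lia.
Qed.

Definition rcode (rs : seq (int * int)) := vlist [seq VPair (VInt r.1) (VInt r.2) | r <- rs].

Lemma size_leafc F rs L s : s \in leafc I p c F rs L -> (size s <= size F + size L)%N.
Proof.
rewrite mem_cat => /orP[/flatten_mapP[r _ /size_chainc]|]; first by rewrite addn0.
by rewrite inE => /eqP ->; exact: leq_addr.
Qed.

Definition ratio_cost := (M.+1 * link_cost + 6 * U + X)%N.

Lemma leaf_call F rs L best : (forall r, r \in rs -> small M 1 r.1 /\ small M 1 r.2) ->
    (size best <= M)%N -> (size F + size L <= M)%N ->
  call 12 (vlist [:: lcode best; lcode F; rcode rs; lcode L; VInt b])
    (lcode (foldl (better I p c b) best (leafc I p c F rs L))) ((size rs).+1 * ratio_cost).
Proof.
move=> + + hs; have hF : (size F <= M)%N by apply: leq_trans hs; exact: leq_addr.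
elim: rs best => [|r rs IH] best hr hb; body leaf_body.
  have s1 := better_call hb hF; eapply ev_le.
    eapply ev_iff; [evt|by []|].
    by eapply ev_call; [exact: s1|evt].
  rewrite mul1n /ratio_cost; move: le_XU; move: (_ * link_cost)%N U => T1 T2; by cost_lia.
have [h1 h2] := hr r (mem_head _ _).
have hL : (size F + @size E [::] + size L <= M)%N by rewrite addn0.
have hL' := leq_trans (leq_addl _ _) hL.
have s1 := ev_le (chain_call h1 h2 hb hL) (le_mulM _ hL').
have hb' : (size (foldl (better I p c b) best (chainc I p c F r [::] L)) <= M)%N.
  by apply: size_better_foldl => // s /size_chainc /leq_trans; apply.
have s2 := IH _ (fun q hq => hr q (mem_behead (s := r :: rs) hq)) hb'.
rewrite -foldl_cat /leafc catA -/(flatten (_ :: _)) in s2.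
eapply ev_le.
  eapply ev_ift; [evt|by []|].
  eapply ev_call; first exact: s2.
  eapply ev_pair; last by evt.
  by eapply ev_call; [exact: s1|evt].
rewrite [size (r :: rs)]/= !(mulSn _ ratio_cost); move: (size rs * _)%N => T.
rewrite {2}/ratio_cost; move: le_XU; move: (_ * link_cost)%N U => T1 T2; by cost_lia.
Qed.

Definition enum_cost := (M.+1 * ratio_cost + 2 * X)%N.

Lemma enum_call R F h rs L best : (forall r, r \in rs -> small M 1 r.1 /\ small M 1 r.2) ->
    (size rs <= M)%N -> (size best <= M)%N -> (size R + size F + size L <= M)%N ->
    small M 2 h%:Z ->
  call 13 (vlist [:: lcode best; lcode R; lcode F; VInt h%:Z; rcode rs; lcode L; VInt b])
    (lcode (foldl (better I p c b) best (flatten [seq leafc I p c F' rs L | F' <- enumF R F h])))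
    (enum_cost * (size R).+1 ^ h.+1).
Proof.
move=> hr hrs; elim: R F h best => [|x R IH] F h best hb hs hh; body enum_body.
  have s1 := ev_le (leaf_call hr hb hs) (le_mulM _ hrs).
  rewrite exp1n muln1 [enumF _ _ _]/= /flatten [foldr _ _ _]/= cats0; eapply ev_le.
    eapply ev_iff; [evt|by []|].
    by eapply ev_call; [exact: s1|evt].
  by rewrite /enum_cost; move: (_ * ratio_cost)%N => T1; cost_lia.
have hs1 : (size R + size F + size L <= M)%N.
  by apply: leq_trans hs; rewrite /= !addSn.
have s1 := IH F h best hb hs1 hh.
set best1 := foldl _ _ _ in s1.
have hb1 : (size best1 <= M)%N.
  apply: size_better_foldl => // s /flatten_mapP[F' /enumF_inv[sub ss ->] /size_leafc].
  move/leq_trans; apply; apply: leq_trans hs1; rewrite leq_add2r size_cat size_rev.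
  by rewrite leq_add2r size_subseq.
have fE : foldl (better I p c b) best
    (flatten [seq leafc I p c F' rs L | F' <- enumF (x :: R) F h]) =
  foldl (better I p c b) best1 (flatten [seq leafc I p c F' rs L | F' <-
    if h is h'.+1 then enumF R (x :: F) h' else [::]]).
  by rewrite /best1 -foldl_cat -flatten_cat -map_cat; case: (h).
rewrite fE {fE}; clearbody best1; case: h hh s1 => [|h] hh s1.
  eapply ev_le.
    eapply ev_ift; [evt|by []|].
    eapply ev_let; first by eapply ev_call; [exact: s1|evt].
    by eapply ev_iff; [evt|by []|evt].
  rewrite !expn1 [size (x :: R)]/= !mulnS; move: (enum_cost * _)%N => T.
  by rewrite /enum_cost; move: (_ * ratio_cost)%N => T1; cost_lia.
have hh' : small M 2 h%:Z by apply: leq_trans hh.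
have hs2 : (size R + size (x :: F) + size L <= M)%N by rewrite /= addnS -addSn.
have s2 := IH (x :: F) h best1 hb1 hs2 hh'.
eapply ev_le.
  eapply ev_ift; [evt|by []|].
  eapply ev_let; first by eapply ev_call; [exact: s1|evt].
  eapply ev_ift; [evt|by []|].
  eapply ev_call; first exact: s2.
  eapply ev_pair; [evt|eapply ev_pair; [evt|eapply ev_pair; [evt|eapply ev_pair; [|evt]]]].
  eapply (@ev_op _ _ M); [evt|evt|exact: hh|exact: small1|by []|by []|].
  by rewrite /= -addn1 PoszD addrK.
rewrite [size (x :: R)]/=.
have le1 : ((size R).+1 ^ h.+1 < (size R).+2 ^ h.+1)%N by rewrite ltn_exp2r.
rewrite (expnS _ h.+1) [in leqRHS]expnS.
move: ((size R).+1 ^ h.+1)%N ((size R).+2 ^ h.+1)%N le1 => q q' le1.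
apply: (@leq_trans (enum_cost * ((size R).+2 * q.+1))); last first.
  by rewrite leq_mul2l leq_mul2l le1 !orbT.
apply: (@leq_trans (enum_cost + enum_cost * ((size R).+1 * q) + enum_cost * q)).
  have : (2 * X <= enum_cost)%N by rewrite leq_addl.
  move: enum_cost (enum_cost * q)%N (enum_cost * (_ * q))%N => t1 t2 t3.
  by cost_lia.
rewrite -[X in (X + _ + _)%N]muln1 -!mulnDr leq_mul2l; apply/orP; right.
by rewrite mulnS !mulSn; move: (size R * q)%N => t; lia.
Qed.

Lemma class_filter_call a d lo hi l : 0 <= a -> 0 < d -> small M 2 a -> small M 3 d ->
    small M 4 lo -> small M 4 hi ->
  call 14 (vlist [:: lcode l; VInt a; VInt d; VInt lo; VInt hi])
    (lcode (class_filter p a d lo hi l)) ((size l).+1 * X).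
Proof.
move=> a0 d0 ha hd hlo hhi; elim: l => [|x l IH]; body class_filter_body.
  eapply ev_le; first by eapply ev_iff; [evt|by []|evt].
  by rewrite mul1n; cost_lia.
have hc : small M 3 (profit_class p a d x).
  by apply: small_div => //; [rewrite mulr_ge0|exact: small_mul (p_small x) ha].
have pa : small M 3 (p x * a) := small_mul (p_small x) ha.
rewrite [class_filter _ _ _ _ _ (x :: l)]/= -/(class_filter p a d lo hi l).
case h1 : (lo <= profit_class p a d x); last first.
  eapply ev_le.
    eapply ev_ift; [evt|by []|].
    eapply (@ev_let _ _ _ _ _ (VInt (profit_class p a d x))).
      by eapply (@ev_op _ _ M); [evt|evt|exact: pa|exact: hd| | |reflexivity].
    evf_if (lo <= profit_class p a d x); [|by rewrite h1|by eapply ev_call; [exact: IH|evt]].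
    by eapply (@ev_op _ _ M); [evt|evt|exact: hlo|exact: hc| | |reflexivity].
  by cons_cost l.
case h2 : (profit_class p a d x <= hi); last first.
  eapply ev_le.
    eapply ev_ift; [evt|by []|].
    eapply (@ev_let _ _ _ _ _ (VInt (profit_class p a d x))).
      by eapply (@ev_op _ _ M); [evt|evt|exact: pa|exact: hd| | |reflexivity].
    evt_if (lo <= profit_class p a d x); [|by rewrite h1|].
      by eapply (@ev_op _ _ M); [evt|evt|exact: hlo|exact: hc| | |reflexivity].
    evf_if (profit_class p a d x <= hi); [|by rewrite h2|by eapply ev_call; [exact: IH|evt]].
    by eapply (@ev_op _ _ M); [evt|evt|exact: hc|exact: hhi| | |reflexivity].
  by cons_cost l.
eapply ev_le.
  eapply ev_ift; [evt|by []|].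
  eapply (@ev_let _ _ _ _ _ (VInt (profit_class p a d x))).
    by eapply (@ev_op _ _ M); [evt|evt|exact: pa|exact: hd| | |reflexivity].
  evt_if (lo <= profit_class p a d x); [|by rewrite h1|].
    by eapply (@ev_op _ _ M); [evt|evt|exact: hlo|exact: hc| | |reflexivity].
  evt_if (profit_class p a d x <= hi); [|by rewrite h2|].
    by eapply (@ev_op _ _ M); [evt|evt|exact: hc|exact: hhi| | |reflexivity].
  by eapply ev_pair; [evt|eapply ev_call; [exact: IH|evt]].
by cons_cost l.
Qed.

Lemma small_size n : (n <= M)%N -> small M 1 n%:Z.
Proof. by move=> h; rewrite /small mul1n; apply: leq_trans h (ltnW (ltn_expl _ _)). Qed.

Lemma len_call l : (size l <= M)%N -> call 15 (lcode l) (VInt (size l)%:Z) ((size l).+1 * X).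
Proof.
elim: l => [|x l IH] hl; body len_body.
  eapply ev_le; first by eapply ev_iff; [evt|by []|evt].
  by rewrite mul1n; cost_lia.
have {}IH := IH (ltnW hl); have hs := small_size (ltnW hl).
eapply ev_le.
  eapply ev_ift; [evt|by []|].
  eapply (@ev_op _ _ M); [eapply ev_call; [exact: IH|evt]|evt|exact: hs|exact: small1| | |] => //.
  by rewrite /= -PoszD addn1.
by cons_cost l.
Qed.

Definition reps_cost := (4 * U + 2 * X)%N.

Lemma size_pick_reps_step a d q R x : (size (pick_reps_step I p a d q R x) <= (size R).+1)%N.
Proof. by rewrite /pick_reps_step /=; case: ifP. Qed.

Lemma pick_reps_call a d q R l : 0 <= a -> 0 < d -> small M 2 a -> small M 3 d -> small M 4 q ->
    (size R + size l <= M)%N ->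
  call 16 (vlist [:: lcode R; lcode l; VInt a; VInt d; VInt q])
    (lcode (pick_reps I p a d q R l)) ((size l).+1 * reps_cost).
Proof.
move=> a0 d0 ha hd hq; elim: l R => [|x l IH] R hs; body pick_reps_body.
  eapply ev_le; first by eapply ev_iff; [evt|by []|evt].
  by rewrite mul1n /reps_cost; cost_lia.
have hc : small M 3 (profit_class p a d x).
  by apply: small_div => //; [rewrite mulr_ge0|exact: small_mul (p_small x) ha].
have pa : small M 3 (p x * a) := small_mul (p_small x) ha.
have hc4 := small_le hc (isT : 3 <= 4)%N.
have hR : (size R <= M)%N by apply: leq_trans hs; exact: leq_addr.
have hxR : (size R < M)%N by apply: leq_trans hs; rewrite /= addnS ltnS leq_addr.
have IH' : call 16
    (vlist [:: lcode (pick_reps_step I p a d q R x); lcode l; VInt a; VInt d; VInt q])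
    (lcode (pick_reps I p a d q R (x :: l))) ((size l).+1 * reps_cost).
  apply: IH; apply: leq_trans hs; rewrite /= addnS -addSn leq_add2r.
  exact: size_pick_reps_step.
have s1 := ev_le (class_filter_call R a0 d0 ha hd hc4 hc4) (le_U hR).
move: IH'; rewrite /pick_reps_step; set S := class_filter p a d _ _ R in s1 *.
have hS' : (size S < M)%N.
  by apply: leq_ltn_trans hxR; rewrite size_filter count_size.
have hS := ltnW hS'.
have s2 := ev_le (len_call hS) (le_U hS); have lS := small_size hS.
have lS1 := small_add M_gt0 lS (small1 M).
have s3 := ev_le (ids_call S) (le_U hS).
have memE := mem_icode (x :: S).
have vs := leq_trans (vsize_icode (x :: S)) (le_U (hS' : (size (x :: S) <= M)%N)).
have hfil : ev [:: VInt (profit_class p a d x);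
      vlist [:: lcode R; lcode (x :: l); VInt a; VInt d; VInt q]]
    (ECall 14 (elist [:: arg1 0; arg1 2; arg1 3; EVar 0; EVar 0])) (lcode S) (U + X).
  cbv [elist foldr arg0 arg1 iter]; eapply ev_le; first by eapply ev_call; [exact: s1|evt].
  by cost_lia.
cbv [elist foldr arg0 arg1 iter] in hfil.
rewrite -memE; case h1 : ((size S)%:Z + 1 <= q); last first.
  move=> IH'; eapply ev_le.
    eapply ev_ift; [evt|by []|].
    eapply ev_call; [exact: IH'|eapply ev_pair; [|evt]].
    eapply ev_let.
      eapply (@ev_let _ _ _ _ _ (VInt (profit_class p a d x))); last exact: hfil.
      by eapply (@ev_op _ _ M); [evt|evt|exact: pa|exact: hd| | |reflexivity].
    evf_if ((size S)%:Z + 1 <= q); [|by rewrite h1|evt].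
    eapply (@ev_op _ _ M); [|evt|exact: lS1|exact: hq| | |reflexivity] => //.
    by eapply (@ev_op _ _ M);
      [eapply ev_call; [exact: s2|evt]|evt|exact: lS|exact: small1| | |reflexivity].
  rewrite ?[size (x :: l)]/= !(mulSn _ reps_cost); move: (size l * reps_cost)%N => T.
  by rewrite /reps_cost; cost_lia.
case h2 : (mem (icode (x :: S))) => /= IH'; last first.
  eapply ev_le.
    eapply ev_ift; [evt|by []|].
    eapply ev_call; [exact: IH'|eapply ev_pair; [|evt]].
    eapply ev_let.
      eapply (@ev_let _ _ _ _ _ (VInt (profit_class p a d x))); last exact: hfil.
      by eapply (@ev_op _ _ M); [evt|evt|exact: pa|exact: hd| | |reflexivity].
    evt_if ((size S)%:Z + 1 <= q); [|by rewrite h1|].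
      eapply (@ev_op _ _ M); [|evt|exact: lS1|exact: hq| | |reflexivity] => //.
      by eapply (@ev_op _ _ M);
        [eapply ev_call; [exact: s2|evt]|evt|exact: lS|exact: small1| | |reflexivity].
    evf_if (mem (icode (x :: S))); [|by rewrite h2|evt].
    eapply ev_mem; last exact: vs.
    by eapply ev_pair; [evt|eapply ev_call; [exact: s3|evt]].
  rewrite ?[size (x :: l)]/= !(mulSn _ reps_cost); move: (size l * reps_cost)%N => T.
  by rewrite /reps_cost; cost_lia.
eapply ev_le.
  eapply ev_ift; [evt|by []|].
  eapply ev_call; [exact: IH'|eapply ev_pair; [|evt]].
  eapply ev_let.
    eapply (@ev_let _ _ _ _ _ (VInt (profit_class p a d x))); last exact: hfil.
    by eapply (@ev_op _ _ M); [evt|evt|exact: pa|exact: hd| | |reflexivity].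
  evt_if ((size S)%:Z + 1 <= q); [|by rewrite h1|].
    eapply (@ev_op _ _ M); [|evt|exact: lS1|exact: hq| | |reflexivity] => //.
    by eapply (@ev_op _ _ M);
      [eapply ev_call; [exact: s2|evt]|evt|exact: lS|exact: small1| | |reflexivity].
  evt_if (mem (icode (x :: S))); [|by rewrite h2|evt].
  eapply ev_mem; last exact: vs.
  by eapply ev_pair; [evt|eapply ev_call; [exact: s3|evt]].
rewrite ?[size (x :: l)]/= !(mulSn _ reps_cost); move: (size l * reps_cost)%N => T.
by rewrite /reps_cost; cost_lia.
Qed.

Definition mkr1 x := foldl (fun acc y => (p x - p y, c x - c y) :: acc).
Definition mkr2 all := foldl (fun acc x => mkr1 x ((p x, c x) :: acc) all).

Lemma mkr1_call acc x l :
  call 18 (vlist [:: rcode acc; item x; lcode l]) (rcode (mkr1 x acc l)) ((size l).+1 * X).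
Proof.
elim: l acc => [|y l IH] acc; body mkr1_body.
  eapply ev_le; first by eapply ev_iff; [evt|by []|evt].
  by rewrite mul1n; cost_lia.
have s1 := IH ((p x - p y, c x - c y) :: acc); eapply ev_le.
  eapply ev_ift; [evt|by []|].
  by eapply ev_call; [exact: s1|eapply ev_pair; evt].
by cons_cost l.
Qed.

Lemma mkr2_call all acc l : (size all <= M)%N ->
  call 19 (vlist [:: rcode acc; lcode l; lcode all]) (rcode (mkr2 all acc l))
    ((size l).+1 * (U + X)).
Proof.
move=> hall; elim: l acc => [|x l IH] acc; body mkr2_body.
  eapply ev_le; first by eapply ev_iff; [evt|by []|evt].
  by rewrite mul1n; cost_lia.
have s0 := ev_le (mkr1_call ((p x, c x) :: acc) x all) (le_U hall).
have s1 := IH (mkr1 x ((p x, c x) :: acc) all); eapply ev_le.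
  eapply ev_ift; [evt|by []|].
  eapply ev_call; first exact: s1.
  by eapply ev_pair; [eapply ev_call; [exact: s0|evt]|evt].
by cons_cost l.
Qed.

Lemma size_pick_reps a d q R l : (size (pick_reps I p a d q R l) <= size R + size l)%N.
Proof.
elim: l R => [|x l IH] R /=; first by rewrite addn0.
apply: leq_trans (IH _) _; rewrite addnS -addSn leq_add2r.
exact: size_pick_reps_step.
Qed.

Fixpoint scands (k tot : int) items rs n d : seq (seq E) :=
  if n is n'.+1 then
    if d <= tot then
      candidates I p c rs (reps I p k d items) (absz (2 * k)) (lights p k d items)
        ++ scands k tot items rs n' (d + d)
    else [::]
  else [::].

Definition scale_cost K h := (enum_cost * K.+1 ^ h.+1 + M.+1 * reps_cost + 2 * U + 2 * X)%N.

Lemma scale_call (k tot : int) items rs (K : nat) best (n : nat) (d : int) :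
    0 < k -> small M 1 k -> 0 < d -> small M 3 d ->
    small M 2 tot -> tot < (2 ^ n)%N%:Z * d -> (size items + size items <= M)%N ->
    (forall r, r \in rs -> small M 1 r.1 /\ small M 1 r.2) -> (size rs <= M)%N ->
    (size best <= M)%N -> (forall d : int, 0 < d -> (size (reps I p k d items) <= K)%N) ->
  call 17 (vlist [:: lcode best; VInt d; VInt tot; lcode items; rcode rs; VInt k; VInt b])
    (lcode (foldl (better I p c b) best (scands k tot items rs n d)))
    (n.+1 * scale_cost K (absz (2 * k))).
Proof.
move=> k0 hk + + ht + hi hr hrs + hK.
elim: n d best => [|n IH] d best d0 hd htd hb; body scale_body.
  have h : (d <= tot) = false by rewrite leNgt -[d]mul1r htd.
  eapply ev_le.
    by evf_if (d <= tot); [evt|by rewrite h|evt].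
  rewrite mul1n /scale_cost; move: (_ * _)%N (_ * reps_cost)%N U => T1 T2 T3.
  by cost_lia.
rewrite [scands _ _ _ _ _ _]/=; case h : (d <= tot); last first.
  eapply ev_le.
    by evf_if (d <= tot); [evt|by rewrite h|evt].
  rewrite !mulSn {1}/scale_cost; move: (n * _)%N (_ * _)%N (_ * reps_cost)%N U => T0 T1 T2 T3.
  by cost_lia.
set R := reps I p k d items; set L := lights p k d items.
have kk0 : 0 <= k * k by rewrite mulr_ge0 // ltW.
have hkk : small M 2 (k * k) := small_mul hk hk.
have h2k : small M 2 (2 * k) := small_mul (small2 M_gt0) hk.
have eh : (absz (2 * k))%:Z = 2 * k by rewrite gez0_abs // mulr_ge0 // ltW.
have hh : small M 2 (absz (2 * k))%:Z by rewrite eh.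
have h2kk : small M 3 (2 * k * k) := small_mul h2k hk.
have l1 : small M 4 (2 * k * k - 1) := small_sub M_gt0 h2kk (small1 M).
have l2 : small M 4 (k - 1) := small_le (small_sub M_gt0 hk (small1 M)) (isT : 2 <= 4)%N.
have l3 : small M 4 (k * k + 2 * k) := small_le (small_add M_gt0 hkk h2k) (isT : 3 <= 4)%N.
have l4 := small_le hk (isT : 1 <= 4)%N.
have l0 := small_le (small0 M) (isT : 0 <= 4)%N.
have hi1 : (size items <= M)%N := leq_trans (leq_addl _ _) hi.
have sf lo hi' : (size (class_filter p (k * k) d lo hi' items) <= size items)%N.
  by rewrite size_filter count_size.
have s1 := ev_le (class_filter_call items kk0 d0 hkk hd l4 l1) (le_U hi1).
have s2 := ev_le (class_filter_call items kk0 d0 hkk hd l0 l2) (le_U hi1).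
have hb0 : (@size E [::] + size (class_filter p (k * k) d k (2 * k * k - 1) items) <= M)%N.
  by rewrite add0n; apply: leq_trans hi1.
have s3 := ev_le (pick_reps_call kk0 d0 hkk hd l3 hb0) (le_mulM reps_cost hb0).
have sR : (size R <= size items)%N.
  apply: leq_trans (size_pick_reps _ _ _ _ _) _; rewrite add0n; exact: sf.
have hRL : (size R + @size E [::] + size L <= M)%N.
  by rewrite addn0; apply: leq_trans hi; apply: leq_add sR (sf _ _).
have s4 := enum_call hr hrs hb hRL hh; rewrite eh in s4.
rewrite -/(candidates I p c rs R (absz (2 * k)) L) in s4.
have le4 : (enum_cost * (size R).+1 ^ (absz (2 * k)%R).+1 <=
    enum_cost * K.+1 ^ (absz (2 * k)%R).+1)%N.
  by rewrite leq_mul2l leq_exp2r // ltnS hK ?orbT.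
have {}s4 := ev_le s4 le4.
rewrite foldl_cat; set best' := foldl _ _ _ in s4 *.
have hb' : (size best' <= M)%N.
  apply: size_better_foldl => // s /flatten_mapP[F' /enumF_inv[sub ss ->] /size_leafc].
  move/leq_trans; apply; apply: leq_trans hRL; rewrite leq_add2r size_cat size_rev.
  by rewrite leq_add2r size_subseq.
have hd2 : small M 2 d.
  by apply: leq_trans ht; rewrite -lez_nat !gez0_abs // ?ltW // (lt_le_trans d0).
have dd0 : 0 < d + d by rewrite addr_gt0.
have htd' : tot < (2 ^ n)%N%:Z * (d + d).
  have -> : (2 ^ n)%N%:Z * (d + d) = (2 ^ n.+1)%N%:Z * d by rewrite expnS PoszM; ring.
  exact: htd.
clear l0 l1 l2 l3 l4 hkk h2k hh h2kk.
have s5 := IH (d + d) best' dd0 (small_add M_gt0 hd2 hd2) htd' hb'.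
eapply ev_le.
  evt_if (d <= tot); [evt|by rewrite h|].
  eapply ev_call; first exact: s5.
  eapply ev_pair; last by evt.
  eapply ev_call; first exact: s4.
  eapply ev_pair; [evt|eapply ev_pair].
    eapply ev_call; first exact: s3.
    eapply ev_pair; [evt|eapply ev_pair; [|evt]].
    eapply ev_call; first exact: s1.
    by evt.
  eapply ev_pair; [evt|eapply ev_pair; [evt|eapply ev_pair; [evt|eapply ev_pair; [|evt]]]].
  eapply ev_call; first exact: s2.
  by evt.
rewrite (mulSn n.+1 (scale_cost _ _)) {2}/scale_cost.
move: (_ * scale_cost _ _)%N (enum_cost * _)%N (_ * reps_cost)%N U => T0 T1 T2 T3.
by cost_lia.
Qed.

End Functions.

(** * Profit scales and breakpoints *)

Lemma size_count_classes (T : Type) (f : T -> nat) (n : nat) (s : seq T) :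
  all (fun x => f x < n)%N s -> size s = \sum_(i < n) count (fun x => f x == i) s.
Proof.
elim: s => [_|x s IH] /=; first by rewrite big1.
case/andP => fx /IH ->; rewrite big_split /= -add1n; congr (_ + _)%N.
rewrite (bigD1 (Ordinal fx)) //= eqxx big1 // => i ifx.
by apply/eqP; rewrite eqb0 eq_sym.
Qed.

Section Scales.

Variables (E : finType) (I : {set {set E}}) (p c : E -> int) (b : int).
Hypothesis p_ge0 : forall x, 0 <= p x.

Lemma pick_reps_class_size a d q R l :
    (forall k, (size (class_filter p a d k k R))%:Z <= q) ->
  forall k, (size (class_filter p a d k k (pick_reps I p a d q R l)))%:Z <= q.
Proof.
elim: l R => //= x l IH R hR; apply: IH => k; rewrite /pick_reps_step.
case: ifP => // /andP[hq _] /=; case: ifP => // /le_anti ek.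
by move: hq; rewrite -ek /= -PoszD addn1.
Qed.

Lemma size_reps (k d : int) items : 0 < k -> 0 < d ->
  (size (reps I p k d items) <= absz (2 * k * k)%R * absz (k * k + 2 * k)%R)%N.
Proof.
move=> k0 d0; have k2 : 0 < 2 * k * k by rewrite !mulr_gt0.
have q0 : 0 <= k * k + 2 * k by rewrite addr_ge0 // mulr_ge0 // ltW.
pose f x := absz (profit_class p (k * k) d x).
have f0 x : 0 <= profit_class p (k * k) d x.
  by rewrite /profit_class divz_ge0 // mulr_ge0 // mulr_ge0 // ltW.
have hf : all (fun x => f x < absz (2 * k * k)%R)%N (reps I p k d items).
  apply/allP => x /pick_reps_sub; rewrite mem_filter => /andP[/andP[_ h] _].
  by rewrite -ltz_nat /f !gez0_abs // ?(ltW k2) // -lezD1 -lerBrDr.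
rewrite (size_count_classes hf) -[X in (X * _)%N]card_ord -sum_nat_const.
apply: leq_sum => i _; rewrite -size_filter.
have h0 : forall z, (size (class_filter p (k * k) d z z ([::] : seq E)))%:Z <= k * k + 2 * k by [].
have := pick_reps_class_size (class_filter p (k * k) d k (2 * k * k - 1) items) h0 i%:Z.
rewrite -/(reps I p k d items) -lez_nat gez0_abs //; congr (_%:Z <= _).
rewrite /class_filter; congr size; apply: eq_filter => x.
by rewrite -eq_le eq_sym -[i%:Z]/(Posz i) -{1}(gez0_abs (f0 x)).
Qed.

Lemma scands_mem k tot items rs n i d s : d * (2 ^ i)%N%:Z <= tot -> 0 < d -> (i < n)%N ->
    s \in candidates I p c rs (reps I p k (d * (2 ^ i)%N%:Z) items) (absz (2 * k))
      (lights p k (d * (2 ^ i)%N%:Z) items) ->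
  s \in scands I p c k tot items rs n d.
Proof.
elim: i n d => [|i IH] [|n] d //= h d0 hn hs.
  by rewrite mulr1 in h hs; rewrite h mem_cat hs.
have e : d * (2 ^ i.+1)%N%:Z = (d + d) * (2 ^ i)%N%:Z by rewrite expnS PoszM; ring.
have dt : d <= tot.
  apply: le_trans h; rewrite ler_peMr //; first exact: ltW.
  by rewrite lez_nat expn_gt0.
rewrite dt mem_cat; apply/orP; right; apply: IH; rewrite -?e //.
by rewrite addr_gt0.
Qed.

Lemma scands_uniq k tot items rs n d : uniq items ->
  all uniq (scands I p c k tot items rs n d).
Proof.
move=> ui; elim: n d => //= n IH d; case: ifP => // _; rewrite all_cat IH andbT.
by apply: candidates_uniq; exact: reps_lights_uniq.
Qed.

Lemma mkr1_sub x acc l : {subset acc <= mkr1 p c x acc l}.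
Proof.
elim: l acc => [|y l IH] acc q //= qa; apply: IH; by rewrite inE qa orbT.
Qed.

Lemma mkr1_mem x acc l y : y \in l -> (p x - p y, c x - c y) \in mkr1 p c x acc l.
Proof.
elim: l acc => //= z l IH acc; rewrite inE => /orP[/eqP ->|]; last exact: IH.
by apply: mkr1_sub; rewrite mem_head.
Qed.

Lemma mkr2_sub all acc l : {subset acc <= mkr2 p c all acc l}.
Proof.
elim: l acc => [|y l IH] acc q //= qa; apply: IH; apply: mkr1_sub.
by rewrite inE qa orbT.
Qed.

Lemma mkr2_mem1 all acc l x : x \in l -> (p x, c x) \in mkr2 p c all acc l.
Proof.
elim: l acc => //= z l IH acc; rewrite inE => /orP[/eqP ->|]; last exact: IH.
by apply: mkr2_sub; apply: mkr1_sub; rewrite mem_head.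
Qed.

Lemma mkr2_mem2 all acc l x y : x \in l -> y \in all ->
  (p x - p y, c x - c y) \in mkr2 p c all acc l.
Proof.
move=> + hy; elim: l acc => //= z l IH acc; rewrite inE => /orP[/eqP ->|]; last exact: IH.
by apply: mkr2_sub; exact: mkr1_mem.
Qed.

Lemma mkr1_inv (A : int * int -> Prop) x acc l :
    (forall q, q \in acc -> A q) -> (forall y, A (p x - p y, c x - c y)) ->
  forall q, q \in mkr1 p c x acc l -> A q.
Proof.
move=> + h; elim: l acc => //= y l IH acc ha; apply: IH => q.
by rewrite inE => /orP[/eqP ->|]; [exact: h|exact: ha].
Qed.

Lemma mkr2_inv (A : int * int -> Prop) all acc l :
    (forall q, q \in acc -> A q) -> (forall x, A (p x, c x)) ->
    (forall x y, A (p x - p y, c x - c y)) ->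
  forall q, q \in mkr2 p c all acc l -> A q.
Proof.
move=> + h1 h2; elim: l acc => //= y l IH acc ha; apply: IH; apply: mkr1_inv => // q.
by rewrite inE => /orP[/eqP ->|]; [exact: h1|exact: ha].
Qed.

Lemma size_mkr1 x acc l : size (mkr1 p c x acc l) = (size acc + size l)%N.
Proof. by elim: l acc => //= [|y l IH] acc; rewrite ?addn0 // IH addSnnS. Qed.

Lemma size_mkr2 all acc l :
  size (mkr2 p c all acc l) = (size acc + size l * (size all).+1)%N.
Proof.
elim: l acc => //= [|y l IH] acc; first by rewrite addn0.
by rewrite IH size_mkr1 /= mulSn addnA addSnnS.
Qed.

End Scales.

(** * Scaling to integers *)

Lemma absz_bits z : (absz z <= 2 ^ bits z)%N.
Proof.
apply: leq_trans (ltnW (trunc_log_ltn (absz z) (isT : 1 < 2)%N)) _.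
by rewrite leq_exp2l.
Qed.

Lemma elem_code_inj (E : finType) : injective (@elem_code E).
Proof. by move=> x y [] /ord_inj /enum_rank_inj. Qed.

Lemma set_of_seq_code (E : finType) (s : seq E) :
  set_of_code E (seq_code s) = [set e in s].
Proof.
apply/setP => x; rewrite !inE; have -> : int_list (seq_code s) = map (@elem_code E) s.
  by elim: s => //= y s ->.
by rewrite mem_map //; exact: elem_code_inj.
Qed.

Lemma elem_code_enum (E : finType) :
  [seq elem_code e | e <- enum E] = [seq Posz j | j <- iota 0 #|E|].
Proof.
have -> : [seq elem_code e | e <- enum E] =
  [seq Posz j | j <- [seq nat_of_ord (enum_rank e) | e <- enum E]] by rewrite -map_comp.
congr (map _ _).
case: (pickP E) => [x0 _|E0]; last first.
  have c0 := eq_card0 E0; have e0 : enum E = [::].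
    by apply/eqP; rewrite -size_eq0 -cardE c0.
  by rewrite e0; have -> : iota 0 #|E| = [::] by rewrite c0.
apply: (@eq_from_nth _ 0%N) => [|i]; rewrite size_map -cardE ?size_iota // => iE.
rewrite nth_iota // add0n (nth_map x0) -?cardE //.
by rewrite -[i]/(val (Ordinal iE)) -(enum_val_nth x0 (Ordinal iE)) enum_valK.
Qed.

Section Scaling.

Variable K : bmi.
Local Notation E := (ground K).
Implicit Types (e : E) (l : seq E).

Definition entry e := VPair (rat_code (cost e)) (rat_code (profit e)).

Definition ecode l := vlist [seq entry e | e <- l].

Definition dprod l : int := \prod_(e <- l) (denq (cost e) * denq (profit e)).

Definition denom : int := denq (budget K) * dprod (enum E).

Definition scaled (q : rat) : int := numq q * (denom %/ denq q)%Z.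

Definition sprofit e := scaled (profit e).
Definition scost e := scaled (cost e).
Definition sbudget := scaled (budget K).

Lemma dprod_gt0 l : 0 < dprod l.
Proof. by rewrite /dprod; apply: prodr_gt0 => e _; rewrite mulr_gt0 ?denq_gt0. Qed.

Lemma denom_gt0 : 0 < denom.
Proof. by rewrite mulr_gt0 ?denq_gt0 ?dprod_gt0. Qed.

Lemma dvd_entry e : (denq (cost e) * denq (profit e) %| denom)%Z.
Proof.
rewrite /denom /dprod dvdz_mull // (big_rem e) ?mem_enum //=.
exact: dvdz_mulr.
Qed.

Lemma scaledE q : (denq q %| denom)%Z -> (scaled q)%:~R = denom%:~R * q :> rat.
Proof.
move=> h; rewrite /scaled rmorphM /= numqE -[in RHS](divzK h) rmorphM /=.
by ring.
Qed.

Lemma sprofitE e : (sprofit e)%:~R = denom%:~R * profit e :> rat.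
Proof. by apply: scaledE; apply: dvdz_trans (dvd_entry e); exact: dvdz_mull. Qed.

Lemma scostE e : (scost e)%:~R = denom%:~R * cost e :> rat.
Proof. by apply: scaledE; apply: dvdz_trans (dvd_entry e); exact: dvdz_mulr. Qed.

Lemma sbudgetE : (sbudget)%:~R = denom%:~R * budget K :> rat.
Proof. by apply: scaledE; exact: dvdz_mulr. Qed.

Lemma denomQ_gt0 : 0 < denom%:~R :> rat.
Proof. by rewrite ltr0z denom_gt0. Qed.

Lemma sprofit_ge0 e : 0 <= sprofit e.
Proof. by rewrite -(ler0z rat) sprofitE mulr_ge0 ?profit_ge0 // ltW ?denomQ_gt0. Qed.

Lemma scost_ge0 e : 0 <= scost e.
Proof.
rewrite -(ler0z rat) scostE mulr_ge0 ?(ltW denomQ_gt0) //.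
by case/andP: (cost_bounds e).
Qed.

Lemma scost_le e : scost e <= sbudget.
Proof.
rewrite -(ler_int rat) scostE sbudgetE ler_pM2l ?denomQ_gt0 //.
by case/andP: (cost_bounds e).
Qed.

Lemma sum_sprofit (A : {set E}) :
  (\sum_(e in A) sprofit e)%:~R = denom%:~R * set_profit A :> rat.
Proof. by rewrite rmorph_sum /set_profit mulr_sumr; apply: eq_bigr => e _; exact: sprofitE. Qed.

Lemma sum_scost (A : {set E}) :
  (\sum_(e in A) scost e)%:~R = denom%:~R * set_cost A :> rat.
Proof. by rewrite rmorph_sum /set_cost mulr_sumr; apply: eq_bigr => e _; exact: scostE. Qed.

Lemma vsize_ecode_cons e l : vsize (ecode (e :: l)) = (1 + vsize (entry e) + vsize (ecode l))%N.
Proof. by []. Qed.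

Lemma ecode_size l : (size l <= vsize (ecode l))%N.
Proof.
by elim: l => // e l IH; rewrite vsize_ecode_cons [size _]/= -add1n leq_add // leq_addr.
Qed.

Lemma ecode_entry l e : e \in l -> (vsize (entry e) <= vsize (ecode l))%N.
Proof.
elim: l => // f l IH; rewrite inE vsize_ecode_cons => /orP[/eqP ->|/IH h].
  by rewrite addnAC; exact: leq_addl.
exact: leq_trans h (leq_addl _ _).
Qed.

Lemma dprod_le l : (absz (dprod l) <= 2 ^ vsize (ecode l))%N.
Proof.
elim: l => [|e l IH]; first by rewrite /dprod big_nil.
rewrite /dprod big_cons !abszM -/(dprod l).
have h1 := absz_bits (denq (cost e)); have h2 := absz_bits (denq (profit e)).
apply: leq_trans (leq_mul (leq_mul h1 h2) IH) _; rewrite -!expnD leq_exp2l //.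
rewrite vsize_ecode_cons leq_add2r /=.
by move: (bits _) (bits _) (bits _) (bits _); clear; lia.
Qed.

Local Notation N := (instance_size K).

Lemma card_le_size : (#|E| <= N)%N.
Proof.
rewrite cardE; apply: leq_trans (ecode_size _) _.
by rewrite /instance_size /instance_code [vsize _]/= -/(ecode _) leq_addl.
Qed.

Lemma denom_le : (absz denom <= 2 ^ N)%N.
Proof.
rewrite abszM; apply: leq_trans (leq_mul (absz_bits _) (dprod_le _)) _.
rewrite -expnD leq_exp2l // /instance_size /instance_code [vsize (VPair _ _)]/=.
rewrite -/(ecode _) leq_add2r; lia.
Qed.

Lemma scaled_le q : (bits (numq q) <= N)%N -> (absz (scaled q) <= 2 ^ (2 * N))%N.
Proof.
move=> h; rewrite /scaled abszM mul2n -addnn expnD leq_mul //.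
  by apply: leq_trans (absz_bits _) _; rewrite leq_exp2l.
apply: leq_trans denom_le; apply: leq_absz_div; last exact: denq_gt0.
exact: ltW denom_gt0.
Qed.

Lemma entry_bits e :
  [/\ (bits (numq (cost e)) <= N)%N, (bits (denq (cost e)) <= N)%N,
      (bits (numq (profit e)) <= N)%N & (bits (denq (profit e)) <= N)%N].
Proof.
have h : (vsize (entry e) <= N)%N.
  apply: leq_trans (ecode_entry (mem_enum _ e : e \in enum E)) _.
  by rewrite /instance_size /instance_code [vsize (VPair _ _)]/= -/(ecode _) leq_addl.
by move: h; rewrite /=; move: (bits _) (bits _) (bits _) (bits _) => *; split; lia.
Qed.

Lemma budget_bits : (bits (numq (budget K)) <= N)%N /\ (bits (denq (budget K)) <= N)%N.
Proof.
rewrite /instance_size /instance_code [vsize _]/=.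
by move: (bits _) (bits _) (vsize _) => *; split; lia.
Qed.

End Scaling.

(** * The main function *)

Section Main.

Variables (K : bmi) (eps : int -> int -> bool) (k M : nat).
Local Notation E := (ground K).
Local Notation N := (instance_size K).
Hypotheses (k_gt0 : (0 < k)%N) (epsP : forall j, (0 < j <= k)%N -> eps 5 j%:Z = (k <= j)%N).
Hypothesis M_ge : (N.+2 * N.+2 + k <= M)%N.
Implicit Types (e : E) (l : seq E).

Local Notation mem := (mem_oracle K).
Local Notation X := (step_cost M).
Local Notation U := (scan_cost M).
Local Notation ev := (ev mem eps).
Local Notation call := (call mem eps).
Local Notation P := (@sprofit K).
Local Notation C := (@scost K).
Local Notation B := (sbudget K).
Local Notation id := (@elem_code E).

Let M_gt0 : (0 < M)%N.
Proof. by apply: leq_trans M_ge; rewrite mulSn. Qed.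

Let M_geN : (3 * N + 4 <= M)%N.
Proof. by apply: leq_trans M_ge; rewrite !mulSn !mulnS; move: (N * N)%N N => a b; clear; lia. Qed.

Let small_2N (z : int) : (absz z <= 2 ^ (2 * N))%N -> small M 1 z.
Proof.
move/leq_trans; apply; rewrite leq_exp2l // mul1n.
by move: M_geN; clear; move: N => n; lia.
Qed.

Let small_bits (z : int) : (bits z <= N)%N -> small M 1 z.
Proof.
move=> h; apply: small_2N; apply: leq_trans (absz_bits z) _.
by rewrite leq_exp2l // (leq_trans h) // leq_pmull.
Qed.

Let P_small e : small M 1 (P e).
Proof. by apply: small_2N; apply: scaled_le; case: (entry_bits e). Qed.

Let C_small e : small M 1 (C e).
Proof. by apply: small_2N; apply: scaled_le; case: (entry_bits e). Qed.

Let B_small : small M 1 B.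
Proof. by apply: small_2N; apply: scaled_le; case: (budget_bits K). Qed.

Let small_nat n : (n <= M)%N -> small M 1 n%:Z.
Proof. exact: small_size. Qed.

Let card_leM : (#|E| <= M)%N.
Proof.
apply: leq_trans (card_le_size K) _; move: M_geN; clear; move: N => n; lia.
Qed.

Let id_small e : small M 1 (id e).
Proof. by apply: small_nat; apply: leq_trans card_leM; apply: ltnW. Qed.

Let denom_small : small M 1 (denom K).
Proof.
apply: small_2N; apply: leq_trans (denom_le K) _.
by rewrite leq_exp2l // leq_pmull.
Qed.

Let mem_icode l : mem (icode id l) = ([set e in l] \in indep K).
Proof. by rewrite /mem_oracle -set_of_seq_code. Qed.

Lemma findk_call j : (0 < j <= k)%N -> call 1 (VInt j%:Z) (VInt k%:Z) ((k - j).+1 * X).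
Proof.
have [n] := ubnP (k - j)%N; elim: n j => // n IH j; rewrite ltnS => hn hj.
have kM : (k <= M)%N by apply: leq_trans M_ge; exact: leq_addl.
have b5 : (bits 5 <= op_cost M)%N.
  by rewrite /op_cost; have -> : bits 5 = 4%N by []; move: M_gt0; clear; lia.
have lj : small M 1 j%:Z.
  by apply: small_nat; apply: leq_trans kM; case/andP: hj.
have bj := bits_small lj (isT : 1 <= 8)%N.
have ep := epsP hj; body findk_body; have [kj|jk] := leqP k j.
  have -> : k = j by apply/eqP; rewrite eqn_leq kj; case/andP: hj.
  rewrite kj in ep; eapply ev_le.
    evt_if (eps 5 j%:Z); [|by rewrite ep|evt].
    by eapply ev_eps; [evt|evt|exact: b5|exact: bj].
  by rewrite subnn mul1n; cost_lia.
rewrite leqNgt jk /= in ep.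
have hn1 : (k - j.+1 < n)%N by rewrite subnS prednK ?subn_gt0.
have s1 := IH j.+1 hn1 jk.
eapply ev_le.
  evf_if (eps 5 j%:Z); [|by rewrite ep|].
    by eapply ev_eps; [evt|evt|exact: b5|exact: bj].
  eapply ev_call; first exact: s1.
  eapply ev_op; [evt|evt|exact: lj|exact: small1|by []|by []|].
  by rewrite /= -PoszD addn1.
rewrite subnS; have := subn_gt0 j k; rewrite jk; case: (k - j)%N => // d _.
by rewrite succnK !mulSn; move: (d * X)%N => T; cost_lia.
Qed.

Lemma dens_call l : (vsize (ecode l) <= N)%N ->
  call 2 (ecode l) (VInt (dprod l)) ((size l).+1 * X).
Proof.
elim: l => [|e l IH] hl; body dens_body.
  rewrite /dprod big_nil; eapply ev_le; first by eapply ev_iff; [evt|by []|evt].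
  by rewrite mul1n; cost_lia.
have hl' : (vsize (ecode l) <= N)%N.
  by apply: leq_trans hl; rewrite vsize_ecode_cons leq_addl.
have s1 := IH hl'; have [_ /small_bits hc _ /small_bits hp] := entry_bits e.
have hd : small M 1 (dprod l).
  apply: small_2N; apply: leq_trans (dprod_le l) _; rewrite leq_exp2l //.
  by apply: leq_trans hl' _; rewrite leq_pmull.
have -> : dprod (e :: l) = denq (cost e) * denq (profit e) * dprod l.
  by rewrite /dprod big_cons.
have hcp := small_mul hc hp.
eapply ev_le.
  eapply ev_ift; [evt|by []|].
  eapply ev_op; [|eapply ev_call; [exact: s1|evt]|exact: hcp|exact: hd|by []|by []|reflexivity].
  by eapply ev_op; [evt|evt|exact: hc|exact: hp|by []|by []|reflexivity].
by cons_cost l.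
Qed.

Lemma conv_call l i : [seq id e | e <- l] = [seq Posz j | j <- iota i (size l)] ->
    (i + size l <= M)%N ->
  call 3 (vlist [:: ecode l; VInt i%:Z; VInt (denom K)]) (lcode P C id l) ((size l).+1 * X).
Proof.
elim: l i => [|e l IH] i; body conv_body.
  move=> _ _; eapply ev_le; first by eapply ev_iff; [evt|by []|evt].
  by rewrite mul1n; cost_lia.
case=> ide0 ids hi; have ide : id e = i%:Z by rewrite /elem_code ide0.
have hi' : (i.+1 + size l <= M)%N by rewrite addSnnS.
have s1 := IH _ ids hi'; have [hc1 hc2 hp1 hp2] := entry_bits e.
have li : small M 1 i%:Z by apply: small_nat; apply: leq_trans hi; exact: leq_addr.
have {}hc1 := small_bits hc1; have {}hc2 := small_bits hc2.
have {}hp1 := small_bits hp1; have {}hp2 := small_bits hp2.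
have d0 : 0 <= denom K := ltW (denom_gt0 K).
have qc := small_div d0 (denq_gt0 (cost e)) denom_small.
have qp := small_div d0 (denq_gt0 (profit e)) denom_small.
have -> : lcode P C id (e :: l) = VPair (item P C id e) (lcode P C id l) by [].
rewrite /item ide /sprofit /scost /scaled.
eapply ev_le.
  eapply ev_ift; [evt|by []|].
  eapply ev_pair.
    eapply ev_pair; [evt|eapply ev_pair].
      eapply ev_op; [evt| |exact: hp1|exact: qp|by []|by []|reflexivity].
      by eapply ev_op; [evt|evt|exact: denom_small|exact: hp2|by []|by []|reflexivity].
    eapply ev_op; [evt| |exact: hc1|exact: qc|by []|by []|reflexivity].
    by eapply ev_op; [evt|evt|exact: denom_small|exact: hc2|by []|by []|reflexivity].
  eapply ev_call; first exact: s1.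
  eapply ev_pair; [evt|eapply ev_pair; [|evt]].
  eapply ev_op; [evt|evt|exact: li|exact: small1|by []|by []|].
  by rewrite /= -PoszD addn1.
by cons_cost l.
Qed.

Definition items := wsort P C 1 0 (- B) [::] (enum E).
Definition ratios := mkr2 P C items [:: (0, 1)] items.
Definition result :=
  foldl (better (indep K) P C B) [::]
    (scands (indep K) P C k%:Z (psum P items) items ratios (3 * N).+1 1).

Definition max_reps := (absz (2 * k%:Z * k%:Z)%R * absz (k%:Z * k%:Z + 2 * k%:Z)%R)%N.

Definition total_cost :=
  (6 * U + 2 * sort_cost M + M.+1 * scale_cost M max_reps (absz (2 * k%:Z)%R) + 5 * X)%N.

Lemma perm_items : perm_eq items (enum E).
Proof.
apply: perm_trans (perm_wsort _ _ _ _ _ _ _) _; rewrite cats0.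
rewrite (@eq_in_filter _ _ predT) ?filter_predT // => e _.
by rewrite /wt mul0r mul1r sub0r lerN2 scost_le.
Qed.

Lemma items_uniq : uniq items.
Proof. by rewrite (perm_uniq perm_items) enum_uniq. Qed.

Lemma mem_items e : e \in items.
Proof. by rewrite (perm_mem perm_items) mem_enum. Qed.

Lemma size_items : size items = #|E|.
Proof. by rewrite (perm_size perm_items) -cardE. Qed.

Lemma items_sorted : pairwise (fun x y => C x <= C y) items.
Proof.
have : pairwise (dec P C 1 0) items by apply: wsort_dec.
apply: sub_pairwise => x y.
by rewrite /dec /wt !mul0r !mul1r !sub0r lerN2.
Qed.

Let all_scands := scands (indep K) P C k%:Z (psum P items) items ratios (3 * N).+1 1.

Lemma result_spec : [/\ feasible (indep K) C B result, uniq result &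
  forall s, s \in all_scands -> feasible (indep K) C B s -> psum P s <= psum P result].
Proof.
have f0 : feasible (indep K) C B [::].
  rewrite /feasible /csum big_nil; apply/andP; split.
    have -> : [set e : E in [::]] = set0 by apply/setP => e; rewrite !inE.
    by case: (indep_matroid K).
  by rewrite -(ler_int rat) sbudgetE mulr_ge0 // ltW ?denomQ_gt0 ?budget_gt0.
have ua : all uniq all_scands by apply: scands_uniq; exact: items_uniq.
by have [? ? _ ?] := better_foldl P f0 isT ua.
Qed.

Let ratios_small r : r \in ratios -> small M 1 r.1 /\ small M 1 r.2.
Proof.
have sub a b : 0 <= a -> 0 <= b -> small M 1 a -> small M 1 b -> small M 1 (a - b).
  rewrite /small => a0 b0; move: (2 ^ _)%N => n; clear -a0 b0; lia.
apply: (mkr2_inv (A := fun r : int * int => small M 1 r.1 /\ small M 1 r.2)).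
- move=> q; rewrite inE => /eqP -> /=.
  by split; [exact: small01 (small0 M)|exact: small01 (small1 M)].
- by move=> x; split; [exact: P_small|exact: C_small].
move=> x y; split; apply: sub; rewrite ?sprofit_ge0 ?scost_ge0 //;
  by [apply: P_small|apply: C_small].
Qed.

Let size_ratios : (size ratios <= M)%N.
Proof.
rewrite size_mkr2 size_items [size _]/= ; apply: leq_trans M_ge.
apply: leq_trans (leq_addr _ _).
have := card_le_size K; move: #|E| N => a n h.
apply: (@leq_trans (1 + n * n.+1)); first by rewrite leq_add2l leq_mul.
by rewrite !mulSn !mulnS; move: (n * n)%N => t; lia.
Qed.

Let tot_small : small M 2 (psum P items).
Proof.
rewrite /psum; apply: (@leq_trans (size items * 2 ^ M)).
  elim: items => [|x l IH]; first by rewrite big_nil.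
  rewrite big_cons; apply: leq_trans (leq_abszD _ _) _; rewrite [size _]/= mulSn.
  apply: leq_add IH; have := P_small x; by rewrite /small mul1n.
rewrite size_items mul2n -addnn expnD leq_mul2r; apply/orP; right.
by apply: leq_trans card_leM (ltnW (ltn_expl _ _)).
Qed.

Let tot_lt : psum P items < (2 ^ (3 * N).+1)%N%:Z * 1.
Proof.
have h : psum P items <= ((size items) * 2 ^ (2 * N))%N%:Z.
  rewrite /psum; elim: items => [|x l IH]; first by rewrite big_nil.
  rewrite big_cons [size _]/= mulSn PoszD lerD //.
  rewrite -[P x]gez0_abs ?sprofit_ge0 // lez_nat; apply: scaled_le.
  by case: (entry_bits x).
rewrite mulr1; apply: le_lt_trans h _; rewrite ltz_nat size_items.
rewrite expnS -[(3 * N)%N]/((1 + 2) * N)%N mulnDl mul1n expnD.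
have h1 : (#|E| <= 2 ^ N)%N by apply: leq_trans (card_le_size K) (ltnW (ltn_expl _ _)).
apply: (@leq_ltn_trans (2 ^ N * 2 ^ (2 * N))); first by rewrite leq_mul2r h1 orbT.
by rewrite ltn_Pmull // muln_gt0 !expn_gt0.
Qed.

Lemma result_opt (S : {set E}) : S \in indep K -> \sum_(e in S) C e <= B ->
    (forall S' : {set E}, S' \in indep K -> \sum_(e in S') C e <= B ->
      \sum_(e in S') P e <= \sum_(e in S) P e) ->
  (k%:Z - 5) * \sum_(e in S) P e <= k%:Z * psum P result.
Proof.
move=> SI cS Smax; have [fr ur best] := result_spec.
set opt := \sum_(e in S) P e in Smax *.
have opt0 : 0 <= opt by apply: sumr_ge0 => e _; exact: sprofit_ge0.
have res0 : 0 <= psum P result by apply: sumr_ge0 => e _; exact: sprofit_ge0.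
have k0 : 0 < k%:Z by rewrite ltz_nat.
have [opt_eq|opt_gt] := eqVneq opt 0.
  by rewrite opt_eq mulr0 mulr_ge0 // ltW.
have absopt : (0 < absz opt)%N by rewrite absz_gt0.
have eopt : opt = (absz opt)%:Z by rewrite gez0_abs.
set i := trunc_log 2 (absz opt); set d := 1 * (2 ^ i)%N%:Z.
have opt_tot : opt <= psum P items.
  rewrite /psum big_list_set ?items_uniq // [leRHS](big_setID S) /= (setIidPr _).
    by rewrite lerDl; apply: sumr_ge0 => e _; exact: sprofit_ge0.
  by apply/subsetP => e _; rewrite inE mem_items.
have d_opt : d <= opt by rewrite /d mul1r eopt lez_nat trunc_logP.
have opt_d : opt < 2 * d.
  rewrite /d mul1r eopt -[2]/(2%N%:Z) -PoszM ltz_nat -expnS.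
  exact: trunc_log_ltn.
have d0 : 0 < d by rewrite /d mul1r ltz_nat expn_gt0.
have i_lt : (i < (3 * N).+1)%N.
  rewrite -(@ltn_exp2l 2) // -ltz_nat; apply: (@le_lt_trans _ _ opt).
    by rewrite -[Posz (2 ^ i)]mul1r.
  by apply: le_lt_trans opt_tot _; rewrite -[ltRHS]mulr1.
have dS : d <= opt < 2 * d by rewrite d_opt opt_d.
have r0 : (0, 1) \in ratios by apply: mkr2_sub; rewrite mem_head.
have [s sc /andP[fs hs]] := guarantee (indep_matroid K) (@sprofit_ge0 K) (@scost_ge0 K) k0 d0
  items_uniq mem_items items_sorted r0 (fun e => mkr2_mem1 _ _ _ _ (mem_items e))
  (fun e f => mkr2_mem2 _ _ _ (mem_items e) (mem_items f)) SI cS Smax dS.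
apply: le_trans hs _; rewrite ler_pM2l //; apply: best fs.
by apply: scands_mem sc => //; exact: le_trans d_opt opt_tot.
Qed.

Lemma main_call : call 0 (instance_code K) (icode id result) total_cost.
Proof.
body main_body.
have kM : (k <= M)%N by apply: leq_trans M_ge; exact: leq_addl.
have hE : (size (enum E) <= M)%N by rewrite -cardE.
have s1 := ev_le (findk_call (k_gt0 : (0 < 1 <= k)%N)) (_ : _ <= U)%N.
have {}s1 : call 1 (VInt 1) (VInt k%:Z) U.
  by apply: s1; apply: le_U; apply: leq_trans kM; exact: leq_subr.
have hv : (vsize (ecode (enum E)) <= N)%N.
  by rewrite /instance_size /instance_code [vsize (VPair _ _)]/= -/(ecode _) leq_addl.
have s2 := ev_le (dens_call hv) (le_U hE).
have hids : [seq id e | e <- enum E] = [seq Posz j | j <- iota 0 (size (enum E))].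
  by rewrite -cardE elem_code_enum.
have s3 := ev_le (conv_call hids hE) (le_U hE).
have l0 := small01 (small0 M); have l1 := small01 (small1 M).
have lB : small M 2 (- B) by rewrite smallN; apply: small_le B_small _.
have hE0 : (size (enum E) + @size E [::] <= M)%N by rewrite addn0.
have s4 := ev_le (wsort_call mem eps M_gt0 id P_small C_small l1 l0 lB hE0) (le_mulM _ hE).
rewrite -/items -/(sort_cost M) in s4.
have hI : (size items <= M)%N by rewrite size_items.
have s5 := ev_le (mkr2_call mem eps id P_small C_small [:: (0, 1)] items hI) (le_mulM _ hI).
rewrite -/ratios -/(sort_cost M) in s5.
have s6 := ev_le (wsum_call mem eps M_gt0 id P_small C_small l0 l1 hI) (le_U hI).
rewrite psumE in s6.
have lB2 : small M 2 B by apply: small_le B_small _.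
have k0 : 0 < k%:Z by rewrite ltz_nat.
have hI2 : (size items + size items <= M)%N.
  rewrite size_items; apply: leq_trans (leq_add (card_le_size K) (card_le_size K)) _.
  by move: M_geN; clear; move: N => n; lia.
have hd1 : small M 3 1 by apply: small_le (small1 M) _.
have s7 := scale_call eps M_gt0 P_small C_small id_small (@elem_code_inj E) (@sprofit_ge0 K)
  mem_icode
  lB2 k0 (small_nat kM) ltr01 hd1 tot_small tot_lt hI2 ratios_small size_ratios
  (leq0n M : (@size E [::] <= M)%N) (fun d d0 => size_reps _ (@sprofit_ge0 K) _ k0 d0).
have n_le : ((3 * N).+1 <= M)%N by move: M_geN; clear; move: N => n; lia.
have {}s7 := ev_le s7 (le_mulM _ n_le).
rewrite -/max_reps -/result in s7.
have hres : (size result <= M)%N.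
  have [_ ur _] := result_spec; apply: leq_trans card_leM.
  by rewrite -(card_uniqP ur) max_card.
have s8 := ev_le (ids_call mem eps M P C id result) (le_U hres).
have lden := small_bits (proj2 (budget_bits K)); have lnum := small_bits (proj1 (budget_bits K)).
have ldp : small M 1 (dprod (enum E)).
  apply: small_2N; apply: leq_trans (dprod_le _) _; rewrite leq_exp2l //.
  by apply: leq_trans hv _; rewrite leq_pmull.
have d0 : 0 <= denom K := ltW (denom_gt0 K).
have lq := small_div d0 (denq_gt0 (budget K)) denom_small.
eapply ev_le.
  eapply ev_let; first by eapply ev_call; [exact: s1|evt].
  eapply (@ev_let _ _ _ _ _ (VInt (denom K))).
    eapply ev_op; [evt|eapply ev_call; [exact: s2|evt]|exact: lden|exact: ldp|by []|by []|].
    by [].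
  eapply (@ev_let _ _ _ _ _ (VInt B)).
    eapply ev_op; [evt| |exact: lnum|exact: lq|by []|by []|reflexivity].
    by eapply ev_op; [evt|evt|exact: denom_small|exact: lden|by []|by []|reflexivity].
  eapply ev_let.
    eapply ev_call; first exact: s4.
    eapply ev_pair; [eapply ev_call; [exact: s3|evt]|].
    eapply ev_pair; [evt|eapply ev_pair; [evt|eapply ev_pair; [evt|eapply ev_pair; [|evt]]]].
    eapply ev_op; [evt|evt|exact: small0|exact: lB2|by []|by []|].
    by rewrite /= sub0r.
  eapply ev_let; first by eapply ev_call; [exact: s5|evt].
  eapply ev_call; first exact: s8.
  eapply ev_call; first exact: s7.
  eapply ev_pair; [evt|eapply ev_pair; [evt|eapply ev_pair; [|evt]]].
  by eapply ev_call; [exact: s6|evt].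
rewrite /total_cost; move: U (sort_cost M) (M.+1 * scale_cost _ _ _)%N => T1 T2 T3.
by cost_lia.
Qed.

End Main.

(** * The running time *)

Definition poly_bounded (f : nat -> nat) := exists a e, forall M, (f M <= a * M.+1 ^ e)%N.

Lemma poly_bounded_const a : poly_bounded (fun _ => a).
Proof. by exists a, 0%N => M; rewrite muln1. Qed.

Lemma poly_bounded_succ : poly_bounded (fun M => M.+1).
Proof. by exists 1%N, 1%N => M; rewrite mul1n. Qed.

Lemma poly_bounded_add f g : poly_bounded f -> poly_bounded g ->
  poly_bounded (fun M => f M + g M)%N.
Proof.
move=> [a [e hf]] [a' [e' hg]]; exists (a + a')%N, (e + e')%N => M.
rewrite mulnDl; apply: leq_add.
  by apply: leq_trans (hf M) _; rewrite leq_mul2l leq_pexp2l ?orbT // leq_addr.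
by apply: leq_trans (hg M) _; rewrite leq_mul2l leq_pexp2l ?orbT // leq_addl.
Qed.

Lemma poly_bounded_mul f g : poly_bounded f -> poly_bounded g ->
  poly_bounded (fun M => f M * g M)%N.
Proof.
move=> [a [e hf]] [a' [e' hg]]; exists (a * a')%N, (e + e')%N => M.
by apply: leq_trans (leq_mul (hf M) (hg M)) _; rewrite mulnACA -expnD.
Qed.

Definition poly_part M :=
  (6 * scan_cost M + 2 * sort_cost M +
   M.+1 * (enum_cost M + M.+1 * reps_cost M + 2 * scan_cost M + 2 * step_cost M) +
   5 * step_cost M + 2)%N.

Lemma poly_part_bounded : poly_bounded poly_part.
Proof.
have pW : poly_bounded op_cost.
  by exists 8%N, 1%N => M; rewrite /op_cost expn1 mulnS; lia.
have pX : poly_bounded step_cost.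
  exact: poly_bounded_mul (poly_bounded_const _) pW.
have pM := poly_bounded_succ.
have pU : poly_bounded scan_cost by exact: poly_bounded_mul pM pX.
have pc := poly_bounded_const.
have padd f g := @poly_bounded_add f g.
have pmul f g := @poly_bounded_mul f g.
have pcX n : poly_bounded (fun M => n * step_cost M)%N by exact: pmul (pc n) pX.
have pcU n : poly_bounded (fun M => n * scan_cost M)%N by exact: pmul (pc n) pU.
have psrt : poly_bounded sort_cost := pmul _ _ pM (padd _ _ pU pX).
have pgrd : poly_bounded greedy_cost := pmul _ _ pM (padd _ _ (padd _ _ pU pU) pX).
have plink : poly_bounded link_cost :=
  padd _ _ (padd _ _ (padd _ _ (padd _ _ psrt psrt) pgrd) (pcU 6)) (pcX 2).
have pstep : poly_bounded ratio_cost := padd _ _ (padd _ _ (pmul _ _ pM plink) (pcU 6)) pX.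
have penum : poly_bounded enum_cost := padd _ _ (pmul _ _ pM pstep) (pcX 2).
have pbld : poly_bounded reps_cost := padd _ _ (pcU 4) (pcX 2).
exact: padd _ _ (padd _ _ (padd _ _ (padd _ _ (pcU 6) (pmul _ _ (pc 2) psrt))
  (pmul _ _ pM (padd _ _ (padd _ _ (padd _ _ penum (pmul _ _ pM pbld)) (pcU 2)) (pcX 2))))
  (pcX 5)) (pc 2).
Qed.

Lemma max_repsE k : max_reps k = (2 * k * k * (k * k + 2 * k))%N.
Proof. by rewrite /max_reps -!PoszM -PoszD. Qed.

Lemma total_cost_le k M : (total_cost k M + 2 <=
  poly_part M * (max_reps k).+1 ^ (2 * k).+1)%N.
Proof.
have q0 : (0 < (max_reps k).+1 ^ (2 * k).+1)%N by rewrite expn_gt0.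
rewrite /total_cost /poly_part /scale_cost.
have -> : absz (2 * k%:Z)%R = (2 * k)%N by rewrite -PoszM.
move: (_ ^ _)%N q0 => q q0.
move: (enum_cost M) (reps_cost M) (scan_cost M) (step_cost M) (sort_cost M) => te tb sc st ts.
have lq a : (a <= a * q)%N by rewrite leq_pmulr.
set A := (M.+1 * _)%N; set A' := (M.+1 * (te + _ + _ + _))%N.
have leA : (A <= A' * q)%N.
  rewrite -mulnA leq_mul2l; apply/orP; right.
  rewrite (mulnDl _ (2 * st) q) (mulnDl _ (2 * sc) q) (mulnDl te _ q).
  by do 3 (apply: leq_add; last exact: lq).
rewrite (mulnDl _ 2 q) (mulnDl _ (5 * st) q) (mulnDl _ A' q) (mulnDl (6 * sc) _ q).
do 2 (apply: leq_add; last exact: lq); apply: leq_add leA.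
by apply: leq_add; exact: lq.
Qed.

Lemma eps_part_le k e : (0 < k)%N ->
  (k.+1 ^ e * (max_reps k).+1 ^ (2 * k).+1 <= 2 ^ ((e + 21) * (k * k)))%N.
Proof.
move=> k0; have kk : (k <= k * k)%N by rewrite leq_pmulr.
have k2 : (k < 2 ^ k)%N := ltn_expl k (isT : 1 < 2)%N.
rewrite mulnDl expnD; apply: leq_mul.
  apply: (@leq_trans ((2 ^ k) ^ e)); first by case: (e) => // e'; rewrite leq_exp2r.
  by rewrite -expnM leq_exp2l // mulnC leq_mul2l kk orbT.
have h1 : ((max_reps k).+1 <= 2 ^ (7 * k))%N.
  rewrite max_repsE; apply: (@leq_trans (8 * (k * k * (k * k)))).
    by nia.
  rewrite (_ : 7 * k = 3 * k + 4 * k)%N; last by lia.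
  rewrite expnD leq_mul //; first by rewrite (_ : 8 = 2 ^ 3)%N // leq_exp2l // leq_pmulr.
  rewrite mulnC expnM -[(k * k)%N]/(k ^ 2)%N -expnD leq_exp2r //; exact: ltnW.
apply: (@leq_trans ((2 ^ (7 * k)) ^ (2 * k).+1)); first by rewrite leq_exp2r.
by rewrite -expnM leq_exp2l //; nia.
Qed.

Section Precision.

Variables (R : realType) (eps : R).
Hypotheses (eps_gt0 : 0 < eps) (eps_lt : eps < 1 / 2).

Lemma precision_exists : exists k, [/\ (0 < k)%N, 5 <= k%:R * eps, k%:R * eps <= 6 &
  forall j, (0 < j <= k)%N -> eps_oracle eps 5 j%:Z = (k <= j)%N].
Proof.
have ex : exists k, (5 <= k%:R * eps).
  exists (Num.bound (5 / eps)); rewrite -ler_pdivrMr //.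
  by apply/ltW/archi_boundP; rewrite divr_ge0 // ltW.
have [k hk kmin] := ex_minnP ex.
have k0 : (0 < k)%N by rewrite lt0n; apply/eqP => k0; move: hk; rewrite k0 mul0r; lra.
exists k; split=> //.
  have : ~~ (5 <= k.-1%:R * eps) by apply/negP => /kmin; rewrite leqNgt prednK ?leqnn.
  rewrite -ltNge => h; have -> : k%:R = k.-1%:R + 1 :> R by rewrite natr1 prednK.
  by rewrite mulrDl mul1r; move: (_ * _) h => u h; move: eps_lt; lra.
move=> j /andP[j0 jk]; rewrite /eps_oracle; have [kj|jk'] := leqP k j.
  have -> : j = k by apply/eqP; rewrite eqn_leq jk.
  exact: hk.
by apply/negP => /kmin; rewrite leqNgt jk'.
Qed.

Lemma precision_cost k (a : nat) : k%:R * eps <= 6 ->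
  (2 ^ (a * (k * k)))%N%:R <= 2 `^ (36 * a%:R / ln 2 * (eps ^- 2 * ln (1 / eps))) :> R.
Proof.
move=> hk; rewrite natrX -powR_mulrn //; apply: ler_powR; first by lra.
have ln2 : 0 < ln (2 : R) by apply: ln_gt0; lra.
have le_ln : ln (2 : R) <= ln (1 / eps).
  rewrite ler_ln ?posrE ?divr_gt0 // ler_pdivlMr //.
  by move: eps_lt; lra.
have e2 : 0 < eps ^- 2 by rewrite invr_gt0 exprn_gt0.
have h1 : (k * k)%:R <= 36 * eps ^- 2.
  rewrite ler_pdivlMr ?exprn_gt0 // natrM expr2 mulrACA.
  have -> : 36 = 6 * 6 :> R by ring.
  by apply: ler_pM; rewrite // mulr_ge0 // ltW.
have -> : 36 * a%:R / ln 2 * (eps ^- 2 * ln (1 / eps)) =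
    a%:R * (36 * eps ^- 2) * (ln (1 / eps) / ln 2) by ring.
rewrite natrM; apply: le_trans (_ : a%:R * (36 * eps ^- 2) <= _).
  by rewrite ler_wpM2l.
have h2 : 1 <= ln (1 / eps) / ln 2 by rewrite ler_pdivlMr // [leLHS]mul1r.
by rewrite ler_peMr // !mulr_ge0 // ltW.
Qed.

End Precision.

Lemma result_solution (K : bmi) (k : nat) : is_solution [set e in result K k].
Proof.
have [/andP[ri rc] ur _] := result_spec K k; rewrite /is_solution ri /=.
rewrite -(ler_pM2l (denomQ_gt0 K)) -sum_scost -sbudgetE ler_int -big_list_set //.
Qed.

Lemma result_profit (K : bmi) (k : nat) : (0 < k)%N ->
  (k%:R - 5) * OPT K <= k%:R * set_profit [set e in result K k] :> rat.
Proof.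
move=> k0; rewrite /OPT.
have sol0 : @is_solution K set0.
  rewrite /is_solution /set_cost big_set0 ltW ?budget_gt0 // andbT.
  by case: (indep_matroid K).
case: (arg_maxP (fun X => @set_profit K X) sol0) => S /andP[SI cS] Smax.
have intE (A : {set ground K}) : (\sum_(e in A) scost e <= sbudget K) = (set_cost A <= budget K).
  by rewrite -(ler_int rat) sum_scost sbudgetE ler_pM2l ?denomQ_gt0.
have := @result_opt K k k0 S SI; rewrite intE => /(_ cS) h.
have [_ ur _] := result_spec K k.
have h2 : forall S' : {set ground K}, S' \in indep K -> \sum_(e in S') scost e <= sbudget K ->
      \sum_(e in S') sprofit e <= \sum_(e in S) sprofit e.
  move=> S' S'I; rewrite intE => cS'.
  rewrite -(ler_int rat) !sum_sprofit ler_pM2l ?denomQ_gt0 //.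
  by apply: Smax; rewrite /is_solution S'I.
have {h2}h := h h2.
move: h; rewrite /psum big_list_set // -(ler_int rat) !rmorphM rmorphB /= !sum_sprofit.
rewrite mulrCA [leRHS]mulrCA ler_pM2l ?denomQ_gt0 //.
Qed.

Theorem theorem1p1 (R : realType) :
  exists (prog : program) (A : R) (P : {poly R}),
  forall (K : bmi) (eps : R), 0 < eps -> eps < 1 / 2 ->
  exists (s : seq (ground K)) (t : nat),
    [/\ runs prog K eps (seq_code s) t,
        t%:R <= 2 `^ (A * (eps ^- 2 * ln (1 / eps))) * P.[(instance_size K)%:R],
        is_solution [set e in s]
      & (1 - eps) * ratr (OPT K) <= ratr (set_profit [set e in s])].
Proof.
have [a [e hpoly]] := poly_part_bounded.
exists bmi_prog, (36 * (e + 21)%:R / ln 2).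
exists (a%:R *: (('X + 2%:P) ^+ 2 + 1%:P) ^+ e) => K eps eps0 eps1.
have [k [k0 k5 k6 kP]] := precision_exists eps0 eps1.
set N := instance_size K; pose M := (N.+2 * N.+2 + k)%N.
have [t le_t run] := ev_call (main_call k0 kP (leqnn M))
  (@ev_var (mem_oracle K) (eps_oracle eps) [:: instance_code K] 0 _ erefl).
exists (result K k), t; split.
- exact: run.
- have le1 : (t <= a * (N.+2 * N.+2 + 1) ^ e * 2 ^ ((e + 21) * (k * k)))%N.
    apply: leq_trans le_t _; rewrite addnC.
    apply: leq_trans (total_cost_le _ _) _.
    apply: leq_trans (leq_mul (hpoly M) (leqnn _)) _.
    apply: leq_trans (leq_mul (leqnn _) (eps_part_le e k0)).
    rewrite mulnA leq_mul2r; apply/orP; right.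
    rewrite -mulnA leq_mul2l -expnMn; apply/orP; right.
    case: (e) => // e'; rewrite leq_exp2r // /M.
    by move: (N.+2 * N.+2)%N => n; nia.
  rewrite mulrC; apply: (@le_trans _ _
    (a * (N.+2 * N.+2 + 1) ^ e * 2 ^ ((e + 21) * (k * k)))%N%:R); first by rewrite ler_nat.
  rewrite natrM; apply: ler_pM; rewrite ?ler0n //; last exact: precision_cost.
  rewrite hornerZ horner_exp hornerD horner_exp hornerD hornerX !hornerC natrM natrX natrD natrM.
  rewrite le_eqVlt; apply/orP; left; apply/eqP; congr (_ * _ ^+ _).
  by rewrite -[N.+2]addn2 natrD expr2.
- exact: result_solution.
have := result_profit K k0; rewrite -(ler_rat R) !rmorphM rmorphB /= !ratr_nat => h.
have opt0 : 0 <= ratr (OPT K) :> R.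
  rewrite ler0q /OPT /set_profit; apply: sumr_ge0 => x _; exact: profit_ge0.
have kR : 0 < k%:R :> R by rewrite ltr0n.
rewrite -(ler_pM2l kR); apply: le_trans h; rewrite mulrA ler_wpM2r //.
by rewrite mulrBr mulr1 lerD2l lerN2.
Qed.
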